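(* Let $s\in\mathbb N$, $\alpha\in\mathbb N$ with $\alpha\ge2$, and let $F\in H_{\alpha,0,\rho,s}(\mathbb R^s)$. Let $P_{n,\alpha}=\{y^{(0)},\dots,y^{(n-1)}\}\subset[0,1)^s$ be the point set of an interlaced polynomial lattice rule of order $\alpha$ with $n=2^m$ points, $m\in\mathbb N$, which satisfies the unit-cube error bound stated in the context. Then, for any $\lambda\in[1,\alpha)$, taking $T=2+2\sqrt{\lambda\ln n}$, the rule $$Q_{s,n}(F)=\frac{(2T)^s}{n}\sum_{i=0}^{n-1}F(\mathbf T(y^{(i)}))\,\rho(\mathbf T(y^{(i)})),\qquad \mathbf T(y)=(2Ty_1-T,\dots,2Ty_s-T),$$ satisfies $$\Big|\int_{\mathbb R^s}F(y)\rho(y)\,dy-Q_{s,n}(F)\Big|\le C_{\alpha,\lambda,s}\,\frac{(\ln n)^{(\alpha/2+1/4)s}}{n^\lambda}\,\|F\|_{H_{\alpha,0,\rho,s}(\mathbb R^s)},$$ where $C_{\alpha,\lambda,s}$ is the constant, independent of $F$ and $n$, defined in the context.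
   Context: $\rho$ denotes $\rho(y)=e^{-y^2/2}/\sqrt{2\pi}$ in one variable and the product $\prod_{j=1}^s\rho(y_j)$ in $s$ variables. **Space $H_{\alpha,0,\rho,s}(\mathbb R^s)$.** For $s=1$, $H_{\alpha,0,\rho}(\mathbb R)$ consists of functions integrable w.r.t. $\rho$, with $F(0)=0$, absolutely continuous derivatives up to order $\alpha-1$ on bounded intervals and $\int_{\mathbb R}|F^{(\alpha)}|^2\rho<\infty$, with inner product $\sum_{r=1}^{\alpha-1}F^{(r)}(0)G^{(r)}(0)+\int_{\mathbb R}F^{(\alpha)}G^{(\alpha)}\rho\,dy$. It is a reproducing kernel Hilbert space with kernel $$K_{\alpha,0,\rho}(x,y)=\sum_{r=1}^{\alpha-1}\frac{x^r}{r!}\frac{y^r}{r!}+\mathbf 1\{xy>0\}\int_0^{\min\{|x|,|y|\}}\frac{(|x|-t)^{\alpha-1}}{(\alpha-1)!}\frac{(|y|-t)^{\alpha-1}}{(\alpha-1)!}\frac{dt}{\rho(t)}.$$ $H_{\alpha,0,\rho,s}(\mathbb R^s)$ is the tensor product space (kernel $\prod_{j=1}^sK_{\alpha,0,\rho}(x_j,y_j)$), with norm $\|F\|^2=\sum_{\bm\tau\in\{1,\dots,\alpha\}^s}\int_{\mathbb R^{|\mathfrak v|}}|F^{(\bm\tau)}(y_{\mathfrak v})|^2\prod_{j\in\mathfrak v}\rho(y_j)\,dy_{\mathfrak v}$, where $\mathfrak v=\{j:\tau_j=\alpha\}$ and $y_{\mathfrak v}$ has components $0$ outside $\mathfrak v$.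 **Interlaced polynomial lattice rule.** A polynomial lattice point set over $\mathbb Z_2$ with irreducible modulus $p\in\mathbb Z_2[\chi]$, $\deg p=m$, and generating vector $(q_1,\dots,q_{s'})$, $\deg q_j<m$, consists of the $2^m$ points in $[0,1)^{s'}$ with $j$th coordinate $\vartheta_m(k(\chi)q_j(\chi)/p(\chi))$, $0\le k<2^m$, where $k=\sum\kappa_i2^i$ is identified with $k(\chi)=\sum\kappa_i\chi^i$ and $\vartheta_m(\sum_{i\ge\ell}w_i\chi^{-i})=\sum_{i=\max(1,\ell)}^mw_i2^{-i}$ on formal Laurent series. Interlaced of order $\alpha$: take such a set in $\alpha s$ dimensions and map each consecutive block of $\alpha$ coordinates $x_j=\sum_{i\ge1}\xi_{i,j}2^{-i}$ to $\sum_{i\ge1}\sum_{j=1}^\alpha\xi_{i,j}2^{-\alpha(i-1)-j}$, giving a point set in $[0,1)^s$. **Unit-cube error bound.** The point set is such that for all $\lambda\in[1,\alpha)$ and all $f\in H_{\alpha,s}([0,1]^s)$, $|\int_{[0,1]^s}f(y)\,dy-\frac1n\sum_if(y^{(i)})|\le\widetilde C_{\alpha,\lambda,s}n^{-\lambda}\|f\|_{H_{\alpha,s}([0,1]^s)}$, with $\widetilde C_{\alpha,\lambda,s}=4^\lambda2^{\alpha(\alpha-1)s/2}\big[(1+\tfrac1{2^{\alpha/\lambda}-2})^{\alpha s}-1\big]^\lambda$. Here $H_{\alpha,s}([0,1]^s)$ is the $s$-fold tensor product of the space of functions on $[0,1]$ with absolutely continuous derivatives up to order $\alpha-1$ and square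 integrable $\alpha$th derivative, with inner product $\sum_{r=0}^{\alpha-1}\int_0^1f^{(r)}\int_0^1g^{(r)}+\int_0^1f^{(\alpha)}g^{(\alpha)}$. (Such rules exist for every $m$.) **Constants.** $C_{\alpha,\lambda,s}=\max\Big\{\frac{C_{3,\alpha,s}}{2\sqrt{\lambda\ln2}},\,C_{4,\alpha,\lambda,s}\big(\tfrac{2}{\sqrt{\ln2}}+2\sqrt\lambda\big)^{(\alpha+1/2)s}\Big\}$, with $C_{3,\alpha,s}=2sM^{s-1}\sqrt{\alpha/2}\,\frac{2e}{(2\pi)^{1/4}}$, $M=\int_{\mathbb R}K_{\alpha,0,\rho}(y,y)^{1/2}\rho(y)\,dy$, $C_{4,\alpha,\lambda,s}=2^s\widetilde C_{\alpha,\lambda,s}C_{1,\alpha}^s$, $C_{1,\alpha}=\alpha!\,2^{3\alpha}\big(\alpha(1+\alpha/2)\tfrac1{\sqrt{2\pi}}\Gamma(2\alpha)I_0(1/2)\big)^{1/2}$, where $I_0$ is the modified Bessel function of the first kind of order $0$. *)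

(* Defs.v *)
From HB Require Import structures.
From mathcomp Require Import all_boot all_order all_algebra.
From mathcomp Require Import all_classical all_reals all_analysis.

Set Implicit Arguments.
Unset Strict Implicit.
Unset Printing Implicit Defensive.
Import Order.TTheory GRing.Theory Num.Theory.
Import numFieldNormedType.Exports.

Local Open Scope classical_set_scope.
Local Open Scope ring_scope.

(* R^n, with the product sigma-algebra of the Borel sigma-algebra of R *)
Notation Rtuple R n := (n.-tuple (measurableTypeR R)).

Section lebesgue_tuple.
Context {R : realType}.

Definition cons_pair n (x : measurableTypeR R * Rtuple R n) : Rtuple R n.+1 :=
  [tuple of x.1 :: x.2].

Lemma measurable_cons_pair n : measurable_fun setT (@cons_pair n).
Proof. exact: measurable_cons. Qed.

Section succ.
Variables (n : nat) (mu : {sigma_finite_measure set (Rtuple R n) -> \bar R}).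

(* The image of lebesgue_measure \x mu under the bijection R * R^n -> R^n.+1. *)
Definition lebesgue_cons : set (Rtuple R n.+1) -> \bar R :=
  pushforward (lebesgue_measure \x mu)%E (@cons_pair n).

Let lebesgue_cons0 : lebesgue_cons set0 = 0%E.
Proof. by rewrite /lebesgue_cons /pushforward preimage_set0 measure0. Qed.

Let measurable_preimage (A : set (Rtuple R n.+1)) :
  measurable A -> measurable (@cons_pair n @^-1` A).
Proof. by move=> mA; rewrite -[X in measurable X]setTI; exact: measurable_cons_pair. Qed.

Let lebesgue_cons_ge0 A : (0 <= lebesgue_cons A)%E.
Proof. by rewrite /lebesgue_cons /pushforward; apply: measure_ge0. Qed.

Let lebesgue_cons_sigma_additive : semi_sigma_additive lebesgue_cons.
Proof.
move=> F mF tF mUF; rewrite /lebesgue_cons /pushforward preimage_bigcup.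
apply: measure_semi_sigma_additive.
- by move=> k; exact: measurable_preimage.
- apply/trivIsetP => i j _ _ ij; rewrite -preimage_setI.
  by move/trivIsetP : tF => /(_ _ _ I I ij) ->; rewrite preimage_set0.
- by rewrite -preimage_bigcup; exact: measurable_preimage.
Qed.

HB.instance Definition _ := isMeasure.Build _ _ _ lebesgue_cons
  lebesgue_cons0 lebesgue_cons_ge0 lebesgue_cons_sigma_additive.

Let lebesgue_cons_sigma_finite : sigma_finite setT lebesgue_cons.
Proof.
have /sigma_finiteP[F [TF ndF Foo]] := sigma_finiteT (@lebesgue_measure R).
have /sigma_finiteP[G [TG ndG Goo]] := sigma_finiteT mu.
pose uncons (y : Rtuple R n.+1) : measurableTypeR R * Rtuple R n :=
  (thead y, [tuple of behead y]).
have muncons : measurable_fun setT uncons.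
  apply/measurable_fun_pair => /=; first exact: measurable_tnth.
  exact: measurable_behead.
have unconsK : uncons \o @cons_pair n = id.
  by apply/funext => -[a b]; congr (_, _); exact/val_inj.
exists (fun k => uncons @^-1` (F k `*` G k)).
  rewrite -preimage_bigcup -[LHS](preimage_setT uncons); congr (_ @^-1` _).
  rewrite -setXTT TF TG predeqE => -[x y]; split => [|[k _ []]/=]; last first.
    by split; exists k.
  move=> [/= [k _ Fkx] [l _ Gly]]; exists (maxn k l) => //; split.
  - by move: x Fkx; exact/subsetPset/ndF/leq_maxl.
  - by move: y Gly; exact/subsetPset/ndG/leq_maxr.
move=> k; have [mF Fk] := Foo k; have [mG Gk] := Goo k; split.
  by rewrite -[X in measurable X]setTI; apply: muncons => //; exact: measurableX.
rewrite /lebesgue_cons /pushforward -comp_preimage unconsK preimage_id.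
by rewrite product_measure1E// lte_mul_pinfty// ge0_fin_numE.
Qed.

HB.instance Definition _ := Measure_isSigmaFinite.Build _ _ _ lebesgue_cons
  lebesgue_cons_sigma_finite.

End succ.

Fixpoint lebesgue_tuple n : {sigma_finite_measure set (Rtuple R n) -> \bar R} :=
  if n is n'.+1 then lebesgue_cons (lebesgue_tuple n') else dirac [tuple].

End lebesgue_tuple.
Arguments lebesgue_tuple R n : clear implicits.

Section sobolev_spaces.
Context {R : realType}.
Implicit Types f g : R -> R.

Definition rho (x : R) : R := expR (- (x ^+ 2 / 2)) / Num.sqrt (2 * pi).

Definition abs_cont (a b : R) f : Prop :=
  forall e : R, 0 < e -> exists2 d : R, 0 < d &
    forall (n : nat) (I : 'I_n -> R * R),
      (forall i, a <= (I i).1 /\ (I i).1 <= (I i).2 /\ (I i).2 <= b) ->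
      trivIset setT (fun i => [set` `](I i).1, (I i).2[]) ->
      \sum_i ((I i).2 - (I i).1) < d ->
      \sum_i `|f (I i).2 - f (I i).1| < e.

(* Derivative of f as a function on A: it is one-sided at the end points when
   A is a compact interval. Where the limit does not exist the value is
   irrelevant, as for f^`(). *)
Definition derivable_within (A : set R) f (x : R) : Prop :=
  cvg ((f y - f x) / (y - x) @[y --> within A x^']).
Definition derive_within (A : set R) f (x : R) : R :=
  lim ((f y - f x) / (y - x) @[y --> within A x^']).

(* An inner product space of real functions on a subset of R. Its elements are
   represented by total functions of which only the restriction to fs_dom
   matters. *)
Record fun_space := FunSpace {
  fs_dom : set R ;
  fs_mem : (R -> R) -> Prop ;
  fs_dot : (R -> R) -> (R -> R) -> R }.

(* H_{alpha,0,rho}(R). The derivative of order alpha exists almost everywhere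
   only, all the others exist everywhere. *)
Definition H_rho_mem (alpha : nat) f : Prop :=
  [/\ lebesgue_measure.-integrable setT (fun x => (f x * rho x)%:E),
      f 0 = 0,
      forall r x, (r.+1 < alpha)%N -> derivable (derive1n r f) x 1,
      forall r a b, (r < alpha)%N -> abs_cont a b (derive1n r f) &
      lebesgue_measure.-integrable setT
        (fun x => (derive1n alpha f x ^+ 2 * rho x)%:E)].

Definition H_rho_dot (alpha : nat) f g : R :=
  \sum_(1 <= r < alpha) derive1n r f 0 * derive1n r g 0 +
  \int[lebesgue_measure]_x (derive1n alpha f x * derive1n alpha g x * rho x).

Definition H_rho (alpha : nat) : fun_space :=
  FunSpace setT (H_rho_mem alpha) (H_rho_dot alpha).

Definition derive_unit (r : nat) f : R -> R := iter r (derive_within `[0, 1]) f.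

Definition H_unit_mem (alpha : nat) f : Prop :=
  [/\ forall r x, (r.+1 < alpha)%N -> 0 <= x <= 1 ->
        derivable_within `[0, 1] (derive_unit r f) x,
      forall r, (r < alpha)%N -> abs_cont 0 1 (derive_unit r f) &
      lebesgue_measure.-integrable `[0, 1]
        (fun x => (derive_unit alpha f x ^+ 2)%:E)].

Definition H_unit_dot (alpha : nat) f g : R :=
  \sum_(0 <= r < alpha)
    (\int[lebesgue_measure]_(x in `[0, 1]) derive_unit r f x) *
    (\int[lebesgue_measure]_(x in `[0, 1]) derive_unit r g x) +
  \int[lebesgue_measure]_(x in `[0, 1])
    (derive_unit alpha f x * derive_unit alpha g x).

Definition H_unit (alpha : nat) : fun_space :=
  FunSpace `[0, 1] (H_unit_mem alpha) (H_unit_dot alpha).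

End sobolev_spaces.
Arguments fun_space R : clear implicits.
Arguments H_rho R alpha : clear implicits.
Arguments H_unit R alpha : clear implicits.

(* The s-fold Hilbert tensor product of a space H of functions on D with
   continuous point evaluations, realized as a space of functions on D^s: the
   completion of the algebraic tensor product, a Cauchy sequence of which is
   identified with its pointwise limit. *)
Section tensor_power.
Context {R : realType} (H : fun_space R) (s : nat).

(* [:: (c_k, (f_{k,1}, ..., f_{k,s}))]_k stands for
   \sum_k c_k f_{k,1} \otimes ... \otimes f_{k,s} *)
Definition tensor : Type := seq (R * ('I_s -> {f : R -> R | fs_mem H f})).

Definition tensor_eval (u : tensor) (y : s.-tuple R) : R :=
  \sum_(t <- u) t.1 * \prod_(j < s) sval (t.2 j) (tnth y j).

Definition tensor_dot (u v : tensor) : R :=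
  \sum_(t <- u) \sum_(t' <- v)
    t.1 * t'.1 * \prod_(j < s) fs_dot H (sval (t.2 j)) (sval (t'.2 j)).

Definition tensor_sqdist (u v : tensor) : R :=
  tensor_dot u u - tensor_dot u v *+ 2 + tensor_dot v v.

Definition tensor_cauchy (u : nat -> tensor) : Prop :=
  forall e : R, 0 < e ->
    exists N, forall k l, (N <= k)%N -> (N <= l)%N -> tensor_sqdist (u k) (u l) < e.

Definition tensor_represents (u : nat -> tensor) (F : s.-tuple R -> R) : Prop :=
  tensor_cauchy u /\
  forall y : s.-tuple R, (forall j, fs_dom H (tnth y j)) ->
    tensor_eval (u k) y @[k --> \oo] --> F y.

Definition tensor_mem (F : s.-tuple R -> R) : Prop :=
  exists u, tensor_represents u F.

(* Continuity of point evaluations makes the limit of the norms independent of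
   the representing sequence: the set below is a singleton if F is in the
   space. *)
Definition tensor_norm (F : s.-tuple R -> R) : R :=
  inf [set N : R | exists2 u, tensor_represents u F &
    Num.sqrt (tensor_dot (u k) (u k)) @[k --> \oo] --> N].

End tensor_power.

Section interlaced_polynomial_lattice.

Definition binary_poly (k : nat) : {poly 'F_2} :=
  \poly_(i < k) (odd (k %/ 2 ^ i))%:R.

(* For i > 0, the coefficient of X^-i in the Laurent expansion of a / p in
   powers of X^-1: the constant coefficient of the polynomial part of
   X^i a / p. *)
Definition laurent_coef (a p : {poly 'F_2}) (i : nat) : 'F_2 :=
  ((a * 'X^i) %/ p)`_0.

(* Polynomial part of X^N a / p, i.e., a / p is approximated by the truncation
   of its expansion at X^-N with an error r / p X^-N, size r < size p. *)
Lemma laurent_coefE (a p : {poly 'F_2}) (N : nat) : p != 0 ->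
  (a * 'X^N) %/ p =
  (a %/ p) * 'X^N + \sum_(1 <= i < N.+1) laurent_coef a p i *: 'X^(N - i).
Proof.
move=> p0; elim: N => [|N IH].
  by rewrite expr0 !mulr1 big_nil addr0.
have step : (a * 'X^(N.+1)) %/ p =
    (a * 'X^N) %/ p * 'X + (laurent_coef a p N.+1)%:P.
  have E : (a * 'X^(N.+1)) %/ p =
      (a * 'X^N) %/ p * 'X + ((a * 'X^N) %% p * 'X) %/ p.
    rewrite exprSr mulrA {1}(divp_eq (a * 'X^N) p) mulrDl mulrAC.
    by rewrite divpD mulpK.
  have [c cE] : exists c, ((a * 'X^N) %% p * 'X) %/ p = c%:P.
    exists ((((a * 'X^N) %% p * 'X) %/ p)`_0); apply: size1_polyC.
    rewrite size_divp// leq_subLR.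
    apply: leq_trans (size_polyMleq _ _) _; rewrite size_polyX addn2/=.
    by rewrite addn1 prednK ?size_poly_gt0// ltn_modp.
  by rewrite /laurent_coef E cE coefD coefMX/= coefC/= add0r.
rewrite step IH mulrDl -mulrA -exprSr -addrA; congr (_ + _).
rewrite [RHS]big_nat_recr//= subnn expr0 alg_polyC; congr (_ + _).
rewrite mulr_suml; apply: eq_big_nat => i /andP[_ iN].
by rewrite -scalerAl -exprSr subSn.
Qed.

Context {R : realType}.

Definition vartheta (m : nat) (w : nat -> 'F_2) : R :=
  \sum_(1 <= i < m.+1) (w i : nat)%:R / 2 ^+ i.

Definition poly_lattice_point (m : nat) (p : {poly 'F_2}) (d : nat)
    (q : d.-tuple {poly 'F_2}) (k : nat) : d.-tuple R :=
  [tuple vartheta m (laurent_coef (binary_poly k * tnth q j) p) | j < d].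

Definition binary_digit (x : R) (i : nat) : bool := odd (Num.truncn (x * 2 ^+ i)).

(* The coordinates x_l, l < alpha, are numbered from 0. *)
Definition interlace (alpha : nat) (x : nat -> R) : R :=
  limn (fun N => \sum_(1 <= i < N) \sum_(l < alpha)
    (binary_digit (x l) i)%:R / 2 ^+ (alpha * (i - 1) + l.+1) : R).

Definition interlaced_point (m alpha s : nat) (p : {poly 'F_2})
    (q : (alpha * s).-tuple {poly 'F_2}) (k : nat) : s.-tuple R :=
  let x := poly_lattice_point m p q k in
  [tuple interlace alpha (fun l => nth 0 x (alpha * j + l)) | j < s].

End interlaced_polynomial_lattice.

Section error_bound.
Context {R : realType}.

Definition unit_cube (s : nat) : set (Rtuple R s) :=
  [set y | forall j, 0 <= tnth y j <= 1].
Arguments unit_cube : clear implicits.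

Definition Ctilde (alpha : nat) (lambda : R) (s : nat) : R :=
  4 `^ lambda * 2 `^ ((alpha * (alpha - 1) * s)%:R / 2) *
  ((1 + 1 / (2 `^ (alpha%:R / lambda) - 2)) ^+ (alpha * s) - 1) `^ lambda.

Definition unit_cube_error_bound (alpha s n : nat) (y : nat -> s.-tuple R) : Prop :=
  forall lambda : R, 1 <= lambda < alpha%:R ->
  forall f : s.-tuple R -> R, tensor_mem (H_unit R alpha) f ->
  `| \int[lebesgue_tuple R s]_(x in unit_cube s) f x
     - n%:R^-1 * \sum_(i < n) f (y i) | <=
  Ctilde alpha lambda s * n%:R `^ (- lambda) * tensor_norm (H_unit R alpha) f.

Definition kernel_rho (alpha : nat) (x y : R) : R :=
  \sum_(1 <= r < alpha) x ^+ r / r`!%:R * (y ^+ r / r`!%:R) +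
  (if 0 < x * y then
     \int[lebesgue_measure]_(t in `[0, Num.min `|x| `|y|])
       ((`|x| - t) ^+ alpha.-1 / alpha.-1`!%:R *
        ((`|y| - t) ^+ alpha.-1 / alpha.-1`!%:R) / rho t)
   else 0).

Definition Mconst (alpha : nat) : R :=
  \int[lebesgue_measure]_y (Num.sqrt (kernel_rho alpha y y) * rho y).

Definition Gamma (x : R) : R :=
  \int[lebesgue_measure]_(t in `]0, +oo[) (t `^ (x - 1) * expR (- t)).

Definition bessel_I0 (x : R) : R :=
  limn (series (fun k => ((x / 2) ^+ k / k`!%:R) ^+ 2)).

Definition C1 (alpha : nat) : R :=
  alpha`!%:R * 2 ^+ (3 * alpha) *
  Num.sqrt (alpha%:R * (1 + alpha%:R / 2) * (1 / Num.sqrt (2 * pi)) *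
            Gamma (2 * alpha)%:R * bessel_I0 (1 / 2)).

Definition C3 (alpha s : nat) : R :=
  2 * s%:R * Mconst alpha ^+ (s - 1) * Num.sqrt (alpha%:R / 2) *
  (2 * expR 1 / (2 * pi) `^ (1 / 4)).

Definition C4 (alpha : nat) (lambda : R) (s : nat) : R :=
  2 ^+ s * Ctilde alpha lambda s * C1 alpha ^+ s.

Definition Cconst (alpha : nat) (lambda : R) (s : nat) : R :=
  Num.max (C3 alpha s / (2 * Num.sqrt (lambda * ln 2)))
    (C4 alpha lambda s *
     (2 / Num.sqrt (ln 2) + 2 * Num.sqrt lambda) `^ ((alpha%:R + 1 / 2) * s%:R)).

Definition rho_prod (s : nat) (y : s.-tuple R) : R := \prod_(j < s) rho (tnth y j).

Definition box_map (T : R) (s : nat) (y : s.-tuple R) : s.-tuple R :=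
  [tuple 2 * T * tnth y j - T | j < s].

Definition quadrature (T : R) (s n : nat) (y : nat -> s.-tuple R)
    (F : s.-tuple R -> R) : R :=
  (2 * T) ^+ s / n%:R *
  \sum_(i < n) F (box_map T (y i)) * rho_prod (box_map T (y i)).

End error_bound.

(* Main.v *)
Require Import Defs.
From HB Require Import structures.
From mathcomp Require Import all_boot all_order all_algebra.
From mathcomp Require Import all_classical all_reals all_analysis.
From mathcomp Require Import measurable_realfun ring lra zify.
Import Order.TTheory GRing.Theory Num.Theory.
Import numFieldNormedType.Exports.
Set Implicit Arguments.
Unset Strict Implicit.
Unset Printing Implicit Defensive.
Local Open Scope classical_set_scope.
Local Open Scope ring_scope.

(* Let u be a finite sum of tensors f_1 (x) ... (x) f_s and N its norm in H_rho.
   - The integral over R^s and the integral over [-T, T]^s act on u as tensor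
     powers of one-dimensional functionals of norm at most 16 * 2^alpha, whose
     difference has norm at most 16 * 2^alpha * exp (- (T / 2 - 1)^2), that is,
     16 * 2^alpha * n^-lambda. Telescoping the difference of the two products
     bounds the truncation error.
   - The map f |-> 2 T (f rho)(2 T y - T) sends H_rho to H_unit with norm at most
     3/2 C1 T^(alpha + 1/2), hence its tensor power sends u to an element of the
     tensor power of H_unit to which the error bound on the unit cube applies.
   Tensor powers of bounded maps are bounded because products of positive
   semidefinite kernels are positive semidefinite. Both bounds extend to the
   completion by dominated convergence. The factor 3/2, instead of 2, leaves room
   for the truncation error, so that only the second argument of the maximum in
   Cconst is needed.

   One-dimensional bounds rest on |f^(r)(x)| <= N 2^k e^(|x|/2) growth x, where
   k = alpha - 1 - r and growth x * rho x = exp (|x|/4 - x^2/4), and on Leibniz'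
   formula for (f rho)^(r). *)

(** The choice T = 2 + 2 sqrt(lambda ln n) makes (T / 2 - 1)^2 equal to lambda ln n, which turns the
    tail factor into n^-lambda. Membership in [H_rho] gives absolute continuity in epsilon-delta
    form, while the estimates use that the derivative of order alpha - 1 is the integral of an
    almost everywhere derivative. Hence the fundamental theorem of calculus for absolutely
    continuous functions, through Radon-Nikodym, and the measurability of derivatives, including the
    points where they take a default value. The function spaces carry no declared vector space
    structure: boundedness of a functional or of an operator is expressed on formal linear
    combinations, as an inequality between kernels, which is also the form that passes to tensor
    products. The norm of F is an infimum over the sequences of tensors that represent F, so the
    error is compared with the limit of the norms along each such sequence. The case alpha = 2 has
    its own pointwise bound, the general constant being too large there for comparison with [C1]. *)

Lemma eqW d (T : porderType d) (x y : T) : x = y -> (x <= y)%O.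
Proof. by move->. Qed.

(** * Absolutely continuous functions *)

Section absolute_continuity.
Context {R : realType}.
Implicit Types (f g : R -> R) (a b c d x y e : R).

(** The index type is arbitrary so that the cells of several partitions can be indexed by pairs.
    Open intervals make a degenerate interval empty, hence disjoint from the others: clipping may
    collapse intervals. *)
Definition disjoint_family (J : Type) (I : J -> R * R) :=
  (forall i, (I i).1 <= (I i).2) /\
  trivIset setT (fun i => [set` `](I i).1, (I i).2[] : set R).

(* Absolute continuity on the whole line, with one modulus: abs_cont on [a, b] is
   turned into it by composition with clip a b. *)
Definition uabs_cont g := forall e, 0 < e -> exists2 d, 0 < d &
  forall (J : finType) (I : J -> R * R), disjoint_family I ->
  \sum_i ((I i).2 - (I i).1) < d -> \sum_i `|g (I i).2 - g (I i).1| < e.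

Definition clip a b x := Num.min (Num.max x a) b.

Lemma clip_itv a b x : a <= b -> a <= clip a b x <= b.
Proof.
by move=> ab; rewrite /clip le_min le_max lexx orbT ab ge_min lexx orbT.
Qed.

Lemma clip_id a b x : a <= x <= b -> clip a b x = x.
Proof. by move=> /andP[? ?]; rewrite /clip; case: (leP x a) => ?; [case: (leP a b)|case: (leP x b)] => ?; lra. Qed.

Lemma clip_le a b x y : a <= b -> x <= y -> clip a b x <= clip a b y.
Proof.
move=> ab xy; rewrite /clip.
by rewrite le_min !ge_min lexx orbT andbT ge_max !le_max xy lexx orbT.
Qed.

Lemma clipB a b x y : a <= b -> x <= y -> clip a b y - clip a b x <= y - x.
Proof.
move=> ab xy; rewrite /clip.
by case: (leP x a) => ?; case: (leP y a) => ?; case: (leP a b) => ?;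
  case: (leP x b) => ?; case: (leP y b) => ?; lra.
Qed.

(** A number strictly between two clipped values lies in [[a, b]], where [clip] is the identity;
    monotonicity of [clip] carries the order back to [x] and [y]. *)
Lemma clip_oo a b x y z : a <= b -> clip a b x < z < clip a b y -> x < z < y.
Proof.
move=> ab /andP[xz zy].
have zc : clip a b z = z.
  apply: clip_id; rewrite (le_trans _ (ltW xz))/=; last by case/andP: (clip_itv x ab).
  by rewrite (le_trans (ltW zy))//; case/andP: (clip_itv y ab).
apply/andP; split; rewrite ltNge; apply/negP => h.
  by have := clip_le ab h; rewrite zc leNgt xz.
by have := clip_le ab h; rewrite zc leNgt zy.
Qed.

Lemma disjoint_family_clip a b (J : Type) (I : J -> R * R) : a <= b ->
  disjoint_family I ->
  disjoint_family (fun i => (clip a b (I i).1, clip a b (I i).2)).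
Proof.
move=> ab [I12 tI]; split=> [i/=|i j _ _ [z []]]; first exact: clip_le.
rewrite /= !in_itv/= => /(clip_oo ab) zi /(clip_oo ab) zj.
by apply: (tI i j) => //; exists z; rewrite /= !in_itv/=.
Qed.

Lemma abs_cont_uabs_cont a b f : a <= b -> abs_cont a b f ->
  uabs_cont (f \o clip a b).
Proof.
move=> ab + e e0 => /(_ e e0)[d d0 H]; exists d => // J I dI Id.
have [I12 tI] := disjoint_family_clip ab dI.
rewrite (reindex (enum_val : 'I_#|J| -> J))/=; last first.
  by apply: onW_bij; exact: enum_val_bij.
apply: (H _ (fun i => (clip a b (I (enum_val i)).1, clip a b (I (enum_val i)).2))).
- by move=> i; have /andP[-> _] := clip_itv (I (enum_val i)).1 ab;
    have /andP[_ ->] := clip_itv (I (enum_val i)).2 ab; rewrite I12.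
- by move=> i j _ _ /= ij; apply: enum_val_inj; exact: tI.
- apply: le_lt_trans Id; rewrite [leRHS](reindex (enum_val : 'I_#|J| -> J))/=; last first.
    by apply: onW_bij; exact: enum_val_bij.
  apply: ler_sum => i _ /=; apply: clipB; [exact: ab|exact: dI.1].
Qed.

Lemma itv_partition_family c d s (P : 'I_(size s) -> R * R) :
  itv_partition c d s ->
  P = (fun k => (nth d (c :: s) k, nth d (c :: s) k.+1)) ->
  [/\ disjoint_family P, forall k, c <= (P k).1 /\ (P k).2 <= d,
     \sum_k ((P k).2 - (P k).1) = d - c &
     forall g, variation c d g s = \sum_k `|g (P k).2 - g (P k).1|].
Proof.
move=> cds ->; split => /=.
- have [sc _] := cds.
  have mono (i j : nat) : (i <= j)%N -> (j <= size s)%N ->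
      nth d (c :: s) i <= nth d (c :: s) j.
    rewrite leq_eqVlt => /predU1P[->//|ij] js; apply/ltW.
    have sj : (j < size (c :: s))%N by rewrite /= ltnS.
    by rewrite (lt_sorted_ltn_nth d (sc : sorted <%O (c :: s)))// inE (ltn_trans ij).
  split; first by move=> k /=; apply: (mono k k.+1) => //; exact: ltnW.
  move=> i j _ _ [z []].
  rewrite /= !in_itv/= => /andP[iz zi] /andP[jz zj]; apply: val_inj => /=.
  case: (ltngtP i j) => // ij.
    by have := mono _ _ ij (ltnW (ltn_ord j)); rewrite leNgt (lt_trans jz zi).
  by have := mono _ _ ij (ltnW (ltn_ord i)); rewrite leNgt (lt_trans iz zj).
- move=> k; split; first by apply: itv_partition_nth_ge => //; rewrite ltnS ltnW.
  by apply: (@itv_partition_nth_le _ _ c d s k.+1) => //; rewrite ltnS.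
- rewrite -(big_mkord xpredT (fun k => nth d (c :: s) k.+1 - nth d (c :: s) k)).
  by rewrite telescope_sumr//= -[X in X - _]/(nth d (c :: s) (size s)) (itv_partition_nth_size d cds).
- by move=> g; rewrite /variation big_mkord.
Qed.

(** Over a length below the modulus for 1 every variation sum is below 1; [[c, d]] is covered by
    finitely many steps of half that length, along which total variations add up. *)
Lemma uabs_cont_bounded_variation g c d : uabs_cont g -> c <= d ->
  bounded_variation c d g.
Proof.
move=> /(_ 1 ltr01)[e e0 H].
have base x y : x <= y -> y - x < e -> bounded_variation x y g.
  move=> xy yx; exists 1 => _ [s xys <-].
  have [dP _ PE ->] := itv_partition_family xys erefl.
  by apply/ltW/H => //; rewrite PE.
have step k x y : x <= y -> y - x <= (e / 2) *+ k -> bounded_variation x y g.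
  elim: k x y => [|k IH] x y xy yx.
    by apply: base => //; rewrite (le_lt_trans yx).
  have [yxe|yxe] := leP (y - x) (e / 2); first by apply: base => //; lra.
  have xz : x <= x + e / 2 by lra.
  have zy : x + e / 2 <= y by lra.
  apply/bounded_variationP => //; rewrite (total_variationD _ xz zy) fin_numD.
  apply/andP; split; apply/bounded_variationP => //; first by apply: base; lra.
  by apply: IH => //; rewrite mulrS in yx; lra.
move=> cd; pose n := (Num.truncn ((d - c) / (e / 2))).+1.
apply: (step n) => //; rewrite -mulr_natl -ler_pdivrMr; last lra.
by apply/ltW; rewrite truncnS_gt.
Qed.

(** In each interval a partition is chosen whose variation nearly attains the total variation. The
    cells of all these partitions form one disjoint family of the same total length, to which
    absolute continuity of [g] applies. *)
Lemma uabs_cont_total_variation g e : uabs_cont g -> 0 < e ->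
  exists2 d, 0 < d & forall (J : finType) (I : J -> R * R), disjoint_family I ->
  \sum_i ((I i).2 - (I i).1) < d ->
  \sum_i fine (total_variation (I i).1 (I i).2 g) < e.
Proof.
move=> gAC e0; have e20 : 0 < e / 2 by lra.
have [d d0 H] := gAC _ e20; exists d => // J I [I12 tI] Id.
(* Summed over [J] the defects are at most [e / 2]; the successor keeps the denominator positive
   when [J] is empty. *)
pose eta := e / 2 / #|J|.+1%:R.
have eta0 : 0 < eta by rewrite divr_gt0.
have TVfin i : total_variation (I i).1 (I i).2 g \is a fin_num.
  by apply/bounded_variationP => //; exact: uabs_cont_bounded_variation.
have /choice[s sP] : forall i, exists s, itv_partition (I i).1 (I i).2 s /\
    fine (total_variation (I i).1 (I i).2 g) - eta < variation (I i).1 (I i).2 g s.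
  move=> i; have [_ [_ [s ? <-] <-]] := ub_ereal_sup_adherent eta0 (TVfin i).
  by rewrite -[X in (X - _)%E](fineK (TVfin i)) lte_fin => ?; exists s.
pose P i (k : 'I_(size (s i))) :=
  (nth (I i).2 ((I i).1 :: s i) k, nth (I i).2 ((I i).1 :: s i) k.+1).
have PP i := itv_partition_family (sP i).1 (erefl (P i)).
pose K : finType := {i : J & 'I_(size (s i))}.
have sumK (G : forall i, 'I_(size (s i)) -> R) :
    \sum_(k : K) G (tag k) (tagged k) = \sum_i \sum_(k < size (s i)) G i k.
  by rewrite sig_big_dep.
have : \sum_(k : K) `|g (P (tag k) (tagged k)).2 - g (P (tag k) (tagged k)).1| < e / 2.
  apply: (H _ (fun k : K => P (tag k) (tagged k))).
    split=> [[i k]/=|[i k] [j l] _ _ [z []]]; first by have [[P12 _] _ _ _] := PP i; exact: P12.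
    rewrite /= !in_itv/= => /andP[iz zi] /andP[jz zj].
    have [[_ tPi] Pi _ _] := PP i; have [[_ tPj] Pj _ _] := PP j.
    have ij : i = j.
      apply: tI => //; exists z; rewrite /= !in_itv/=; split; apply/andP; split.
      - exact: le_lt_trans (Pi k).1 iz.
      - exact: lt_le_trans zi (Pi k).2.
      - exact: le_lt_trans (Pj l).1 jz.
      - exact: lt_le_trans zj (Pj l).2.
    move: l jz zj; rewrite -ij => l jz zj; congr existT; apply: tPi => //.
    by exists z; rewrite /= !in_itv/= iz zi jz zj.
  rewrite (sumK (fun i k => (P i k).2 - (P i k).1)).
  apply: le_lt_trans Id; apply: ler_sum => i _.
  by have [_ _ -> _] := PP i.
rewrite (sumK (fun i k => `|g (P i k).2 - g (P i k).1|)).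
have sE i : \sum_(k < size (s i)) `|g (P i k).2 - g (P i k).1| =
  variation (I i).1 (I i).2 g (s i) by have [_ _ _ /(_ g)->] := PP i.
under eq_bigr do rewrite sE.
move=> Hs; rewrite [ltRHS](splitr e).
apply: (@le_lt_trans _ _ (\sum_i (variation (I i).1 (I i).2 g (s i) + eta))).
  by apply: ler_sum => i _; have [_] := sP i; lra.
rewrite big_split/= ltr_leD// sumr_const -(mulr_natr eta) /eta -mulrA ger_pMr//.
by rewrite mulrC ler_pdivrMr// mul1r ler_nat.
Qed.

End absolute_continuity.

(* An open set is an increasing union of finite unions of dyadic cells, so that
   absolute continuity of F bounds its Stieltjes measure on open sets. *)
Section dyadic_cells.
Context {R : realType}.
Local Notation mu := (@lebesgue_measure R).
Implicit Types (U : set R) (x e d : R) (F : cumulative R R).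

Lemma lebesgue_stieltjes_measure_itv_oc F x y : x <= y ->
  lebesgue_stieltjes_measure F `]x, y] = (F y - F x)%:E.
Proof.
move=> xy; rewrite /lebesgue_stieltjes_measure /measure_extension.
rewrite measurable_mu_extE/=; last exact: is_ocitv.
by rewrite wlength_itv_bnd.
Qed.

(** Half-open cells: those of one level partition the line, and on such intervals the Stieltjes
    measure of [F] is the increment of [F]. *)
Definition dyadic n (j : int) : set R := `]j%:~R / 2 ^+ n, (j + 1)%:~R / 2 ^+ n].

Lemma dyadicE n j x : dyadic n j x <-> j%:~R < x * 2 ^+ n <= (j + 1)%:~R.
Proof.
have p : (0 : R) < 2 ^+ n by rewrite exprn_gt0.
by rewrite /dyadic /= in_itv/= ltr_pdivrMr// ler_pdivlMr.
Qed.

Lemma dyadic_ex n x : exists j, dyadic n j x.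
Proof.
exists (Num.ceil (x * 2 ^+ n) - 1); apply/dyadicE; rewrite subrK.
by rewrite intrD/= intrN; have := ceil_itv (x * 2 ^+ n); lra.
Qed.

Lemma dyadic_inj n j j' x : dyadic n j x -> dyadic n j' x -> j = j'.
Proof.
move=> /dyadicE/andP[a b] /dyadicE/andP[c d].
have := lt_le_trans a d; have := lt_le_trans c b.
by rewrite !ltr_int; lia.
Qed.

(** A common point gives strict inequalities between end points; scaled by 2^(n+1) these are
    integers, which sharpens them to the inequalities of an inclusion. *)
Lemma dyadicS n j j' x : dyadic n j x -> dyadic n.+1 j' x ->
  dyadic n.+1 j' `<=` dyadic n j.
Proof.
have E (z : R) : z * 2 ^+ n.+1 = 2 * (z * 2 ^+ n) by rewrite exprS; lra.
have I2 (i : int) : (2 * i)%:~R = 2 * i%:~R :> R by rewrite intrM.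
move=> /dyadicE/andP[a b] /dyadicE; rewrite E => /andP[c d] y /dyadicE; rewrite E => /andP[y1 y2].
have : ((2 * j)%:~R < (j' + 1)%:~R :> R) by rewrite I2; lra.
have : (j'%:~R < (2 * (j + 1))%:~R :> R) by rewrite I2; lra.
rewrite !ltr_int => h1 h2.
have : ((2 * j)%:~R <= j'%:~R :> R) by rewrite ler_int; lia.
have : ((j' + 1)%:~R <= (2 * (j + 1))%:~R :> R) by rewrite ler_int; lia.
by rewrite !I2 => h3 h4; apply/dyadicE; apply/andP; split; lra.
Qed.

(** The bound on [x] cuts along cells and leaves finitely many of them, so that the measure is a
    finite sum. *)
Definition dyadic_inner U n := [set x : R | - n%:R < x <= n%:R /\
  exists2 j, dyadic n j x & dyadic n j `<=` U].

Definition dyadic_nth n k : int := k%:Z - (n * 2 ^ n)%:Z.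

Lemma dyadic_nth_inj n : injective (dyadic_nth n).
Proof. by move=> i j; rewrite /dyadic_nth; lia. Qed.

Lemma dyadic_innerE U n : dyadic_inner U n =
  \big[setU/set0]_(k < (n * 2 ^ n).*2 | `[< dyadic n (dyadic_nth n k) `<=` U >])
    dyadic n (dyadic_nth n k).
Proof.
have p : (0 : R) < 2 ^+ n by rewrite exprn_gt0.
have N2 : (n * 2 ^ n)%:R = n%:R * 2 ^+ n :> R by rewrite natrM natrX.
have IN (i : nat) : (i%:Z)%:~R = i%:R :> R by [].
apply/seteqP; split => x.
  move=> [/andP[x1 x2] [j jx jU]].
  have /dyadicE/andP[j1 j2] := jx.
  have h1 : ((- (n * 2 ^ n)%:Z)%:~R < (j + 1)%:~R :> R).
    by rewrite intrN IN N2 (lt_le_trans _ j2)// -mulNr ltr_pM2r.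
  have h2 : (j%:~R < ((n * 2 ^ n)%:Z)%:~R :> R).
    by rewrite IN N2 (lt_le_trans j1)// ler_pM2r.
  rewrite !ltr_int in h1 h2.
  pose k := absz (j + (n * 2 ^ n)%:Z).
  have kn : (k < (n * 2 ^ n).*2)%N by rewrite /k -addnn; lia.
  have kE : dyadic_nth n (Ordinal kn) = j by rewrite /dyadic_nth/= /k; lia.
  by rewrite (bigD1 (Ordinal kn)) ?kE/=; [left|apply/asboolP].
apply: (big_ind (fun S : set R => S x -> dyadic_inner U n x)) => //.
  by move=> A B hA hB [/hA|/hB].
move=> k /asboolP kU kx; have kn := ltn_ord k.
split; last by exists (dyadic_nth n k).
have := kx; move=> /dyadicE; rewrite /dyadic_nth !intrD intrN !IN N2 => /andP[k1 k2].
apply/andP; split; first by rewrite -(ltr_pM2r p) mulNr; have := ler0n R k; lra.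
have : k.+1%:R <= (n * 2 ^ n + n * 2 ^ n)%:R :> R by rewrite ler_nat addnn.
by rewrite -natr1 natrD N2 => ?; rewrite -(ler_pM2r p); lra.
Qed.

Lemma measurable_dyadic n j : measurable (dyadic n j : set (measurableTypeR R)).
Proof. exact: measurable_itv. Qed.

Lemma lebesgue_stieltjes_measure_dyadic_inner F U n :
  lebesgue_stieltjes_measure F (dyadic_inner U n) =
  (\sum_(k < (n * 2 ^ n).*2 | `[< dyadic n (dyadic_nth n k) `<=` U >])
    (F ((dyadic_nth n k + 1)%:~R / 2 ^+ n) - F ((dyadic_nth n k)%:~R / 2 ^+ n)))%:E.
Proof.
rewrite dyadic_innerE measure_bigsetU_ord.
- rewrite -sumEFin; apply: eq_bigr => k _.
  apply: lebesgue_stieltjes_measure_itv_oc; rewrite ler_pM2r ?invr_gt0 ?exprn_gt0//.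
  by rewrite ler_int; lia.
- by move=> i; exact: measurable_dyadic.
- move=> i k _ _ [z [iz kz]]; apply: val_inj.
  exact: dyadic_nth_inj (dyadic_inj iz kz).
Qed.

Lemma measurable_dyadic_inner U n :
  measurable (dyadic_inner U n : set (measurableTypeR R)).
Proof.
by rewrite dyadic_innerE; apply: bigsetU_measurable => k _; exact: measurable_dyadic.
Qed.

Lemma nondecreasing_dyadic_inner U : nondecreasing_seq (dyadic_inner U).
Proof.
apply/nondecreasing_seqP => n; apply/subsetPset => x [xn [j jx jU]]; split.
  by have := ler_nat R n n.+1; rewrite leqnSn; move: xn => /andP[? ?] ?; apply/andP; split; lra.
have [j' j'x] := dyadic_ex n.+1 x; exists j' => //.
exact: subset_trans (dyadicS jx j'x) jU.
Qed.

Lemma bigcup_dyadic_inner U : open U -> \bigcup_n dyadic_inner U n = U.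
Proof.
move=> oU; apply/seteqP; split => [x [n _ [_ [j jx]]]|x Ux]; first exact.
have /nbhs_ballP[e /= e0 xeU] : nbhs x U by exact: open_nbhs_nbhs.
near \oo => n; exists n => //; split.
  have : `|x| < n%:R.
    by near: n; exact: nbhs_infty_gtr.
  by rewrite ltr_norml => /andP[-> /ltW].
have [j jx] := dyadic_ex n x; exists j => // y jy; apply: xeU.
rewrite /ball/=.
have p : (0 : R) < 2 ^+ n by rewrite exprn_gt0.
have ne : 1 < e * 2 ^+ n.
  rewrite -ltr_pdivrMl// mulr1.
  apply: lt_trans (_ : n%:R < _); last by rewrite -natrX ltr_nat ltn_expl.
  by near: n; exact: nbhs_infty_gtr.
rewrite -(ltr_pM2r p); apply: le_lt_trans ne.
rewrite -[X in _ * X](gtr0_norm p) -normrM mulrBl.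
move: jx jy => /dyadicE/andP[a b] /dyadicE/andP[c d].
by move: a b c d; rewrite intrD => a b c d; rewrite ler_norml; apply/andP; split; lra.
Unshelve. all: by end_near. Qed.

Lemma lebesgue_stieltjes_measure_open_le F e d U :
  (forall (J : finType) (I : J -> R * R), disjoint_family I ->
    \sum_i ((I i).2 - (I i).1) < d -> \sum_i `|F (I i).2 - F (I i).1| < e) ->
  open U -> (mu U < d%:E)%E -> (lebesgue_stieltjes_measure F U <= e%:E)%E.
Proof.
move=> H oU Ud; have UE := bigcup_dyadic_inner oU.
have mU : measurable (\bigcup_n dyadic_inner U n : set (measurableTypeR R)).
  by apply: bigcupT_measurable => n; exact: measurable_dyadic_inner.
have := nondecreasing_cvg_mu (mu := lebesgue_stieltjes_measure F)
  (@measurable_dyadic_inner U) mU (@nondecreasing_dyadic_inner U).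
rewrite UE => /cvg_lim <-//; apply: lime_le.
  apply: ereal_nondecreasing_is_cvgn => m n mn; apply: le_measure.
  - by rewrite inE; exact: measurable_dyadic_inner.
  - by rewrite inE; exact: measurable_dyadic_inner.
  - by apply/subsetPset; exact: nondecreasing_dyadic_inner.
near=> n => /=; rewrite lebesgue_stieltjes_measure_dyadic_inner lee_fin.
have : (mu (dyadic_inner U n) < d%:E)%E.
  apply: le_lt_trans Ud; apply: le_measure; rewrite ?inE.
  - exact: measurable_dyadic_inner.
  - by rewrite -UE.
  - by rewrite -[X in _ `<=` X]UE; exact: bigcup_sup.
(* The Lebesgue measure is the Stieltjes measure of the identity, so one formula computes both
   measures. *)
have -> : mu (dyadic_inner U n) = _ :=
  lebesgue_stieltjes_measure_dyadic_inner idfun U n.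
rewrite lte_fin /= => Wd.
pose l k : R := (dyadic_nth n k)%:~R / 2 ^+ n.
pose r k : R := (dyadic_nth n k + 1)%:~R / 2 ^+ n.
(* A cell not contained in [U] is replaced by a degenerate interval: it is empty and adds nothing to
   either sum. *)
pose I (k : 'I_((n * 2 ^ n).*2)) :=
  if `[< dyadic n (dyadic_nth n k) `<=` U >] then (l k, r k) else (l k, l k).
have lr k : l k <= r k by rewrite ler_pM2r ?invr_gt0 ?exprn_gt0// ler_int; lia.
have Iz i z : `](I i).1, (I i).2[%classic z -> dyadic n (dyadic_nth n i) z.
  rewrite /I; case: asboolP => _; rewrite /= in_itv/= => /andP[z1 z2].
    by rewrite /dyadic/= in_itv/= z1 ltW.
  by have := lt_trans z1 z2; rewrite ltxx.
have dI : disjoint_family I.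
  split=> [k|i k _ _ [z [/Iz iz /Iz kz]]].
    by rewrite /I; case: asboolP => _ /=; [exact: lr|].
  exact/val_inj/(dyadic_nth_inj (dyadic_inj iz kz)).
have Id : \sum_i ((I i).2 - (I i).1) < d.
  apply: le_lt_trans Wd; rewrite [leRHS]big_mkcond/=; apply: ler_sum => k _.
  by rewrite /I; case: asboolP => _ //=; rewrite subrr.
apply/ltW/(le_lt_trans _ (H _ _ dI Id)); rewrite [leLHS]big_mkcond/=.
apply: ler_sum => k _; rewrite /I; case: asboolP => _ /=; last by rewrite subrr normr0.
exact: ler_norm.
Unshelve. all: by end_near. Qed.

End dyadic_cells.

Section lebesgue_ae.
Context {R : realType}.
Local Notation mu := (@lebesgue_measure R).

Lemma ae_filter : Filter (nbhs (almost_everywhere mu)).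
Proof. exact: ae_filter_ringOfSetsType mu. Qed.

Lemma ae_neq (c : R) : {ae mu, forall x, x != c}.
Proof.
by exists [set c]; split; [exact: measurable_set1|exact: lebesgue_measure_set1|
  move=> x /= /negP; rewrite negbK => /eqP].
Qed.

End lebesgue_ae.

Section ae_Rintegral.
Context {R : realType}.
Local Notation mu := (@lebesgue_measure R).
Variables (A : set (measurableTypeR R)) (f g : R -> R).
Hypotheses (mA : measurable A) (mf : measurable_fun A f) (mg : measurable_fun A g).
Hypothesis fg : {ae mu, forall x, A x -> f x = g x}.

Lemma ae_eq_Rintegral : \int[mu]_(x in A) f x = \int[mu]_(x in A) g x.
Proof.
rewrite /Rintegral; congr fine; apply: ae_eq_integral => //; [exact/measurable_EFinP..|].
have aeF := @ae_filter R.
by apply: filterS fg => x H Ax; rewrite H.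
Qed.

Lemma ae_eq_Rintegrable : mu.-integrable A (EFin \o g) -> mu.-integrable A (EFin \o f).
Proof.
move=> /integrableP[_ gi]; apply/integrableP; split; first exact/measurable_EFinP.
apply: le_lt_trans gi; apply: eqW.
apply: ae_eq_integral => //.
- by apply: measurableT_comp => //; exact/measurable_EFinP.
- by apply: measurableT_comp => //; exact/measurable_EFinP.
have aeF := @ae_filter R.
by apply: filterS fg => x H Ax; rewrite /= H.
Qed.

End ae_Rintegral.

(** * Fundamental theorem of calculus for absolutely continuous functions *)

Section ftc_absolutely_continuous.
Context {R : realType}.
Local Notation mu := (@lebesgue_measure R).
Implicit Types (f g : R -> R) (a b c d x y e : R).

Lemma disjoint_family1 x y : x <= y -> disjoint_family (fun _ : 'I_1 => (x, y)).
Proof. by move=> xy; split=> // i j _ _ _; rewrite !ord1. Qed.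

Lemma uabs_cont_continuous g : uabs_cont g -> continuous g.
Proof.
move=> gAC x; apply/cvgrPdist_lt => e e0; have [d d0 H] := gAC e e0.
near=> y; have xyd : `|x - y| < d by near: y; apply/nbhs_ballP; exists d.
have [xy|/ltW yx] := leP x y.
  have := H _ _ (disjoint_family1 xy); rewrite !big_ord1/= distrC; apply.
  by rewrite distrC ger0_norm// subr_ge0 in xyd.
have := H _ _ (disjoint_family1 yx); rewrite !big_ord1/=; apply.
by rewrite ger0_norm// subr_ge0 in xyd.
Unshelve. all: by end_near. Qed.

(** By outer regularity a null set lies in an open set of Lebesgue measure below the modulus, whose
    Stieltjes measure is then small. *)
Lemma uabs_cont_dominated (F : cumulative R R) : uabs_cont F ->
  lebesgue_stieltjes_measure F `<< mu.
Proof.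
move=> FAC; apply/null_content_dominatesP => A mA muA0.
apply/eqP; rewrite eq_le measure_ge0 andbT; apply/lee_addgt0Pr => e e0.
rewrite add0e; have [d d0 H] := FAC e e0.
have [|U [oU AU UAd]] := lebesgue_regularity_outer mA _ d0; first by rewrite muA0.
have mU := open_measurable oU.
apply: (@le_trans _ _ (lebesgue_stieltjes_measure F U)).
  by apply: le_measure => //; rewrite inE.
apply: (lebesgue_stieltjes_measure_open_le H oU).
have mUA : measurable (U `\` A : set (measurableTypeR R)) by exact: measurableD.
have -> : U = (U `\` A) `|` A :> set (measurableTypeR R).
  by rewrite setUC setDUK.
by rewrite measureU// ?setDKI// [X in (_ + X)%E]muA0 adde0.
Qed.

Lemma lebesgue_stieltjes_measure_finite (F : cumulative R R) (B : R) :
  (forall x y, F y - F x <= B) -> (lebesgue_stieltjes_measure F setT < +oo)%E.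
Proof.
move=> FB.
pose I n : set (measurableTypeR R) := `]- (n%:R), n%:R]%classic.
have mI n : measurable (I n) by exact: measurable_itv.
have IT : \bigcup_n I n = setT by rewrite -(bigcup_itvT false false).
apply: (@le_lt_trans _ _ B%:E); last exact: ltry.
rewrite -IT; have := nondecreasing_cvg_mu (mu := lebesgue_stieltjes_measure F) mI.
move=> /(_ (bigcupT_measurable _ mI)) H.
have ndI : nondecreasing_seq I.
  by move=> n k nk; apply/subsetPset/subset_itv; rewrite leBSide/= ?lerN2 ler_nat.
have /cvg_lim <- // := H ndI; apply: lime_le.
  apply: ereal_nondecreasing_is_cvgn => m n mn; apply: le_measure; rewrite ?inE//.
  exact/subsetPset/ndI.
near=> n; rewrite /= lebesgue_stieltjes_measure_itv_oc ?lee_fin//.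
by rewrite ge0_cp.
Unshelve. all: by end_near. Qed.

(** [h] is the Radon-Nikodym density of the Stieltjes measure of [g]; bounded increments make that
    measure finite. *)
Lemma nondecreasing_uabs_cont_integral g (B : R) :
  {homo g : x y / x <= y} -> uabs_cont g -> (forall x y, g y - g x <= B) ->
  exists2 h : R -> R, mu.-integrable setT (EFin \o h) &
    forall x y, x <= y -> g y - g x = \int[mu]_(t in `]x, y]) h t.
Proof.
move=> ndg gAC gB.
have rcg : right_continuous g by apply: right_continuousW; exact: uabs_cont_continuous.
pose F : cumulative R R := HB.pack g (isCumulative.Build R _ R g ndg rcg).
have Foo : fin_num_fun (lebesgue_stieltjes_measure F).
  apply: lty_fin_num_fun; exact: (@lebesgue_stieltjes_measure_finite F B gB).
pose nu : {finite_measure set (measurableTypeR R) -> \bar R} :=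
  HB.pack (lebesgue_stieltjes_measure F) (@Measure_isFinite.Build _ _ _ (lebesgue_stieltjes_measure F) Foo).
have numu : nu `<< mu by exact: (@uabs_cont_dominated F).
have [h [h0 hfin inth nuE]] := radon_nikodym_sigma_finite numu.
exists (fine \o h); first by apply: eq_integrable inth => // x _; rewrite /= fineK.
move=> x y xy; have := nuE `]x, y]%classic (measurable_itv _).
rewrite [LHS](lebesgue_stieltjes_measure_itv_oc F xy) => /(congr1 fine)/= ->.
by congr fine; apply: eq_integral => t _; rewrite fineK.
Qed.

(* g is the difference of its variation and of the variation minus g, two
   nondecreasing functions to which the Radon-Nikodym theorem applies. *)
Lemma uabs_cont_integral g a b : a <= b -> uabs_cont g ->
  exists2 h : R -> R, mu.-integrable setT (EFin \o h) &
    forall x y, a <= x -> x <= y -> y <= b -> g y - g x = \int[mu]_(t in `]x, y]) h t.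
Proof.
move=> ab gAC; pose V x := fine (total_variation a (clip a b x) g).
(* Clipping makes [V] and [W] constant outside [[a, b]]: their increments are bounded on the whole
   line, as finiteness of their Stieltjes measures requires. *)
pose W x := V x - g (clip a b x).
have TVfin x y : x <= y -> total_variation x y g \is a fin_num.
  by move=> xy; apply/bounded_variationP => //; exact: uabs_cont_bounded_variation.
have ac x : a <= clip a b x by case/andP: (clip_itv x ab).
have VB x y : x <= y -> V y - V x = fine (total_variation (clip a b x) (clip a b y) g).
  move=> xy; have cxy := clip_le ab xy.
  rewrite /V (total_variationD g (ac x) cxy) fineD ?TVfin//.
  by rewrite addrAC subrr add0r.
have gTV x y : x <= y -> `|g y - g x| <= fine (total_variation x y g).
  by move=> xy; rewrite -lee_fin fineK ?TVfin//; exact: total_variation_ge.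
have ndV : {homo V : x y / x <= y}.
  move=> x y xy; rewrite -subr_ge0 VB//; apply: le_trans (gTV _ _ _) => //.
  exact: clip_le.
have ndW : {homo W : x y / x <= y}.
  move=> x y xy; have := gTV _ _ (clip_le ab xy); rewrite -VB// /W.
  by move=> /(le_trans (ler_norm _)); lra.
have VAC : uabs_cont V.
  move=> e e0; have [d d0 H] := uabs_cont_total_variation gAC e0.
  exists d => // J I dI Id; have := H _ _ (disjoint_family_clip ab dI).
  move=> /(_ (le_lt_trans (ler_sum _ (fun i _ => clipB ab (dI.1 i))) Id)).
  apply: le_lt_trans; apply: ler_sum => i _ /=.
  have I12 := dI.1 i; rewrite -VB// ger0_norm// subr_ge0; exact: ndV.
have WAC : uabs_cont W.
  move=> e e0; have e20 : 0 < e / 2 by lra.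
  have [d d0 H] := VAC _ e20; have [d' d'0 H'] := gAC _ e20.
  exists (Num.min d d'); first by rewrite lt_min d0.
  move=> J I dI; rewrite lt_min => /andP[Id Id'].
  have {H} := H _ _ dI Id.
  have := H' _ _ (disjoint_family_clip ab dI).
  move=> /(_ (le_lt_trans (ler_sum _ (fun i _ => clipB ab (dI.1 i))) Id')).
  move=> /[swap] h1 h2; rewrite [ltRHS](splitr e); apply: le_lt_trans (ltrD h1 h2).
  rewrite -big_split/=; apply: ler_sum => i _; apply: le_trans (ler_normB _ _).
  by apply: eqW; congr `|_|; rewrite /W; lra.
pose B := fine (total_variation a b g) + `|g a| + 2 * fine (total_variation a b g).
have V0 x : 0 <= V x <= fine (total_variation a b g).
  have := clip_itv x ab => /andP[h1 h2].
  rewrite /V fine_ge0 ?total_variation_ge0//=; apply: fine_le; rewrite ?TVfin//.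
  by rewrite (total_variationD g h1 h2) leeDl ?total_variation_ge0.
have gc x : `|g (clip a b x) - g a| <= V x by exact: gTV.
have VBd x y : V y - V x <= fine (total_variation a b g).
  by have := V0 x; have := V0 y; move=> /andP[? ?] /andP[? ?]; lra.
have WBd x y : W y - W x <= 3 * fine (total_variation a b g).
  have := gc x; have := gc y; rewrite !ler_norml => /andP[? ?] /andP[? ?].
  have := V0 x; have := V0 y; move=> /andP[? ?] /andP[? ?].
  by rewrite /W; lra.
have [h ih hE] := nondecreasing_uabs_cont_integral ndV VAC VBd.
have [k ik kE] := nondecreasing_uabs_cont_integral ndW WAC WBd.
exists (h \- k); first by rewrite (_ : _ \o _ = (EFin \o h) \- (EFin \o k))%E//; exact: integrableB.
move=> x y ax xy yb; rewrite RintegralB//; last 2 first.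
- exact: integrableS ih.
- exact: integrableS ik.
rewrite -hE// -kE// /W.
by rewrite !clip_id ?ax ?yb ?(le_trans ax)// ?(le_trans _ yb)//; lra.
Qed.

Section everywhere.
Variable f : R -> R.
Hypothesis fAC : forall a b, abs_cont a b f.

Lemma abs_cont_integral a b : a <= b ->
  exists2 h : R -> R, mu.-integrable setT (EFin \o h) &
    forall x y, a <= x -> x <= y -> y <= b -> f y - f x = \int[mu]_(t in `]x, y]) h t.
Proof.
move=> ab; have [h ih hE] := uabs_cont_integral ab (abs_cont_uabs_cont ab (fAC a b)).
exists h => // x y ax xy yb; rewrite -hE//=.
by rewrite !clip_id ?ax ?yb ?(le_trans ax)// ?(le_trans _ yb).
Qed.

(** [FTC1] differentiates the integral of [h] from [a] at almost every point; near an interior point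
    [f] is that integral plus [f a]. *)
Lemma abs_cont_ae_derive a b : a <= b ->
  exists h : R -> R, [/\ mu.-integrable setT (EFin \o h),
    forall x y, a <= x -> x <= y -> y <= b -> f y - f x = \int[mu]_(t in `]x, y]) h t &
    {ae mu, forall x, a < x < b -> derivable f x 1 /\ derive1 f x = h x}].
Proof.
move=> ab; have [h ih hE] := abs_cont_integral ab; exists h; split=> //.
have iS y : mu.-integrable [set` Interval (BRight a) (BRight y)] (EFin \o h).
  exact: integrableS ih.
have lh : locally_integrable setT h by apply: open_integrable_locally => //; exact: openT.
have aeF := @ae_filter R.
have := FTC1 iS lh; apply: filterS => x Hx /andP[ax xb].
have [dF F'x] := Hx ax.
have near_eq : {near x, (fun y => \int[mu]_(t in `]a, y]) h t + f a) =1 f}.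
  near=> y; rewrite -hE ?subrK//; first by apply/ltW; near: y; exact: lt_nbhsr.
  by apply/ltW; near: y; exact: lt_nbhsl.
have dF' : is_derive x 1 f (h x).
  apply: near_eq_is_derive near_eq _; rewrite -[h x]addr0.
  by apply: is_deriveD; apply: DeriveDef; [exact: dF|rewrite -derive1E F'x].
by split; [exact: dF'.(@ex_derive _ _ _ _ _ _ _)|rewrite derive1E; exact: derive_val].
Unshelve. all: by end_near. Qed.

Lemma abs_cont_ae_derivable : {ae mu, forall x, derivable f x 1}.
Proof.
have aeF := @ae_filter R.
have H n : {ae mu, forall x, - (n%:R) < x < n%:R -> derivable f x 1}.
  have nn : - (n%:R) <= n%:R :> R by rewrite ge0_cp.
  have [h [_ _]] := abs_cont_ae_derive nn.
  by apply: filterS => x + xn => /(_ xn)[].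
have := ae_foralln H.
apply: filterS => x Hx; near \oo => n; apply: (Hx n).
by rewrite -ltr_norml; near: n; exact: nbhs_infty_gtr.
Unshelve. all: by end_near. Qed.

(** The density [h] and [derive1 f] agree almost everywhere on [[a, b]], so one integrand replaces
    the other. Measurability covers the points where [f] is not derivable; [measurable_derive1]
    supplies it for continuous [f]. *)
Lemma abs_cont_FTC a b : measurable_fun setT (derive1 f) -> a <= b ->
  mu.-integrable `[a, b] (EFin \o (derive1 f)) /\
  f b - f a = \int[mu]_(t in `[a, b]) derive1 f t.
Proof.
move=> mf' ab; have [h [ih hE hf']] := abs_cont_ae_derive ab.
have aeF := @ae_filter R.
have mab := @measurable_itv R `[a, b].
have mh : measurable_fun setT h by apply/measurable_EFinP; exact: measurable_int ih.
have mfab : measurable_fun `[a, b] (derive1 f) by exact: measurable_funTS.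
have mhab : measurable_fun `[a, b] h by exact: measurable_funTS.
have fh : {ae mu, forall x, `[a, b]%classic x -> derive1 f x = h x}.
  move: (ae_neq b) (ae_neq a) hf'; apply: filterS3 => x xb xa Hx.
  rewrite /= in_itv/= => /andP[ax bx]; have [|_ ->//] := Hx.
  by rewrite !lt_neqAle ax bx xb eq_sym xa.
split; first by apply: (ae_eq_Rintegrable mab mfab mhab fh); exact: integrableS ih.
rewrite (hE _ _ (lexx a) ab (lexx b)) Rintegral_itv_obnd_cbnd; last exact: integrableS ih.
exact/esym/ae_eq_Rintegral.
Qed.

End everywhere.

End ftc_absolutely_continuous.

(** * Gaussian estimates, primitives and Hermite polynomials *)

Section gaussian_estimates.
Context {R : realType}.
Local Notation mu := (@lebesgue_measure R).
Implicit Types (x y c m : R).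

Lemma expR_ge_sum x n : 0 <= x -> \sum_(k < n) x ^+ k / k`!%:R <= expR x.
Proof.
move=> x0; have -> : expR x = limn (series (exp_coeff x)) by [].
have -> : \sum_(k < n) x ^+ k / k`!%:R = series (exp_coeff x) n.
  by rewrite /series/= big_mkord; apply: eq_bigr => k _; rewrite /exp_coeff.
apply: nondecreasing_cvgn_le; last exact: is_cvg_series_exp_coeff.
by apply: nondecreasing_series => k _ _; exact: exp_coeff_ge0.
Qed.

(** The inequality 1 - x / n <= exp(- x / n), inverted and raised to the power [n]; it serves as a
    source of numerical upper bounds. *)
Lemma expR_le_inv x n : (0 < n)%N -> 0 <= x < n%:R -> expR x <= ((1 - x / n%:R)^-1) ^+ n.
Proof.
move=> n0 /andP[x0 xn]; have n0' : (0 : R) < n%:R by rewrite ltr0n.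
rewrite -[in expR x](divfK (lt0r_neq0 n0') x) expRM_natr; apply: lerXn2r.
- by rewrite nnegrE expR_ge0.
- by rewrite nnegrE invr_ge0 subr_ge0 ler_pdivrMr// mul1r ltW.
- rewrite -[x / n%:R]opprK expRN lef_pV2 ?posrE ?expR_gt0 ?opprK//.
    by have := expR_ge1Dx (- (x / n%:R)).
  by rewrite subr_gt0 ltr_pdivrMr// mul1r.
Qed.

Local Notation s2pi := (Num.sqrt (2 * pi) : R).

Lemma sqrt2pi_bounds : 2 <= s2pi <= 3.
Proof.
have p1 := @pi_ge2 R; have p2 := @pihalf_lt2 R.
have s0 := sqrtr_ge0 (2 * pi : R).
have sE : s2pi ^+ 2 = 2 * pi by rewrite sqr_sqrtr//; lra.
by apply/andP; split; rewrite -ler_sqr ?nnegrE// sE; lra.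
Qed.

Lemma rho_gt0 x : 0 < rho x.
Proof.
by rewrite /rho divr_gt0 ?expR_gt0// (lt_le_trans _ (andP sqrt2pi_bounds).1).
Qed.

Lemma rho_ge0 x : 0 <= rho x.
Proof. exact/ltW/rho_gt0. Qed.

Lemma rho_le x y : `|x| <= `|y| -> rho y <= rho x.
Proof.
move=> xy; rewrite /rho ler_pM2r ?invr_gt0 ?(lt_le_trans _ (andP sqrt2pi_bounds).1)//.
by rewrite ler_expR lerN2 ler_pM2r// -(real_normK (num_real x)) -(real_normK (num_real y)) lerXn2r ?nnegrE.
Qed.

Lemma rho_le_half x : rho x <= 1 / 2.
Proof.
have /andP[s2 _] := sqrt2pi_bounds.
apply: le_trans (rho_le (x := 0) _) _; first by rewrite normr0.
rewrite /rho expr0n/= mul0r oppr0 expR0 ler_pdivrMr; last by lra.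
by lra.
Qed.

Lemma is_derive_rho x : is_derive x 1 (@rho R) (- x * rho x).
Proof.
have dg : is_derive x 1 (fun y : R => - (y ^+ 2 / 2)) (- x).
  by apply: is_derive_eq; rewrite /GRing.scale/= !mulr0 ?add0r ?addr0; field.
have de := @is_derive1_comp _ expR (fun y : R => - (y ^+ 2 / 2)) x _ _ (is_derive_expR _) dg.
rewrite (_ : rho = (expR \o (fun y : R => - (y ^+ 2 / 2))) \* cst (s2pi^-1)); last first.
  by apply/funext => y; rewrite /rho.
by apply: is_derive_eq; rewrite /GRing.scale/= mulr0 add0r /rho; lra.
Qed.

Lemma rho_continuous : continuous (@rho R).
Proof.
move=> x; apply/differentiable_continuous/derivable1_diffP.
by have [] := is_derive_rho x.
Qed.

Lemma normal_pdfE' m y x : y != 0 ->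
  normal_pdf m y x = expR (- (x - m) ^+ 2 / (y ^+ 2 *+ 2)) / Num.sqrt (y ^+ 2 * pi *+ 2).
Proof. by move=> y0; rewrite normal_pdfE// /normal_peak /normal_fun mulrC. Qed.

(** Completing the square recentres the Gaussian at [c]; the exponential moments of [rho] follow
    from the total mass of the normal density. *)
Lemma expR_rhoE c x : expR (c * x) * rho x = expR (c ^+ 2 / 2) * normal_pdf c 1 x.
Proof.
rewrite normal_pdfE'//.
rewrite /rho expr1n mul1r mulrA -expRD mulrA -expRD -[pi *+ 2]mulr_natl mulr2n.
by congr (expR _ / _); field.
Qed.

Lemma integrable_expR_rho c : mu.-integrable setT (fun x => (expR (c * x) * rho x)%:E).
Proof.
have -> : (fun x => (expR (c * x) * rho x)%:E) =
    (fun x => (expR (c ^+ 2 / 2))%:E * (normal_pdf c 1 x)%:E)%E.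
  by apply/funext => x; rewrite expR_rhoE.
exact/integrableZl/integrable_normal_pdf.
Qed.

Lemma Rintegral_expR_rho c : \int[mu]_x (expR (c * x) * rho x) = expR (c ^+ 2 / 2).
Proof.
under eq_Rintegral do rewrite expR_rhoE.
rewrite RintegralZl//; last exact: integrable_normal_pdf.
by rewrite /Rintegral integral_normal_pdf ?oner_neq0//= mulr1.
Qed.

(** A normal density of mean [m] and variance 2, up to normalization: the products f rho decay like
    exp(- x^2 / 4), since f itself may grow like the inverse square root of [rho]. *)
Definition gauss4 m x := expR (- ((x - m) ^+ 2 / 4)).

Lemma gauss4E m x : gauss4 m x = Num.sqrt (4 * pi) * normal_pdf m (Num.sqrt 2) x.
Proof.
rewrite normal_pdfE' ?gt_eqF ?sqrtr_gt0// sqr_sqrtr//.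
rewrite /gauss4 -[2 * pi *+ 2]mulr_natl mulrA -natrM mulrCA divff ?mulr1; last first.
  by rewrite gt_eqF// sqrtr_gt0 mulr_gt0// pi_gt0.
by rewrite mulNr -[2 *+ 2]mulrnA.
Qed.

Lemma integrable_gauss4 m : mu.-integrable setT (fun x => (gauss4 m x)%:E).
Proof.
have -> : (fun x => (gauss4 m x)%:E) =
    (fun x => (Num.sqrt (4 * pi))%:E * (normal_pdf m (Num.sqrt 2) x)%:E)%E.
  by apply/funext => x; rewrite gauss4E.
exact/integrableZl/integrable_normal_pdf.
Qed.

Lemma Rintegral_gauss4 m : \int[mu]_x gauss4 m x <= 4.
Proof.
under eq_Rintegral do rewrite gauss4E.
rewrite RintegralZl//; last exact: integrable_normal_pdf.
rewrite /Rintegral integral_normal_pdf ?gt_eqF ?sqrtr_gt0//= mulr1.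
rewrite -[leRHS]ger0_norm// -sqrtr_sqr ler_wsqrtr//.
by have := @pihalf_lt2 R; lra.
Qed.

End gaussian_estimates.

Section real_integrable.
Context d (T : measurableType d) {R : realType} (mu : {measure set T -> \bar R}).
Implicit Types (D : set T) (f g : T -> R).

Definition Rintegrable D f := mu.-integrable D (EFin \o f).

Lemma Rintegrable_measurable D f : Rintegrable D f -> measurable_fun D f.
Proof. by move=> /measurable_int/measurable_EFinP. Qed.

Lemma RintegrableD D f g : measurable D -> Rintegrable D f -> Rintegrable D g ->
  Rintegrable D (fun x => f x + g x).
Proof.
move=> mD fi gi; rewrite /Rintegrable (_ : _ \o _ = (EFin \o f) \+ (EFin \o g))%E//.
exact: integrableD.
Qed.

Lemma RintegrableZ D a f : measurable D -> Rintegrable D f -> Rintegrable D (fun x => a * f x).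
Proof.
move=> mD fi; rewrite /Rintegrable (_ : _ \o _ = (fun x => a%:E * (EFin \o f) x)%E)//.
exact: integrableZl.
Qed.

Lemma RintegrableB D f g : measurable D -> Rintegrable D f -> Rintegrable D g ->
  Rintegrable D (fun x => f x - g x).
Proof.
move=> mD fi gi; rewrite /Rintegrable (_ : _ \o _ = (EFin \o f) \- (EFin \o g))%E//.
exact: integrableB.
Qed.

Lemma le_Rintegrable D f g : measurable D -> measurable_fun D f ->
  (forall x, D x -> `|f x| <= g x) -> Rintegrable D g -> Rintegrable D f.
Proof.
move=> mD mf fg; apply: le_integrable => //; first exact/measurable_EFinP.
by move=> x Dx /=; rewrite lee_fin (le_trans (fg _ Dx))// ler_norm.
Qed.

Lemma RintegrableS D D' f : measurable D -> measurable D' -> D' `<=` D ->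
  Rintegrable D f -> Rintegrable D' f.
Proof. exact: integrableS. Qed.

Lemma Rintegrable_sum D (I : Type) (r : seq I) (F : I -> T -> R) : measurable D ->
  (forall i, Rintegrable D (F i)) -> Rintegrable D (fun x => \sum_(i <- r) F i x).
Proof.
move=> mD Fi; elim: r => [|i r IH].
  rewrite (_ : (fun x => _) = fun=> 0); last by apply/funext => x; rewrite big_nil.
  exact: integrable0.
rewrite (_ : (fun x => _) = (fun x => F i x + \sum_(j <- r) F j x)).
  exact: RintegrableD.
by apply/funext => x; rewrite big_cons.
Qed.

Lemma Rintegral_sum D (I : Type) (r : seq I) (F : I -> T -> R) : measurable D ->
  (forall i, Rintegrable D (F i)) ->
  \int[mu]_(x in D) (\sum_(i <- r) F i x) = \sum_(i <- r) \int[mu]_(x in D) F i x.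
Proof.
move=> mD Fi; elim: r => [|i r IH].
  under eq_Rintegral do rewrite big_nil.
  by rewrite big_nil Rintegral_cst// mul0r.
under eq_Rintegral do rewrite big_cons.
have si := Rintegrable_sum r mD Fi.
by rewrite RintegralD ?big_cons ?IH//; exact: Fi.
Qed.

Lemma Rintegrable_ge0 D f : (forall x, D x -> 0 <= f x) -> measurable_fun D f ->
  (\int[mu]_(x in D) (f x)%:E < +oo)%E -> Rintegrable D f.
Proof.
move=> f0 mf foo; apply/integrableP; split; first exact/measurable_EFinP.
apply: le_lt_trans foo; apply: eqW.
by apply: eq_integral => x /set_mem Dx; rewrite /= ger0_norm ?f0.
Qed.

Lemma subset_Rintegral D D' f : measurable D -> measurable D' -> D' `<=` D ->
  (forall x, D x -> 0 <= f x) -> Rintegrable D f ->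
  \int[mu]_(x in D') f x <= \int[mu]_(x in D) f x.
Proof.
move=> mD mD' DD f0 fi; apply: fine_le.
- exact/integrable_fin_num/(RintegrableS mD).
- exact: integrable_fin_num.
- by apply: ge0_subset_integral => //; exact: measurable_int fi.
Qed.

End real_integrable.

Section primitive.
Context {R : realType}.
Local Notation mu := (@lebesgue_measure R).
Implicit Types (F f : R -> R) (a b c x : R).

(** Integral form of the relation between a function and its derivative, because the derivative of
    order alpha exists almost everywhere only. *)
Definition primitive F f := forall a b, a <= b ->
  Rintegrable mu `[a, b] f /\ F b - F a = \int[mu]_(t in `[a, b]) f t.

Lemma continuous_Rintegrable f a b : continuous f -> Rintegrable mu `[a, b] f.
Proof.
move=> cf; apply: continuous_compact_integrable; first exact: segment_compact.
exact: continuous_subspaceT.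
Qed.

Lemma primitive_is_derive F f : (forall x, is_derive x 1 F (f x)) -> continuous f ->
  primitive F f.
Proof.
move=> dF cf a b; have cF : continuous F.
  move=> x; apply/differentiable_continuous/derivable1_diffP.
  by have [] := dF x.
rewrite le_eqVlt => /predU1P[<-|ab].
  split; first exact: continuous_Rintegrable.
  by rewrite set_itv1 Rintegral_set1 subrr.
split; first exact: continuous_Rintegrable.
rewrite /Rintegral (@continuous_FTC2 _ f F)//.
- exact: continuous_subspaceT.
- split.
  + by move=> x _; have [] := dF x.
  + by apply: cvg_at_right_filter; exact: cF.
  + by apply: cvg_at_left_filter; exact: cF.
- by move=> x _; rewrite derive1E; exact: derive_val.
Qed.

Lemma primitive_le F f (G g : R -> R) a b : primitive F f -> primitive G g -> a <= b ->
  (forall t, a <= t <= b -> `|f t| <= g t) -> `|F b - F a| <= G b - G a.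
Proof.
move=> Ff Gg ab fg; have [fi ->] := Ff _ _ ab; have [gi ->] := Gg _ _ ab.
apply: le_trans (le_normr_Rintegral _ fi) _; first exact: measurable_itv.
by apply: le_Rintegral => //; exact: integrable_norm fi.
Qed.

Lemma primitive_expR c : primitive (fun t => expR (c * t)) (fun t => c * expR (c * t)).
Proof.
apply: primitive_is_derive.
  move=> x; have dc : is_derive x 1 (fun t : R => c * t) c.
    by apply: is_derive_eq; rewrite /GRing.scale/= ?mulr0 ?addr0 ?add0r ?mulr1.
  have := @is_derive1_comp _ expR (fun t : R => c * t) x _ _ (is_derive_expR _) dc.
  by rewrite mulrC.
move=> x; apply: cvgM; first exact: cvg_cst.
apply: continuous_comp; last exact: continuous_expR.
by apply: cvgM; [exact: cvg_cst|exact: cvg_id].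
Qed.

Lemma primitiveZ F f c : primitive F f -> primitive (fun t => c * F t) (fun t => c * f t).
Proof.
move=> Ff a b ab; have [fi E] := Ff _ _ ab; split; first exact: RintegrableZ.
by rewrite -mulrBr E RintegralZl.
Qed.

Lemma primitiveD F f (G g : R -> R) : primitive F f -> primitive G g ->
  primitive (fun t => F t + G t) (fun t => f t + g t).
Proof.
move=> Ff Gg a b ab; have [fi E] := Ff _ _ ab; have [gi E'] := Gg _ _ ab.
split; first exact: RintegrableD.
by rewrite RintegralD// -E -E'; lra.
Qed.

Lemma primitive_id : primitive id (fun=> 1).
Proof. by apply: primitive_is_derive; move=> x; exact: cvg_cst. Qed.

(** Integration of exp(|t| / 2) from 0 costs a factor 2 and keeps the type of growth, so the bound
    can be iterated. The term -1, from the end point 0, serves to absorb [F 0]. The hypothesis stops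
    at [|x|] because [A] may depend on [x]. *)
Lemma primitive_growth_expR F f A x : primitive F f -> 0 <= A ->
  (forall t, `|t| <= `|x| -> `|f t| <= A * expR (`|t| / 2)) ->
  `|F x| <= `|F 0| + 2 * A * (expR (`|x| / 2) - 1).
Proof.
move=> Ff A0 H.
have tri : `|F x| <= `|F 0| + `|F x - F 0| by rewrite -{1}[F x](subrKC (F 0)) ler_normD.
apply: (le_trans tri); rewrite lerD2l.
have [x0|x0] := leP 0 x.
  have := primitive_le Ff (primitiveZ (2 * A) (primitive_expR (1 / 2))) x0.
  rewrite mulr0 expR0 (ger0_norm x0) => /(_ _)/le_trans; apply.
    move=> t /andP[t0 tx]; apply: le_trans (H t _) _; first by rewrite !ger0_norm.
    by rewrite (ger0_norm t0) (_ : 1 / 2 * t = t / 2); lra.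
  by rewrite (_ : 1 / 2 * x = x / 2); lra.
have := primitive_le Ff (primitiveZ (- (2 * A)) (primitive_expR (- (1 / 2)))) (ltW x0).
rewrite mulr0 expR0 (ltr0_norm x0) distrC => /(_ _)/le_trans; apply.
  move=> t /andP[t0 tx]; apply: le_trans (H t _) _; first by rewrite !ler0_norm ?lerN2 ?(ltW x0).
  by rewrite (ler0_norm tx) (_ : - (1 / 2) * t = - t / 2); lra.
by rewrite (_ : - (1 / 2) * x = - x / 2); lra.
Qed.

Lemma primitive_growth_cst F f A x : primitive F f ->
  (forall t, `|t| <= `|x| -> `|f t| <= A) -> `|F x - F 0| <= A * `|x|.
Proof.
move=> Ff H; have [x0|x0] := leP 0 x.
  have := primitive_le Ff (primitiveZ A primitive_id) x0.
  rewrite mulr0 subr0 (ger0_norm x0) => /(_ _)/le_trans; apply => //.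
  by move=> t /andP[t0 tx]; rewrite mulr1; apply: H; rewrite !ger0_norm.
have := primitive_le Ff (primitiveZ A primitive_id) (ltW x0).
rewrite mulr0 sub0r (ltr0_norm x0) distrC mulrN => /(_ _)/le_trans; apply => //.
by move=> t /andP[t0 tx]; rewrite mulr1; apply: H; rewrite !ler0_norm ?lerN2 ?(ltW x0).
Qed.

(** Nonnegativity of the integral of (f - k)^2, where [k] is the mean of [f] over the interval. *)
Lemma Rintegral_itv_sqr_le f a b : a <= b -> Rintegrable mu `[a, b] f ->
  Rintegrable mu `[a, b] (fun t => f t ^+ 2) ->
  (\int[mu]_(t in `[a, b]) f t) ^+ 2 <= (b - a) * \int[mu]_(t in `[a, b]) (f t ^+ 2).
Proof.
rewrite le_eqVlt => /predU1P[<-|ab] fi f2i.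
  by rewrite !set_itv1 !Rintegral_set1 expr0n mulr0.
set d := \int[mu]_(t in _) f t.
have ba : 0 < b - a by rewrite subr_gt0.
pose k := d / (b - a).
have mab := @measurable_itv R `[a, b].
have ki : Rintegrable mu `[a, b] (fun=> k ^+ 2) by apply: continuous_Rintegrable => t; exact: cvg_cst.
have : 0 <= \int[mu]_(t in `[a, b]) (f t ^+ 2 - (2 * k) * f t + k ^+ 2).
  apply: Rintegral_ge0 => t _.
  have -> : f t ^+ 2 - 2 * k * f t + k ^+ 2 = (f t - k) ^+ 2 by ring.
  exact: sqr_ge0.
rewrite RintegralD//; last by apply: RintegrableB => //; exact: RintegrableZ.
rewrite RintegralB//; last exact: RintegrableZ.
have mE : fine (mu `[a, b]%classic) = b - a.
  by rewrite lebesgue_measure_itv/= lte_fin ab.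
have -> : \int[mu]_(_ in `[a, b]) k ^+ 2 = k ^+ 2 * (b - a).
  by rewrite Rintegral_cst// mE.
rewrite RintegralZl// -/d.
rewrite /k; set I := \int[_]_(_ in _) _; have -> :
  I - 2 * (d / (b - a)) * d + (d / (b - a)) ^+ 2 * (b - a) = I - d ^+ 2 / (b - a).
  by field; rewrite gt_eqF.
by rewrite subr_ge0 ler_pdivrMr// mulrC.
Qed.

End primitive.

Section hermite.
Context {R : realType}.
Implicit Types (x : R) (k r : nat) (p : {poly R}).

(* (-1)^k times the probabilists' Hermite polynomial: rho^(k) = herm k * rho. *)
Fixpoint herm k : {poly R} := if k is k'.+1 then deriv (herm k') - 'X * herm k' else 1.

Lemma is_derive_horner p x : is_derive x 1 (fun y => p.[y]) (deriv p).[x].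
Proof.
elim/poly_ind: p => [|p c IH].
  rewrite deriv0 hornerE (_ : (fun y => _) = cst 0); first exact: is_derive_cst.
  by apply/funext => y; rewrite hornerE.
rewrite (_ : (fun y => _) = (fun y => p.[y] * y + c)); last first.
  by apply/funext => y; rewrite !hornerE.
apply: is_derive_eq; rewrite derivD derivM derivX derivC !hornerE /GRing.scale/=; ring.
Qed.

Lemma horner_continuous p : continuous (fun y : R => p.[y]).
Proof.
move=> x; apply/differentiable_continuous/derivable1_diffP.
by have [] := is_derive_horner p x.
Qed.

Lemma deriv_herm k : deriv (herm k.+1) = - (k.+1%:R *: herm k).
Proof.
elim: k => [|k IH]; first by rewrite /= derivC sub0r derivN mulr1 derivX scale1r.
rewrite [herm k.+2]/= derivB derivM derivX mul1r -[herm k.+1]/(deriv (herm k) - 'X * herm k).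
rewrite -/(herm k.+1) IH derivN derivZ.
rewrite -!mul_polyC -[k.+2]addn1 natrD polyCD polyC1.
by rewrite -[herm k.+1]/(deriv (herm k) - 'X * herm k); ring.
Qed.

Lemma horner0_herm_le k : `|(herm k).[0]| <= k`!%:R.
Proof.
have [m] := ubnP k; elim: m k => [//|m IH] [|[|k]] km.
- by rewrite /= hornerE normr1.
- by rewrite /= derivC mulr1 sub0r hornerN hornerX oppr0 normr0.
- have -> : (herm k.+2).[0] = - (k.+1%:R * (herm k).[0]).
    rewrite -[herm k.+2]/(deriv (herm k.+1) - 'X * herm k.+1) hornerD hornerN hornerM hornerX.
    by rewrite mul0r subr0 deriv_herm hornerN hornerZ.
  rewrite normrN normrM normr_nat.
  apply: (@le_trans _ _ (k.+1%:R * k`!%:R)).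
    by rewrite ler_wpM2l// IH// -ltnS ltnW.
  by rewrite -natrM ler_nat 2!factS leq_pmull.
Qed.

(** The bound is integrated from degree [k] to [k.+1]: [deriv_herm] brings the factor [k.+1], the
    primitive of exp(|t| / 2) the factor 2, and the value at 0 is absorbed by [horner0_herm_le]. *)
Lemma herm_le k x : `|(herm k).[x]| <= k`!%:R * 2 ^+ k * expR (`|x| / 2).
Proof.
elim: k x => [|k IH] x.
  by rewrite /= hornerE normr1 !mul1r -[leLHS]expR0 ler_expR divr_ge0.
pose A : R := k.+1%:R * (k`!%:R * 2 ^+ k).
have A0 : 0 <= A by rewrite !mulr_ge0// exprn_ge0.
have P : primitive (fun y => (herm k.+1).[y]) (fun y => (deriv (herm k.+1)).[y]).
  by apply: primitive_is_derive => [y|]; [exact: is_derive_horner|exact: horner_continuous].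
have := primitive_growth_expR (x := x) P A0.
have -> : (k.+1)`!%:R * 2 ^+ k.+1 * expR (`|x| / 2) = 2 * A * expR (`|x| / 2) :> R.
  by rewrite /A factS natrM exprS; ring.
move=> /(_ _)/le_trans; apply.
  move=> t _; rewrite deriv_herm !hornerE normrN normrM normr_nat.
  by rewrite /A -mulrA ler_wpM2l// -mulrA mulrA IH.
have := horner0_herm_le k.+1.
have : (k.+1)`!%:R <= 2 * A.
  by rewrite /A factS natrM mulrCA ler_wpM2l// mulrCA ler_peMr// -exprS exprn_ege1// ler1n.
by rewrite mulrBr mulr1; lra.
Qed.

Lemma is_derive_herm_rho k x :
  is_derive x 1 (fun y => (herm k).[y] * rho y) ((herm k.+1).[x] * rho x).
Proof.
have d1 := is_derive_horner (herm k) x; have d2 := is_derive_rho x.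
apply: is_derive_eq; rewrite -[herm k.+1]/(deriv (herm k) - 'X * herm k).
by rewrite /GRing.scale/= hornerD hornerN hornerM hornerX; ring.
Qed.

Lemma herm_rho_continuous k : continuous (fun y : R => (herm k).[y] * rho y).
Proof. by move=> x; apply: cvgM; [exact: horner_continuous|exact: rho_continuous]. Qed.

(** Pascal's rule: the combinatorial half of the induction for Leibniz' formula. *)
Lemma binomial_sum_shift (u v : nat -> R) r :
  \sum_(i < r.+1) 'C(r, i)%:R * (u i.+1 * v (r - i)%N + u i * v (r - i).+1) =
  \sum_(i < r.+2) 'C(r.+1, i)%:R * u i * v (r.+1 - i)%N.
Proof.
under eq_bigr do rewrite mulrDr !mulrA.
rewrite big_split/= [RHS]big_ord_recl/= bin0 subn0.
under [in RHS]eq_bigr => i _ do rewrite /bump/= add1n binS natrD mulrDl mulrDl subSS.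
rewrite big_split/= addrA [RHS]addrC; congr (_ + _).
rewrite [in RHS]big_ord_recr/= bin_small// !mul0r addr0.
rewrite [LHS]big_ord_recl/= bin0 subn0; congr (_ + _); apply: eq_bigr => i _.
by rewrite /bump/= add1n subnSK.
Qed.

Definition leibniz_term (D : nat -> R -> R) r i x :=
  'C(r, i)%:R * D i x * ((herm (r - i)).[x] * rho x).

(* The r-th derivative of D 0 * rho, when D i is the i-th derivative of D 0. *)
Definition leibniz D r x := \sum_(i < r.+1) leibniz_term D r i x.

Lemma is_derive_leibniz D r x :
  (forall i, (i <= r)%N -> is_derive x 1 (D i) (D i.+1 x)) ->
  is_derive x 1 (leibniz D r) (leibniz D r.+1 x).
Proof.
move=> dD; pose b j := (herm j).[x] * rho x.
have dt i : (i < r.+1)%N -> is_derive x 1 (leibniz_term D r i)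
    ('C(r, i)%:R * (D i.+1 x * b (r - i)%N + D i x * b (r - i).+1)).
  move=> ir; have d1 := dD i ir; have d2 := is_derive_herm_rho (r - i) x.
  rewrite /leibniz_term; apply: is_derive_eq; rewrite /GRing.scale/= /b; ring.
have ds n : (n <= r.+1)%N -> is_derive x 1 (fun y => \sum_(i < n) leibniz_term D r i y)
    (\sum_(i < n) 'C(r, i)%:R * (D i.+1 x * b (r - i)%N + D i x * b (r - i).+1)).
  elim: n => [|n IH] nr.
    rewrite big_ord0 (_ : (fun y => _) = cst 0); first exact: is_derive_cst.
    by apply/funext => y; rewrite big_ord0.
  rewrite big_ord_recr/= (_ : (fun y => _) =
      (fun y => (\sum_(i < n) leibniz_term D r i y) + leibniz_term D r n y)); last first.
    by apply/funext => y; rewrite big_ord_recr.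
  by apply: is_deriveD; [exact: IH (ltnW nr)|exact: dt].
apply: is_derive_eq; first exact: ds.
by rewrite (binomial_sum_shift (fun i => D i x) b).
Qed.

Lemma leibniz_term_continuous D r i : continuous (D i) -> continuous (leibniz_term D r i).
Proof.
move=> cD x; apply: cvgM; last exact: herm_rho_continuous.
by apply: cvgM; [exact: cvg_cst|exact: cD].
Qed.

Lemma continuous_bigsum n (F : nat -> R -> R) : (forall i, (i < n)%N -> continuous (F i)) ->
  continuous (fun y => \sum_(i < n) F i y).
Proof.
elim: n => [|n IH] cF.
  rewrite (_ : (fun y => _) = cst 0); first by move=> x; exact: cvg_cst.
  by apply/funext => y; rewrite big_ord0.
rewrite (_ : (fun y => _) = (fun y => (\sum_(i < n) F i y) + F n y)).
  move=> x; apply: cvgD; last exact: cF.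
  by apply: IH => i ?; apply: cF; exact: ltnW.
by apply/funext => y; rewrite big_ord_recr.
Qed.

Lemma leibniz_continuous D r : (forall i, (i <= r)%N -> continuous (D i)) ->
  continuous (leibniz D r).
Proof.
move=> cD; apply: continuous_bigsum => i ir; apply: leibniz_term_continuous.
exact: cD.
Qed.

End hermite.

(** * Measurability of derivatives, affine changes of variables *)

Section derivable_measurable.
Context {R : realType}.
Variable f : R -> R.
Hypothesis cf : continuous f.
Implicit Types (x h : R).

Definition diffquot h x := h^-1 * (f (h + x) - f x).

Lemma diffquot_continuous h : continuous (diffquot h).
Proof.
move=> x; apply: cvgM; first exact: cvg_cst.
apply: cvgB; last exact: cf.
apply: (@cvg_comp _ _ _ (fun y => h + y) f _ (nbhs (h + x))); last exact: cf.
by apply: cvgD; [exact: cvg_cst|exact: cvg_id].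
Qed.

(** Cauchy criterion for the difference quotients at scale 1 / (m + 1) with tolerance 1 / (k + 1);
    the nonstrict inequality makes the set closed. *)
Definition diffquot_osc (k m : nat) : set R :=
  [set x | forall h h', 0 < `|h| < m.+1%:R^-1 -> 0 < `|h'| < m.+1%:R^-1 ->
    `|diffquot h x - diffquot h' x| <= k.+1%:R^-1].

Lemma closed_diffquot_osc k m : closed (diffquot_osc k m).
Proof.
have -> : diffquot_osc k m = \bigcap_(hh in [set hh : R * R |
    0 < `|hh.1| < m.+1%:R^-1 /\ 0 < `|hh.2| < m.+1%:R^-1])
    (fun x => `|diffquot hh.1 x - diffquot hh.2 x|) @^-1` [set y | y <= k.+1%:R^-1].
  apply/seteqP; split=> [x Hx [h h']/= [? ?]|x Hx h h' ? ?]; first exact: Hx.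
  by have := Hx (h, h'); apply.
apply: closed_bigI => -[h h'] _; apply: closed_comp; last exact: closed_le.
move=> x _; apply: cvg_norm; apply: cvgB; exact: diffquot_continuous.
Qed.

Lemma derivable_diffquotE x : derivable f x 1 <-> cvg (diffquot h x @[h --> 0^']).
Proof.
rewrite /derivable; suff -> : (fun h => h^-1 *: (f (h *: 1 + x) - f x)) = diffquot ^~ x by [].
by apply/funext => h; rewrite /diffquot [h *: 1]mulr1.
Qed.

Lemma derivable_osc : [set x | derivable f x 1] = \bigcap_k \bigcup_m diffquot_osc k m.
Proof.
apply/seteqP; split=> x /=; rewrite derivable_diffquotE.
  move=> /cvg_ex[l Hl] k _; have k0 : 0 < (k.+1%:R^-1 : R) / 2 by rewrite divr_gt0.
  move/cvgrPdist_lt : Hl => /(_ _ k0)[e /= e0 He].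
  near \oo => m; have me : (m.+1%:R^-1 : R) < e by near: m; exact: (near_infty_natSinv_lt (PosNum e0)).
  exists m => // h h' /andP[h0 hm] /andP[h'0 h'm].
  have A (z : R) : 0 < `|z| -> `|z| < m.+1%:R^-1 -> `|l - diffquot z x| < k.+1%:R^-1 / 2.
    move=> z0 zm; apply: He; last by rewrite -normr_gt0.
    by rewrite /ball/= sub0r normrN (lt_trans zm).
  apply: le_trans (ler_distD l _ _) _; rewrite [leRHS]splitr distrC.
  by apply: lerD; apply/ltW; exact: A.
move=> H; apply/cauchy_cvgP/cauchy_exP => e e0.
near \oo => k; have ke : (k.+1%:R^-1 : R) < e by near: k; exact: (near_infty_natSinv_lt (PosNum e0)).
have [m _ Hm] := H k I.
have m0 : 0 < (m.+1%:R^-1 : R) by [].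
exists (diffquot (m.+1%:R^-1 / 2) x); exists m.+1%:R^-1 => // h /=.
rewrite sub0r normrN => hm h0; rewrite /ball/=; apply: le_lt_trans ke; apply: Hm.
  by rewrite gtr0_norm ?divr_gt0// ltr_pdivrMr// ltr_pMr// ltr1n.
by rewrite normr_gt0 h0.
Unshelve. all: by end_near. Qed.

Lemma measurable_derivable : measurable ([set x | derivable f x 1] : set (measurableTypeR R)).
Proof.
rewrite derivable_osc; apply: bigcapT_measurable => k; apply: bigcupT_measurable => m.
by apply: (@closed_measurable R); exact: closed_diffquot_osc.
Qed.

(** Where [f] is not derivable, [derive1 f] is the default value [point]. The sequence [q] takes
    difference quotients on the measurable set of derivability and [point] elsewhere, hence
    converges to [derive1 f] everywhere. *)
Lemma measurable_derive1 : measurable_fun setT (derive1 f : measurableTypeR R -> R).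
Proof.
pose D := [set x | derivable f x 1].
pose q n x := diffquot n.+1%:R^-1 x * \1_D x + (point : R) * (1 - \1_D x).
apply: (@measurable_fun_cvg _ _ _ _ q).
  move=> n; have mD : measurable_fun setT (\1_D : measurableTypeR R -> R).
    by apply: measurable_indic; exact: measurable_derivable.
  apply: measurable_funD; apply: measurable_funM => //.
    by apply: continuous_measurable_fun; exact: diffquot_continuous.
  by apply: measurable_funB.
move=> x _; rewrite /q indicE; have [xD|xD] := boolP (x \in D).
  have := xD; rewrite inE /D/= derivable_diffquotE => cx.
  rewrite (_ : (fun _ => _) = (fun n : nat => diffquot n.+1%:R^-1 x)); last first.
    by apply/funext => n; rewrite mulr1 subrr mulr0 addr0.
  have {}cx : diffquot h x @[h --> 0^'] --> derive1 f x by exact: cx.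
  apply/cvgrPdist_lt => e e0; have /cvgrPdist_lt/(_ _ e0)[d/= d0 Hd] := cx.
  near=> n; apply: Hd => //=; rewrite sub0r normrN gtr0_norm//.
  by near: n; exact: (near_infty_natSinv_lt (PosNum d0)).
rewrite (_ : (fun _ => _) = fun=> point); last first.
  by apply/funext => n; rewrite mulr0 add0r subr0 mulr1.
suff -> : derive1 f x = point by exact: cvg_cst.
by apply: dvgP => cx; move: xD; rewrite notin_setE; apply; exact/derivable_diffquotE.
Unshelve. all: by end_near. Qed.

End derivable_measurable.

Section affine_change_of_variables.
Context {R : realType}.
Local Notation mu := (@lebesgue_measure R).
Variables (a b : R).
Hypothesis a0 : 0 < a.

Definition affine (x : R) : R := a * x + b.

Lemma measurable_affine : measurable_fun setT (affine : measurableTypeR R -> measurableTypeR R).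
Proof.
apply: continuous_measurable_fun => x.
by apply: cvgD; [apply: cvgM; [exact: cvg_cst|exact: cvg_id]|exact: cvg_cst].
Qed.

Lemma affine_itv x y : affine @^-1` `]x, y]%classic = `](x - b) / a, (y - b) / a]%classic.
Proof.
apply/seteqP; split=> t /=; rewrite !in_itv/= /affine ltr_pdivrMr// ler_pdivlMr//;
  by rewrite ltrBlDr lerBrDr mulrC.
Qed.

Definition affine_pushforward : {measure set (measurableTypeR R) -> \bar R} :=
  measure_function_pushforward__canonical__measure_function_Measure mu measurable_affine.

(** Both sides are measures in [A]; they agree on half-open intervals, which determine the Lebesgue
    measure. *)
Lemma lebesgue_measure_affine (A : set (measurableTypeR R)) : measurable A ->
  mu A = (a%:E * mu (affine @^-1` A))%E.
Proof.
move=> mA.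
pose nu : {measure set (measurableTypeR R) -> \bar R} :=
  mscale (NngNum (ltW a0)) affine_pushforward.
suff : mu A = nu A by [].
apply: lebesgue_measure_unique => // X /ocitvP[->|[[x y]/= xy ->]].
  by rewrite !measure0.
rewrite /nu/= /mscale/= /pushforward affine_itv !lebesgue_measure_itv/= !lte_fin.
rewrite xy ltr_pM2r ?invr_gt0// ltrD2r xy -!EFinB -EFinM; congr EFin.
by field; rewrite gt_eqF.
Qed.

Lemma ge0_integral_affine (D : set (measurableTypeR R)) (g : R -> \bar R) :
  measurable D -> measurable_fun setT (g : measurableTypeR R -> \bar R) -> (forall x, 0 <= g x)%E ->
  (\int[mu]_(x in D) g x = a%:E * \int[mu]_(x in affine @^-1` D) g (affine x))%E.
Proof.
move=> mD mg g0.
pose nu : {measure set (measurableTypeR R) -> \bar R} :=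
  mscale (NngNum (ltW a0)) affine_pushforward.
transitivity (\int[nu]_(x in D) g x)%E.
  apply: eq_measure_integral => A mA _; exact: lebesgue_measure_affine.
rewrite ge0_integral_mscale//=; last exact: measurable_funTS.
rewrite (ge0_integral_pushforward measurable_affine)//.
exact: measurable_funTS.
Qed.

End affine_change_of_variables.

(** * Pointwise and integral bounds in H_rho *)

Section jets.
Context {R : realType}.
Local Notation mu := (@lebesgue_measure R).
Local Notation s2pi := (Num.sqrt (2 * pi) : R).
Implicit Types (D : nat -> R -> R) (x y : R) (r i k : nat).

(* D r stands for the r-th derivative of D 0, an element of H_rho. With a family
   of functions, linear combinations need no computation of derivatives. *)
Definition jet alpha D :=
  [/\ D 0%N 0 = 0,
      forall r, (r < alpha)%N -> continuous (D r),
      forall r, (r < alpha)%N -> primitive (D r) (D r.+1),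
      measurable_fun setT (D alpha) &
      Rintegrable mu setT (fun x => D alpha x ^+ 2 * rho x)].

Definition jet_sqnorm alpha D :=
  \sum_(1 <= r < alpha) D r 0 ^+ 2 + \int[mu]_x (D alpha x ^+ 2 * rho x).

(** Dominates 1 + sqrt(|x| / rho x), the growth that Cauchy-Schwarz gives for the derivative of
    order alpha - 1 ([growth_top]); exp(|x| / 4) accounts for the square root of |x|. *)
Definition growth x : R := s2pi * expR (`|x| / 4 + x ^+ 2 / 4).
Definition decay x : R := expR (`|x| / 4 - x ^+ 2 / 4).

Lemma growth_rho x : growth x * rho x = decay x.
Proof.
have /andP[s2 _] := @sqrt2pi_bounds R.
have s0 : s2pi != 0 by rewrite gt_eqF//; lra.
have -> : growth x * rho x = expR (`|x| / 4 + x ^+ 2 / 4) * expR (- (x ^+ 2 / 2)).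
  by rewrite /growth /rho; field.
by rewrite -expRD /decay; congr expR; lra.
Qed.

Lemma growth_le x y : `|x| <= `|y| -> growth x <= growth y.
Proof.
have /andP[s2 _] := @sqrt2pi_bounds R.
move=> xy; rewrite ler_pM2l; last by lra.
rewrite ler_expR; have : x ^+ 2 <= y ^+ 2.
  by rewrite -(real_normK (num_real x)) -(real_normK (num_real y)) lerXn2r ?nnegrE.
by lra.
Qed.

Lemma growth_ge1 x : 1 <= growth x.
Proof.
have /andP[s2 _] := @sqrt2pi_bounds R.
have : 1 <= expR (`|x| / 4 + x ^+ 2 / 4).
  by rewrite -[leLHS]expR0 ler_expR addr_ge0 ?divr_ge0 ?sqr_ge0.
rewrite /growth; set e := expR _ => e1; nra.
Qed.

Lemma expR_half_ge x : 0 <= x -> 1 + x / 2 + x ^+ 2 / 8 <= expR (x / 2).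
Proof.
move=> x0; apply: le_trans (@expR_ge_sum R (x / 2) 3 _); last by rewrite divr_ge0.
rewrite !big_ord_recr big_ord0/= !factS fact0 expr0 expr1 expr2.
by rewrite -?natrM; lra.
Qed.

Lemma growth_top x : (1 + Num.sqrt (`|x| / rho x)) ^+ 2 <= growth x ^+ 2.
Proof.
have r0 := @rho_gt0 R x.
have h0 : 0 <= `|x| / rho x by rewrite divr_ge0// ltW.
have sq := sqr_sqrtr h0; set u := Num.sqrt _ in sq *.
apply: (@le_trans _ _ (2 * (1 + `|x| / rho x))).
  by rewrite -sq; have := sqr_ge0 (u - 1); nra.
have /andP[s2 s3] := @sqrt2pi_bounds R; set s := s2pi in s2 s3 *.
have -> : `|x| / rho x = `|x| * (s * expR (x ^+ 2 / 2)).
  by rewrite /rho invf_div -expRN opprK.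
have -> : growth x ^+ 2 = s ^+ 2 * (expR (`|x| / 2) * expR (x ^+ 2 / 2)).
  rewrite /growth exprMn -expRM_natl -expRD; congr (_ * expR _).
  by lra.
have e1 : 1 <= expR (x ^+ 2 / 2).
  by rewrite -[leLHS]expR0 ler_expR divr_ge0 ?sqr_ge0.
have := expR_half_ge (normr_ge0 x); set y := `|x|; set e := expR (x ^+ 2 / 2) in e1 *.
set f := expR _ => f1.
have y0 : 0 <= y by exact: normr_ge0.
have key : 2 + 2 * y * s <= s ^+ 2 * f.
  have : s ^+ 2 * (1 + y / 2 + y ^+ 2 / 8) <= s ^+ 2 * f by rewrite ler_wpM2l ?sqr_ge0.
  apply: le_trans; rewrite -subr_ge0.
  (* The square is completed in [y]; the remainder is nonnegative because sqrt(2 pi) >= 2. *)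
  have -> : s ^+ 2 * (1 + y / 2 + y ^+ 2 / 8) - (2 + 2 * y * s) =
    (s * y + 2 * (s - 4)) ^+ 2 / 8 + (s - 2) * (s + 10) / 2 by field.
  by rewrite addr_ge0 ?divr_ge0 ?sqr_ge0// mulr_ge0; lra.
apply: (@le_trans _ _ ((2 + 2 * y * s) * e)); last first.
  by rewrite mulrA ler_wpM2r//; lra.
by nra.
Qed.

Section bounds.
Variables (alpha : nat) (D : nat -> R -> R).
Hypotheses (alpha2 : (2 <= alpha)%N) (jD : jet alpha D).
Let N := Num.sqrt (jet_sqnorm alpha D).

Lemma jet_int_ge0 : 0 <= \int[mu]_x (D alpha x ^+ 2 * rho x).
Proof. by apply: Rintegral_ge0 => x _; rewrite mulr_ge0 ?sqr_ge0 ?rho_ge0. Qed.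

Lemma jet_sqnorm_ge0 : 0 <= jet_sqnorm alpha D.
Proof.
by rewrite addr_ge0 ?jet_int_ge0// sumr_ge0// => r _; exact: sqr_ge0.
Qed.

Lemma jet_normE : N ^+ 2 = jet_sqnorm alpha D.
Proof. by rewrite sqr_sqrtr// jet_sqnorm_ge0. Qed.

Lemma jet_norm_ge0 : 0 <= N.
Proof. exact: sqrtr_ge0. Qed.

Lemma jet_at0 r : (r < alpha)%N -> `|D r 0| <= N.
Proof.
have [D0 _ _ _ _] := jD.
case: r => [_|r ra]; first by rewrite D0 normr0 jet_norm_ge0.
rewrite -ler_sqr ?nnegrE ?jet_norm_ge0// real_normK ?num_real// jet_normE.
have sE : \sum_(1 <= i < alpha) D i 0 ^+ 2 =
    \sum_(1 <= i < r.+1) D i 0 ^+ 2 + (D r.+1 0 ^+ 2 + \sum_(r.+2 <= i < alpha) D i 0 ^+ 2).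
  by rewrite -[X in _ + X]big_ltn// -big_cat_nat//; exact: ltnW.
rewrite /jet_sqnorm sE.
have s1 : 0 <= \sum_(1 <= i < r.+1) D i 0 ^+ 2 by rewrite sumr_ge0// => i _; exact: sqr_ge0.
have s2 : 0 <= \sum_(r.+2 <= i < alpha) D i 0 ^+ 2 by rewrite sumr_ge0// => i _; exact: sqr_ge0.
by have := jet_int_ge0; lra.
Qed.

(** Cauchy-Schwarz on [[a, b]], where [rho] is at least [rho x]; dividing by [rho x] turns the
    unweighted integral into a part of the norm. *)
Lemma jet_top_sqr x a b : a <= b -> (forall t, a <= t <= b -> `|t| <= `|x|) ->
  (D alpha.-1 b - D alpha.-1 a) ^+ 2 <= (b - a) * (N ^+ 2 / rho x).
Proof.
move=> ab H; have [_ _ P mD Di] := jD.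
have aE : alpha.-1.+1 = alpha by rewrite prednK// ltnW.
have := P alpha.-1; rewrite aE leqnn => /(_ isT)/(_ _ _ ab)[Dai ->].
have mab := @measurable_itv R `[a, b].
have r0 := @rho_gt0 R x.
have rDi : Rintegrable mu `[a, b] (fun t => (rho x)^-1 * (D alpha t ^+ 2 * rho t)).
  by apply: RintegrableZ => //; exact: RintegrableS Di.
have bound t : t \in `[a, b] -> D alpha t ^+ 2 <= (rho x)^-1 * (D alpha t ^+ 2 * rho t).
  rewrite in_itv/= => /H/rho_le tx; rewrite ler_pdivlMl// mulrC.
  by rewrite ler_wpM2l ?sqr_ge0.
have D2i : Rintegrable mu `[a, b] (fun t => D alpha t ^+ 2).
  apply: le_Rintegrable rDi => //.
    by apply: measurable_funTS; apply: measurable_funX.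
  by move=> t abt; rewrite ger0_norm ?sqr_ge0// bound.
apply: le_trans (Rintegral_itv_sqr_le ab Dai D2i) _.
rewrite ler_wpM2l ?subr_ge0//.
apply: (@le_trans _ _ (\int[mu]_(t in `[a, b]) ((rho x)^-1 * (D alpha t ^+ 2 * rho t)))).
  by apply: le_Rintegral => // t abt; exact: bound.
rewrite RintegralZl//; last exact: RintegrableS Di.
rewrite mulrC ler_pM2r ?invr_gt0// jet_normE.
apply: (@le_trans _ _ (\int[mu]_x (D alpha x ^+ 2 * rho x))); last first.
  by rewrite lerDr sumr_ge0// => i _; exact: sqr_ge0.
by apply: subset_Rintegral => // t _; rewrite mulr_ge0 ?sqr_ge0 ?rho_ge0.
Qed.

Lemma jet_top x : `|D alpha.-1 x| <= N * growth x.
Proof.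
have r0 := @rho_gt0 R x.
have diff : `|D alpha.-1 x - D alpha.-1 0| <= N * Num.sqrt (`|x| / rho x).
  rewrite -ler_sqr ?nnegrE ?mulr_ge0 ?jet_norm_ge0 ?sqrtr_ge0// real_normK ?num_real//.
  have sq : Num.sqrt (`|x| / rho x) ^+ 2 = `|x| / rho x.
    by rewrite sqr_sqrtr// divr_ge0// ltW.
  rewrite exprMn sq.
  have [x0|x0] := leP 0 x.
    have := @jet_top_sqr x 0 x x0; rewrite subr0 (ger0_norm x0) => /(_ _)/le_trans; apply.
      by move=> t /andP[t0 tx]; rewrite ger0_norm.
    by apply: eqW; field; rewrite gt_eqF.
  have := @jet_top_sqr x x 0 (ltW x0); rewrite -sqrrN opprB sub0r (ltr0_norm x0).
  move=> /(_ _)/le_trans; apply.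
    by move=> t /andP[t0 tx]; rewrite ler0_norm// lerN2.
  by apply: eqW; field; rewrite gt_eqF.
have l0 : `|D alpha.-1 0| <= N by apply: jet_at0; rewrite prednK// ltnW.
have tri : `|D alpha.-1 x| <= `|D alpha.-1 0| + `|D alpha.-1 x - D alpha.-1 0|.
  by rewrite -{1}[D alpha.-1 x](subrKC (D alpha.-1 0)) ler_normD.
apply: (@le_trans _ _ (N * (1 + Num.sqrt (`|x| / rho x)))); first by rewrite mulrDr mulr1; lra.
rewrite ler_wpM2l ?jet_norm_ge0//.
have g1 := growth_ge1 x.
by rewrite -ler_sqr ?nnegrE ?growth_top ?addr_ge0 ?sqrtr_ge0//; lra.
Qed.

(** Downward induction from the order alpha - 1: each integration from 0 costs a factor 2. [growth]
    is frozen at [x], which is legitimate since it increases with |t|. *)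
Lemma jet_le k x : (k < alpha)%N ->
  `|D (alpha.-1 - k)%N x| <= N * 2 ^+ k * expR (`|x| / 2) * growth x.
Proof.
elim: k x => [|k IH] x ka.
  rewrite subn0 mulr1; apply: le_trans (jet_top x) _.
  rewrite -mulrA ler_wpM2l ?jet_norm_ge0// ler_peMl//; first by have := growth_ge1 x; lra.
  by rewrite -[leLHS]expR0 ler_expR divr_ge0.
have [_ _ P _ _] := jD.
have ra : (alpha.-1 - k.+1 < alpha)%N by lia.
have rE : (alpha.-1 - k.+1).+1 = (alpha.-1 - k)%N by lia.
pose A := N * 2 ^+ k * growth x.
have g1 := growth_ge1 x.
have A0 : 0 <= A by rewrite !mulr_ge0 ?jet_norm_ge0 ?exprn_ge0//; lra.
have := primitive_growth_expR (x := x) (P _ ra) A0; rewrite rE => /(_ _)/le_trans; apply.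
  move=> t tx; apply: le_trans (IH t (ltnW ka)) _.
  rewrite /A mulrAC ler_wpM2r ?expR_ge0// ler_wpM2l ?mulr_ge0 ?jet_norm_ge0 ?exprn_ge0//.
  exact: growth_le.
have N2A : N <= 2 * A.
  rewrite /A mulrCA -!mulrA ler_peMr ?jet_norm_ge0//.
  have : (1 : R) <= 2 ^+ k by rewrite exprn_ege1// ler1n.
  by set e := 2 ^+ k => e1; nra.
have := jet_at0 ra; have -> : N * 2 ^+ k.+1 * expR (`|x| / 2) * growth x = 2 * A * expR (`|x| / 2).
  by rewrite /A exprS; ring.
by rewrite mulrBr mulr1; lra.
Qed.

(** A single integration leads from order 1 to order 0; bounding the integrand by a constant costs
    |x| instead of 2 exp(|x| / 2), which keeps the constant for [alpha = 2] small. *)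
Lemma jet_le2 x : alpha = 2%N -> `|D 0%N x| <= N * `|x| * growth x.
Proof.
move=> a2; have [D0 _ P _ _] := jD.
have a0 : (0 < alpha)%N by rewrite a2.
have := @primitive_growth_cst R _ _ (N * growth x) x (P _ a0).
rewrite D0 subr0 mulrAC; apply => t tx.
have := jet_top t; rewrite a2 => /le_trans; apply.
by rewrite ler_wpM2l ?jet_norm_ge0 ?growth_le.
Qed.

End bounds.
End jets.

(** * Bounds for the derivatives of f rho *)

Section leibniz_bounds.
Context {R : realType}.
Local Notation mu := (@lebesgue_measure R).
Local Notation s2pi := (Num.sqrt (2 * pi) : R).
Implicit Types (D : nat -> R -> R) (x y : R) (r i k : nat).

(** The factor 4 / 3 is the sum of the geometric series of ratio 1 / 4 in [leibniz_low_le_gen]. The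
    general value is too large for [unit_const_le] at [alpha = 2], where 4 comes from
    [leibniz_low_le2]. *)
Definition jet_const (alpha : nat) : R :=
  if alpha == 2%N then 4 else alpha`!%:R * 2 ^+ (2 * alpha - 1) * (4 / 3).

Lemma leibniz_termE D r i x :
  leibniz_term D r i x = 'C(r, i)%:R * ((herm (r - i)).[x] * (D i x * rho x)).
Proof. by rewrite /leibniz_term; move: (rho x) => w; ring. Qed.

Lemma herm0E x : (herm 0).[x] = 1.
Proof. by rewrite /= hornerE. Qed.

Lemma herm1E x : (herm 1).[x] = - x.
Proof. by rewrite /= derivC mulr1 sub0r hornerN hornerX. Qed.

Lemma herm2E x : (herm 2).[x] = x ^+ 2 - 1.
Proof.
rewrite -[herm 2]/(deriv (herm 1) - 'X * herm 1) deriv_herm scale1r.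
by rewrite hornerD !hornerN hornerM hornerX herm1E herm0E; ring.
Qed.

(** Leaves out the term with [D alpha], which is controlled in the weighted square mean only; the
    other terms have pointwise bounds. *)
Definition leibniz_low alpha D r x := \sum_(i < minn r.+1 alpha) leibniz_term D r i x.

Lemma leibniz_lowE alpha D r x : (r < alpha)%N -> leibniz D r x = leibniz_low alpha D r x.
Proof. by move=> ra; rewrite /leibniz_low (minn_idPl ra). Qed.

Lemma leibniz_top alpha D x :
  leibniz D alpha x = leibniz_low alpha D alpha x + D alpha x * rho x.
Proof.
rewrite /leibniz_low (minn_idPr (leqnSn _)) /leibniz big_ord_recr/=; congr (_ + _).
by rewrite leibniz_termE binn subnn herm0E !mul1r.
Qed.

Lemma geometric_quarter n : \sum_(i < n) (1 / 4 : R) ^+ i <= 4 / 3.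
Proof.
suff -> : \sum_(i < n) (1 / 4 : R) ^+ i = 4 / 3 * (1 - (1 / 4) ^+ n).
  have : (0 : R) <= (1 / 4) ^+ n by rewrite exprn_ge0.
  by lra.
elim: n => [|n IH]; first by rewrite big_ord0 expr0 subrr mulr0.
by rewrite big_ord_recr/= IH exprS; lra.
Qed.

Lemma jet_const_ge1 alpha : (2 <= alpha)%N -> 1 <= jet_const alpha.
Proof.
move=> a2; rewrite /jet_const; case: eqP => _; first by rewrite ler1n.
have h1 : (1 : R) <= alpha`!%:R by rewrite ler1n fact_gt0.
have h2 : (1 : R) <= 2 ^+ (2 * alpha - 1) by rewrite exprn_ege1// ler1n.
set a := _%:R in h1 *; set b := 2 ^+ _ in h2 *; nra.
Qed.

(** For [alpha = 2] these polynomials in y = |x| bound the Leibniz sums of order 0, 1 and 2, in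
    units of the bound for D 1 rho. The Taylor polynomial of degree 4 dominates them; for the cubic,
    y^2 (y - 1)^2 >= 0 compensates y^3. *)
Lemma cubic_le_expR y : 0 <= y -> [/\ y <= 4 * expR y, 1 + y ^+ 2 <= 4 * expR y &
  y ^+ 3 + 3 * y <= 4 * expR y].
Proof.
move=> y0; have : 1 + y + y ^+ 2 / 2 + y ^+ 3 / 6 + y ^+ 4 / 24 <= expR y.
  apply: le_trans (@expR_ge_sum R y 5 y0).
  rewrite !big_ord_recr big_ord0/= !factS fact0 expr0 expr1 add0r !divr1.
  by rewrite !muln1.
set e := expR y => H.
have y2 : 0 <= y ^+ 2 by exact: sqr_ge0.
have y3 : 0 <= y ^+ 3 by exact: exprn_ge0.
have y4 : 0 <= y ^+ 4 by exact: exprn_ge0.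
split; [lra|lra|].
have : 0 <= y ^+ 2 * (y - 1) ^+ 2 by rewrite mulr_ge0 ?sqr_ge0.
have -> : y ^+ 2 * (y - 1) ^+ 2 = y ^+ 4 - 2 * y ^+ 3 + y ^+ 2 by ring.
by lra.
Qed.

Section bounds.
Variables (alpha : nat) (D : nat -> R -> R).
Hypotheses (alpha2 : (2 <= alpha)%N) (jD : jet alpha D).
Let N := Num.sqrt (jet_sqnorm alpha D).

Let N0 : 0 <= N. Proof. exact: sqrtr_ge0. Qed.

Lemma leibniz_low_le2 r x : alpha = 2%N -> (r <= alpha)%N ->
  `|leibniz_low alpha D r x| <= N * jet_const alpha * decay x * expR `|x|.
Proof.
move=> a2 ra; have r0 := @rho_gt0 R x.
have a1 : alpha.-1 = 1%N by rewrite a2.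
have h0 := jet_le2 alpha2 jD x a2; have := jet_top alpha2 jD x; rewrite a1 => h1.
rewrite -/N in h0 h1.
have Nd : 0 <= N * growth x * rho x by rewrite !mulr_ge0 ?(ltW r0)//; have := @growth_ge1 R x; lra.
have d0 : `|D 0%N x * rho x| <= `|x| * (N * growth x * rho x).
  rewrite normrM (gtr0_norm r0).
  have -> : `|x| * (N * growth x * rho x) = N * `|x| * growth x * rho x.
    by move: (rho x) => w; ring.
  by rewrite ler_wpM2r// ltW.
have d1 : `|D 1%N x * rho x| <= N * growth x * rho x.
  by rewrite normrM (gtr0_norm r0) ler_wpM2r// ltW.
have [e1 e2 e3] := cubic_le_expR (normr_ge0 x).
have fin c y : c <= 4 * expR `|x| -> y <= c * (N * growth x * rho x) ->
    y <= N * jet_const alpha * decay x * expR `|x|.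
  move=> ce yc; apply: (le_trans yc); rewrite /jet_const a2/= -growth_rho.
  apply: (@le_trans _ _ (4 * expR `|x| * (N * growth x * rho x))).
    by rewrite ler_wpM2r.
  by apply: eqW; ring.
set p0 := D 0%N x * rho x in d0 *; set p1 := D 1%N x * rho x in d1 *.
set M := N * growth x * rho x in Nd d0 d1 fin *; set y := `|x| in d0 e1 e2 e3 fin *.
have y0 : 0 <= y by exact: normr_ge0.
have x2 : x ^+ 2 = y ^+ 2 by rewrite /y real_normK ?num_real.
have lowE k : leibniz_low alpha D k x = \sum_(i < minn k.+1 2) leibniz_term D k i x.
  by rewrite /leibniz_low a2.
case: r ra => [|[|[|r]]] ra; last by rewrite a2 in ra.
- rewrite lowE [minn _ _]/= big_ord_recr big_ord0/= add0r.
  rewrite leibniz_termE bin0 subn0 herm0E !mul1r.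
  exact: fin e1 d0.
- rewrite lowE [minn _ _]/= !big_ord_recr big_ord0/= add0r.
  rewrite !leibniz_termE bin0 binn subn0 subnn herm0E herm1E !mul1r -/p0 -/p1.
  apply: fin e2 _; apply: le_trans (ler_normD _ _) _; rewrite normrM normrN -/y.
  by rewrite mulrDl mul1r addrC expr2 -mulrA lerD// ler_wpM2l.
- rewrite lowE [minn _ _]/= !big_ord_recr big_ord0/= add0r.
  rewrite !leibniz_termE bin0 bin1 subn0 subSS subn0 herm1E herm2E mul1r -/p0 -/p1.
  apply: fin e3 _; apply: le_trans (ler_normD _ _) _.
  rewrite (normrM _ p0) (normrM 2) (normrM _ p1) normrN -/y normr_nat.
  have h : `|x ^+ 2 - 1| <= y ^+ 2 + 1.
    by apply: le_trans (ler_normB _ _) _; rewrite normr1 ger0_norm ?sqr_ge0// x2.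
  have -> : (y ^+ 3 + 3 * y) * M = (y ^+ 2 + 1) * (y * M) + 2 * (y * M) by ring.
  by apply: lerD; [apply: ler_pM|rewrite ler_wpM2l// ler_wpM2l].
Qed.

(** In the term of index i the binomial coefficient times (r - i)! is at most alpha!, the powers of
    2 from [herm_le] and [jet_le] multiply to at most 2^(2 alpha - 1) / 4^i, and their two factors
    exp(|x| / 2) to exp |x|. *)
Lemma leibniz_low_le_gen r x : (r <= alpha)%N ->
  `|leibniz_low alpha D r x| <=
  N * (alpha`!%:R * 2 ^+ (2 * alpha - 1) * (4 / 3)) * decay x * expR `|x|.
Proof.
move=> ra; have r0 := @rho_gt0 R x; have g1 := @growth_ge1 R x.
have M0 : 0 <= N * growth x * rho x by rewrite !mulr_ge0 ?(ltW r0)//; lra.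
pose A : R := alpha`!%:R * 2 ^+ (2 * alpha - 1).
have A0 : 0 <= A by rewrite mulr_ge0 ?exprn_ge0.
have term i : (i < minn r.+1 alpha)%N ->
    `|leibniz_term D r i x| <= A * (N * growth x * rho x) * expR `|x| * (1 / 4) ^+ i.
  rewrite leq_min => /andP[ir ia].
  have ka : (alpha.-1 - i < alpha)%N by lia.
  have := jet_le alpha2 jD x ka; rewrite (_ : (alpha.-1 - (alpha.-1 - i))%N = i); last by lia.
  move=> hD; have hh := @herm_le R (r - i) x.
  rewrite leibniz_termE normrM (normrM _ (D i x * rho x)) (normrM (D i x)) normr_nat (gtr0_norm r0).
  have hC : ('C(r, i) * (r - i)`! <= alpha`!)%N.
    have ir' : (i <= r)%N by [].
    apply: leq_trans (leq_fact ra); rewrite -(bin_fact ir') leq_mul2l.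
    by rewrite leq_pmull ?fact_gt0// orbT.
  have hCR : 'C(r, i)%:R * (r - i)`!%:R <= alpha`!%:R :> R by rewrite -natrM ler_nat.
  have h2 : 2 ^+ (r - i) * 2 ^+ (alpha.-1 - i) <= 2 ^+ (2 * alpha - 1) * (1 / 4) ^+ i :> R.
    have -> : (1 / 4 : R) ^+ i = (2 ^+ (2 * i))^-1.
      by rewrite exprM -exprVn mul1r expr2 -natrM.
    by rewrite ler_pdivlMr ?exprn_gt0// -!exprD ler_eXn2l ?ltr1n//; lia.
  have E2 : expR (`|x| / 2) * expR (`|x| / 2) = expR `|x| by rewrite -expRD -splitr.
  apply: (@le_trans _ _ ('C(r, i)%:R * ((r - i)`!%:R * 2 ^+ (r - i) * expR (`|x| / 2) *
     (N * 2 ^+ (alpha.-1 - i) * expR (`|x| / 2) * growth x * rho x)))).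
    rewrite ler_wpM2l// ler_pM//; first by rewrite mulr_ge0 ?(ltW r0).
    by rewrite ler_wpM2r// ltW.
  have -> : 'C(r, i)%:R * ((r - i)`!%:R * 2 ^+ (r - i) * expR (`|x| / 2) *
     (N * 2 ^+ (alpha.-1 - i) * expR (`|x| / 2) * growth x * rho x)) =
     ('C(r, i)%:R * (r - i)`!%:R) * (2 ^+ (r - i) * 2 ^+ (alpha.-1 - i)) *
     ((N * growth x * rho x) * expR `|x|).
    by rewrite -E2; move: (rho x) (growth x) => w g; ring.
  have -> : A * (N * growth x * rho x) * expR `|x| * (1 / 4) ^+ i =
     (alpha`!%:R * (2 ^+ (2 * alpha - 1) * (1 / 4) ^+ i)) * ((N * growth x * rho x) * expR `|x|).
    by rewrite /A; move: (rho x) (growth x) => w g; ring.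
  apply: ler_wpM2r; first exact: mulr_ge0 M0 (expR_ge0 _).
  by apply: ler_pM => //; rewrite ?mulr_ge0 ?exprn_ge0.
apply: le_trans (ler_norm_sum _ _ _) _.
apply: (@le_trans _ _ (\sum_(i < minn r.+1 alpha)
    A * (N * growth x * rho x) * expR `|x| * (1 / 4) ^+ i)).
  by apply: ler_sum => i _; exact: term.
rewrite -mulr_sumr -growth_rho.
apply: (@le_trans _ _ (A * (N * growth x * rho x) * expR `|x| * (4 / 3))).
  rewrite ler_wpM2l ?geometric_quarter//.
  exact: mulr_ge0 (mulr_ge0 A0 M0) (expR_ge0 _).
by apply: eqW; rewrite -/A; move: (rho x) (growth x) => w g; ring.
Qed.

Lemma leibniz_low_le r x : (r <= alpha)%N ->
  `|leibniz_low alpha D r x| <= N * jet_const alpha * decay x * expR `|x|.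
Proof.
move=> ra; have [a2|a2] := eqVneq alpha 2%N; first exact: leibniz_low_le2.
by rewrite /jet_const (negbTE a2); exact: leibniz_low_le_gen.
Qed.

End bounds.

(** The square of decay x * exp |x| is exp(5 |x| / 2 - x^2 / 2); the sum over both signs replaces
    |x|, so that the integral reduces to exponential moments of [rho]. *)
Definition majorant x := s2pi * (expR (5 / 2 * x) * rho x + expR (- (5 / 2) * x) * rho x).

Lemma decay_le_majorant x : (decay x * expR `|x|) ^+ 2 <= majorant x.
Proof.
have /andP[s2 _] := @sqrt2pi_bounds R.
have s0 : s2pi != 0 by rewrite gt_eqF//; lra.
have E c : s2pi * (expR c * rho x) = expR (c - x ^+ 2 / 2).
  by rewrite expRD /rho; field.
rewrite /majorant mulrDr !E /decay -expRD -expRM_natl.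
have [x0|x0] := leP 0 x.
  rewrite (ger0_norm x0); apply: ler_wpDr; first exact: expR_ge0.
  by rewrite ler_expR; lra.
rewrite (ltr0_norm x0); apply: ler_wpDl; first exact: expR_ge0.
by rewrite ler_expR; lra.
Qed.

Lemma Rintegrable_majorant : Rintegrable mu setT majorant.
Proof.
by apply: RintegrableZ => //; apply: RintegrableD => //; exact: integrable_expR_rho.
Qed.

Lemma Rintegral_majorant : \int[mu]_x majorant x <= 192.
Proof.
rewrite RintegralZl//; last by apply: RintegrableD => //; exact: integrable_expR_rho.
rewrite RintegralD//; [|exact: integrable_expR_rho..].
rewrite !Rintegral_expR_rho sqrrN.
have /andP[s2 s3] := @sqrt2pi_bounds R.
have -> : (5 / 2) ^+ 2 / 2 = 25 / 8 :> R by field.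
(* With n = 25 the base is 8 / 7, whose fifth power is at most 2. Then 3 * 2 * 32 = 192, with 3 a
   bound for sqrt(2 pi) and 2 for the two signs. *)
have e : expR (25 / 8 : R) <= 32.
  apply: le_trans (@expR_le_inv R (25 / 8) 25 _ _) _ => //; first by apply/andP; split; lra.
  have -> : (1 - 25 / 8 / 25 : R)^-1 = 8 / 7 by field.
  have -> : (8 / 7 : R) ^+ 25 = ((8 / 7) ^+ 5) ^+ 5 by rewrite -exprM.
  have h : (8 / 7 : R) ^+ 5 <= 2 by rewrite !exprS expr0; lra.
  apply: (@le_trans _ _ (2 ^+ 5)); first by apply: lerXn2r => //; rewrite nnegrE//; apply: exprn_ge0.
  by rewrite !exprS expr0; lra.
have e0 := expR_ge0 (25 / 8 : R).
set f := expR _ in e e0 *; set s := s2pi in s2 s3 *; nra.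
Qed.

Section integrals.
Variables (alpha : nat) (D : nat -> R -> R).
Hypotheses (alpha2 : (2 <= alpha)%N) (jD : jet alpha D).
Let N2 := jet_sqnorm alpha D.
Let K := jet_const alpha.

Lemma measurable_leibniz r : (r <= alpha)%N -> measurable_fun setT (leibniz D r).
Proof.
have [_ cD _ mD _] := jD.
have mDi i : (i <= alpha)%N -> measurable_fun setT (D i).
  rewrite leq_eqVlt => /predU1P[->//|/cD]; exact: continuous_measurable_fun.
move=> ra; apply: measurable_sum => i; apply: measurable_funM; last first.
  by apply: continuous_measurable_fun; exact: herm_rho_continuous.
apply: measurable_funM; first exact: measurable_cst.
by apply: mDi; apply: leq_trans ra; rewrite -ltnS.
Qed.

Lemma leibniz_low_sqr_le r x : (r <= alpha)%N ->
  leibniz_low alpha D r x ^+ 2 <= N2 * K ^+ 2 * majorant x.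
Proof.
move=> ra; have := leibniz_low_le alpha2 jD x ra.
have N2E : Num.sqrt N2 ^+ 2 = N2 by rewrite sqr_sqrtr// jet_sqnorm_ge0.
move=> h; rewrite -[leLHS](real_normK (num_real _)).
apply: (@le_trans _ _ ((Num.sqrt N2 * K * decay x * expR `|x|) ^+ 2)).
  by apply: lerXn2r => //; rewrite nnegrE// (le_trans _ h).
rewrite -[_ * decay x * _]mulrA exprMn exprMn N2E ler_wpM2l ?decay_le_majorant//.
by rewrite mulr_ge0 ?sqr_ge0 ?jet_sqnorm_ge0.
Qed.

Lemma leibniz_sqr_int r : (r < alpha)%N ->
  Rintegrable mu setT (fun x => leibniz D r x ^+ 2) /\
  \int[mu]_x (leibniz D r x ^+ 2) <= 192 * N2 * K ^+ 2.
Proof.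
move=> ra; have mi : Rintegrable mu setT (fun x => N2 * K ^+ 2 * majorant x).
  by apply: RintegrableZ => //; exact: Rintegrable_majorant.
have li : Rintegrable mu setT (fun x => leibniz D r x ^+ 2).
  apply: le_Rintegrable mi => //.
    by apply: measurable_funX; exact: measurable_leibniz (ltnW ra).
  by move=> x _; rewrite ger0_norm ?sqr_ge0// (leibniz_lowE _ _ ra) leibniz_low_sqr_le// ltnW.
split => //; apply: (@le_trans _ _ (\int[mu]_x (N2 * K ^+ 2 * majorant x))).
  by apply: le_Rintegral => // x _; rewrite (leibniz_lowE _ _ ra) leibniz_low_sqr_le// ltnW.
rewrite RintegralZl//; last exact: Rintegrable_majorant.
have := Rintegral_majorant; have : 0 <= N2 * K ^+ 2 by rewrite mulr_ge0 ?sqr_ge0 ?jet_sqnorm_ge0.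
set a := N2 * _; set b := \int[_]_(_ in _) _ => a0 bb.
by rewrite -mulrA -/a mulrC ler_wpM2r.
Qed.

(** From (a + b)^2 <= 2 a^2 + 2 b^2: the bound rho <= 1 / 2 absorbs the second factor 2, and the
    first turns 192 into 384. *)
Lemma leibniz_top_sqr_int :
  Rintegrable mu setT (fun x => leibniz D alpha x ^+ 2) /\
  \int[mu]_x (leibniz D alpha x ^+ 2) <= N2 * (1 + 384 * K ^+ 2).
Proof.
have [_ _ _ mD Di] := jD.
have mi : Rintegrable mu setT (fun x => N2 * K ^+ 2 * majorant x).
  by apply: RintegrableZ => //; exact: Rintegrable_majorant.
have bi : Rintegrable mu setT (fun x => 2 * (N2 * K ^+ 2 * majorant x) + D alpha x ^+ 2 * rho x).
  by apply: RintegrableD => //; exact: RintegrableZ.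
have ptw x : leibniz D alpha x ^+ 2 <= 2 * (N2 * K ^+ 2 * majorant x) + D alpha x ^+ 2 * rho x.
  rewrite leibniz_top; have := leibniz_low_sqr_le x (leqnn alpha).
  set a := leibniz_low _ _ _ _; set b := N2 * _ * _ => ab.
  have r0 := @rho_gt0 R x; have r1 := @rho_le_half R x.
  set d := D alpha x; set w := rho x in r0 r1 *.
  have h1 : (a + d * w) ^+ 2 <= 2 * a ^+ 2 + 2 * (d * w) ^+ 2.
    by have := sqr_ge0 (a - d * w); nra.
  have h2 : 2 * (d * w) ^+ 2 <= d ^+ 2 * w.
    have w2 : 0 <= 1 - 2 * w by lra.
    have := mulr_ge0 (mulr_ge0 (sqr_ge0 d) (ltW r0)) w2.
    have -> : d ^+ 2 * w * (1 - 2 * w) = d ^+ 2 * w - 2 * (d * w) ^+ 2 by ring.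
    by rewrite subr_ge0.
  by lra.
have li : Rintegrable mu setT (fun x => leibniz D alpha x ^+ 2).
  apply: le_Rintegrable bi => //.
    by apply: measurable_funX; exact: measurable_leibniz.
  by move=> x _; rewrite ger0_norm ?sqr_ge0.
split => //; apply: (@le_trans _ _ (\int[mu]_x (2 * (N2 * K ^+ 2 * majorant x) + D alpha x ^+ 2 * rho x))).
  exact: le_Rintegral.
rewrite RintegralD//; last exact: RintegrableZ.
rewrite RintegralZl// RintegralZl//; last exact: Rintegrable_majorant.
have h3 : \int[mu]_x (D alpha x ^+ 2 * rho x) <= N2.
  by rewrite lerDr sumr_ge0// => i _; exact: sqr_ge0.
have := Rintegral_majorant; have : 0 <= N2 * K ^+ 2 by rewrite mulr_ge0 ?sqr_ge0 ?jet_sqnorm_ge0.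
have -> : N2 * (1 + 384 * K ^+ 2) = N2 + 384 * (N2 * K ^+ 2) by ring.
set a := N2 * _; set b := \int[_]_(_ in _) majorant _ => a0 bb.
have : a * b <= a * 192 by rewrite ler_wpM2l.
by lra.
Qed.

End integrals.

End leibniz_bounds.

(** * Change of variables between [-T, T] and [0, 1] *)

Section affine_Rintegral.
Context {R : realType}.
Local Notation mu := (@lebesgue_measure R).
Variables (a b : R).
Hypothesis a0 : 0 < a.
Implicit Types (g : R -> R).

Variable D : set (measurableTypeR R).
Hypothesis mD : measurable D.

Lemma measurable_affine_preimage : measurable (affine a b @^-1` D : set (measurableTypeR R)).
Proof. by rewrite -[X in measurable X]setTI; exact: measurable_affine. Qed.

Lemma measurable_comp_affine g : measurable_fun setT g ->
  measurable_fun setT (g \o affine a b : measurableTypeR R -> R).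
Proof. by move=> mg; apply: measurableT_comp => //; exact: measurable_affine. Qed.

Lemma ge0_Rintegral_affine g : measurable_fun setT g -> (forall x, 0 <= g x) ->
  Rintegrable mu D g ->
  Rintegrable mu (affine a b @^-1` D) (g \o affine a b) /\
  \int[mu]_(x in D) g x = a * \int[mu]_(x in affine a b @^-1` D) g (affine a b x).
Proof.
move=> mg g0 gi; have mga := measurable_comp_affine mg.
have mg' : measurable_fun setT (EFin \o g : measurableTypeR R -> \bar R) by exact/measurable_EFinP.
have := ge0_integral_affine b a0 mD mg' (fun x => ltac:(by rewrite lee_fin)).
rewrite /comp; set X := (\int[mu]_(x in affine _ _ @^-1` _) _)%E => XE.
have X0 : (0 <= X)%E by apply: integral_ge0 => x _; rewrite lee_fin.
have Xoo : (X < +oo)%E.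
  have := integrable_fin_num mD gi; rewrite /comp XE.
  rewrite ltNge leye_eq; apply: contraL => /eqP ->.
  by rewrite gt0_muley ?lte_fin.
split.
  apply: Rintegrable_ge0 => //; first exact: measurable_funTS.
rewrite /Rintegral XE fineM//; last by rewrite ge0_fin_numE.
Qed.

Lemma Rintegral_affine g : measurable_fun setT g -> Rintegrable mu D g ->
  Rintegrable mu (affine a b @^-1` D) (g \o affine a b) /\
  \int[mu]_(x in D) g x = a * \int[mu]_(x in affine a b @^-1` D) g (affine a b x).
Proof.
move=> mg gi; have mD' := measurable_affine_preimage.
have ai : Rintegrable mu D (fun x => `|g x|) by exact: integrable_norm.
pose p x := 1 / 2 * (`|g x| + g x); pose n x := 1 / 2 * (`|g x| - g x).
have mn : measurable_fun setT (fun x => `|g x|) by exact: measurableT_comp.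
have mp : measurable_fun setT p by apply: measurable_funM => //; exact: measurable_funD.
have mm : measurable_fun setT n by apply: measurable_funM => //; exact: measurable_funB.
have p0 x : 0 <= p x by rewrite mulr_ge0// -lerBlDr sub0r -normrN ler_norm.
have n0 x : 0 <= n x by rewrite mulr_ge0// subr_ge0 ler_norm.
have ip : Rintegrable mu D p by apply: RintegrableZ => //; exact: RintegrableD.
have im : Rintegrable mu D n by apply: RintegrableZ => //; exact: RintegrableB.
have [ipa pE] := ge0_Rintegral_affine mp p0 ip.
have [ima nE] := ge0_Rintegral_affine mm n0 im.
have gE x : g x = p x - n x by rewrite /p /n; lra.
have -> : g = fun x => p x - n x by apply/funext.
split; first exact: RintegrableB.
by rewrite RintegralB// pE nE -mulrBr -RintegralB.
Qed.

End affine_Rintegral.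

Section scaled_leibniz.
Context {R : realType}.
Local Notation mu := (@lebesgue_measure R).
Variable (T : R).
Hypothesis T2 : 2 <= T.
Implicit Types (D : nat -> R -> R) (x y : R) (r i k : nat) (g : R -> R).

Let T0 : 0 < 2 * T. Proof. by rewrite mulr_gt0// (lt_le_trans _ T2). Qed.

Local Notation I01 := (`[0, 1]%classic : set (measurableTypeR R)).

(** The derivative of order [r] of the image in [H_unit]: the Jacobian gives one factor 2 T, the
    chain rule [r] more. *)
Definition scaled D r y := (2 * T) ^+ r.+1 * leibniz D r (2 * T * y - T).

Lemma affine_preimage_cube : affine (2 * T) (- T) @^-1` `[- T, T]%classic = `[0, 1]%classic.
Proof.
have := T2 => ?; apply/seteqP; split => x /=; rewrite !in_itv/= /affine => /andP[? ?];
  by apply/andP; split; nra.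
Qed.

Lemma Rintegral_scaling g : measurable_fun setT g -> (forall x, 0 <= g x) ->
  Rintegrable mu setT g ->
  Rintegrable mu I01 (fun y => g (2 * T * y - T)) /\
  \int[mu]_(y in `[0, 1]) g (2 * T * y - T) <= (2 * T)^-1 * \int[mu]_x g x.
Proof.
move=> mg g0 gi.
have mT := @measurable_itv R `[- T, T].
have giT : Rintegrable mu `[- T, T]%classic g by exact: RintegrableS gi.
have [] := Rintegral_affine (- T) T0 mT mg giT.
rewrite affine_preimage_cube => ia E; split => //.
have -> : \int[mu]_(y in `[0, 1]) g (2 * T * y - T) = (2 * T)^-1 * \int[mu]_(x in `[- T, T]) g x.
  by rewrite E mulrA mulVf ?mul1r// gt_eqF.
rewrite ler_pM2l ?invr_gt0//; exact: subset_Rintegral.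
Qed.

Section bound.
Variables (alpha : nat) (D : nat -> R -> R).
Hypotheses (alpha2 : (2 <= alpha)%N) (jD : jet alpha D).
Let N2 := jet_sqnorm alpha D.
Let K : R := jet_const alpha.

Lemma scaled_sqr_int r (C : R) : (r <= alpha)%N ->
  Rintegrable mu setT (fun x => leibniz D r x ^+ 2) ->
  \int[mu]_x (leibniz D r x ^+ 2) <= C ->
  Rintegrable mu I01 (fun y => scaled D r y ^+ 2) /\
  \int[mu]_(y in `[0, 1]) (scaled D r y ^+ 2) <= (2 * T) ^+ r.*2.+1 * C.
Proof.
move=> ra li lC.
have mg : measurable_fun setT (fun x => leibniz D r x ^+ 2).
  by apply: measurable_funX; exact: (measurable_leibniz jD).
have [gi gE] := Rintegral_scaling mg (fun x => sqr_ge0 _) li.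
have E y : scaled D r y ^+ 2 = (2 * T) ^+ r.*2.+2 * leibniz D r (2 * T * y - T) ^+ 2.
  by rewrite /scaled exprMn -exprM muln2.
have -> : (fun y => scaled D r y ^+ 2) =
    (fun y => (2 * T) ^+ r.*2.+2 * leibniz D r (2 * T * y - T) ^+ 2) by apply/funext.
split; first exact: RintegrableZ.
rewrite RintegralZl//; apply: (@le_trans _ _ ((2 * T) ^+ r.*2.+2 * ((2 * T)^-1 * C))).
  rewrite ler_pM2l ?exprn_gt0//; apply: (le_trans gE).
  by rewrite ler_pM2l ?invr_gt0.
by rewrite exprSr -(mulrA (_ ^+ _)) mulVKf// gt_eqF.
Qed.

Lemma measurable_scaled r : (r <= alpha)%N -> measurable_fun setT (scaled D r).
Proof.
move=> ra; apply: measurable_funM => //.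
exact: (measurable_comp_affine (2 * T) (- T) (measurable_leibniz jD ra)).
Qed.

Lemma scaled_int r : (r <= alpha)%N -> Rintegrable mu I01 (fun y => scaled D r y ^+ 2) ->
  Rintegrable mu I01 (scaled D r).
Proof.
move=> ra si; have i1 : Rintegrable mu I01 (fun=> 1 : R).
  by apply: continuous_Rintegrable => x; exact: cvg_cst.
apply: le_Rintegrable (RintegrableD _ si i1) => //.
  by apply: measurable_funTS; exact: measurable_scaled.
move=> x _; rewrite -[_ ^+ 2](real_normK (num_real _)); set u := `|_|.
by have := sqr_ge0 (u - 1 / 2); nra.
Qed.

Lemma scaled_int_lt r : (r < alpha)%N -> Rintegrable mu I01 (scaled D r).
Proof.
move=> ra; have [h1 h2] := leibniz_sqr_int alpha2 jD ra.
by apply: scaled_int (ltnW ra) _; have [] := scaled_sqr_int (ltnW ra) h1 h2.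
Qed.

Lemma scaled_sqr_int_top : Rintegrable mu I01 (fun y => scaled D alpha y ^+ 2).
Proof.
have [h1 h2] := leibniz_top_sqr_int alpha2 jD.
by have [] := scaled_sqr_int (leqnn _) h1 h2.
Qed.

(** The ratio (2 T)^2 is at least 16, so the sum is at most the next term divided by 15. *)
Lemma geometric_scaling n : \sum_(0 <= r < n) (2 * T) ^+ r.*2.+1 <= (2 * T) ^+ n.*2.+1 / 15.
Proof.
elim: n => [|n IH]; first by rewrite big_geq// divr_ge0// exprn_ge0 ?ltW.
rewrite big_nat_recr//= doubleS [in leRHS]exprS [in leRHS]exprS.
set u := (2 * T) ^+ n.*2.+1 in IH *.
have u0 : 0 <= u by rewrite exprn_ge0 ?ltW.
have : 16 * u <= (2 * T * (2 * T)) * u by rewrite ler_wpM2r//; have := T2; nra.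
by lra.
Qed.

Lemma scaled_norm_le :
  \sum_(0 <= r < alpha) (\int[mu]_(y in `[0, 1]) scaled D r y) ^+ 2 +
  \int[mu]_(y in `[0, 1]) (scaled D alpha y ^+ 2) <=
  (2 * T) ^+ alpha.*2.+1 * (400 * K ^+ 2) * N2.
Proof.
have N20 : 0 <= N2 by exact: jet_sqnorm_ge0.
have K1 : 1 <= K ^+ 2 by rewrite exprn_ege1// jet_const_ge1.
have [t1 t2] := leibniz_top_sqr_int alpha2 jD.
have [_ top] := scaled_sqr_int (leqnn _) t1 t2.
have low : \sum_(0 <= r < alpha) (\int[mu]_(y in `[0, 1]) scaled D r y) ^+ 2 <=
    (\sum_(0 <= r < alpha) (2 * T) ^+ r.*2.+1) * (192 * N2 * K ^+ 2).
  rewrite mulr_suml; apply: ler_sum_nat => r /andP[_ ra].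
  have [h1 h2] := leibniz_sqr_int alpha2 jD ra.
  have [si sE] := scaled_sqr_int (ltnW ra) h1 h2.
  apply: le_trans sE; have := Rintegral_itv_sqr_le ler01 (scaled_int_lt ra) si.
  by rewrite subr0 mul1r.
have C0 : 0 <= 192 * N2 * K ^+ 2 := mulr_ge0 (mulr_ge0 (ler0n _ 192) N20) (sqr_ge0 K).
have := ler_wpM2r C0 (geometric_scaling alpha).
set u := (2 * T) ^+ alpha.*2.+1 in top *.
have u0 : 0 <= u by rewrite exprn_ge0 ?ltW.
move=> geo; apply: le_trans (lerD (le_trans low geo) top) _.
(* Here 192 / 15 + 384 = 396.8, and K >= 1 absorbs the remaining 1: the total stays below 400
   K^2. *)
have -> : u / 15 * (192 * N2 * K ^+ 2) + u * (N2 * (1 + 384 * K ^+ 2)) =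
  u * N2 * (1 + (192 / 15 + 384) * K ^+ 2) by field.
have -> : u * (400 * K ^+ 2) * N2 = u * N2 * (400 * K ^+ 2) by ring.
by apply: ler_wpM2l; [exact: mulr_ge0|lra].
Qed.

End bound.
End scaled_leibniz.

(** * Positive semidefinite kernels and tensor powers *)

Section psd_kernels.
Context {R : realType}.

Section one_type.
Variable T : Type.
Implicit Types (K L : T -> T -> R) (u v : seq (R * T)).

(** Quadratic form of a kernel on formal combinations, in the same list representation as [tensor],
    which makes [tensor_dot] an instance by conversion. *)
Definition bform K u v := \sum_(t <- u) \sum_(t' <- v) t.1 * t'.1 * K t.2 t'.2.

Definition psd K := (forall x y, K x y = K y x) /\ forall u, 0 <= bform K u u.

Definition scale_seq (a : R) u := [seq (a * t.1, t.2) | t <- u].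

Lemma bform_cons K c x u : (forall x y, K x y = K y x) ->
  bform K ((c, x) :: u) ((c, x) :: u) =
  c ^+ 2 * K x x + 2 * c * (\sum_(t <- u) t.1 * K x t.2) + bform K u u.
Proof.
move=> symK; rewrite /bform big_cons big_cons/= -expr2 -!addrA; congr (_ + _).
under [X in _ + X = _]eq_bigr do rewrite big_cons/=.
rewrite big_split/= addrA; congr (_ + _).
rewrite -mulrA mulr2n [RHS]mulrDl !mul1r; congr (_ + _).
  by rewrite mulr_sumr; apply: eq_bigr => t _; rewrite mulrA.
by rewrite mulr_sumr; apply: eq_bigr => t _; rewrite symK mulrA [c * _]mulrC.
Qed.

Lemma bform_cat K a u v : (forall x y, K x y = K y x) ->
  bform K (u ++ scale_seq a v) (u ++ scale_seq a v) =
  bform K u u + 2 * a * bform K u v + a ^+ 2 * bform K v v.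
Proof.
move=> symK; rewrite /bform big_cat/= big_map/=.
under eq_bigr do rewrite big_cat/= big_map/=.
under [X in _ + X = _]eq_bigr do rewrite big_cat/= big_map/=.
rewrite !big_split/= -!addrA; congr (_ + _); rewrite addrA; congr (_ + _).
  rewrite -mulrA mulr2n [RHS]mulrDl !mul1r; congr (_ + _).
    rewrite mulr_sumr; apply: eq_bigr => t _; rewrite mulr_sumr; apply: eq_bigr => t' _.
    by rewrite /=; lra.
  rewrite exchange_big mulr_sumr; apply: eq_bigr => t _.
  rewrite mulr_sumr; apply: eq_bigr => t' _.
  by rewrite /= symK; lra.
rewrite mulr_sumr; apply: eq_bigr => t _; rewrite mulr_sumr; apply: eq_bigr => t' _.
by rewrite /=; lra.
Qed.

(** Otherwise the form at two points is affine in the weight of [x]; the weight chosen gives it the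
    value -1. *)
Lemma psd0 K x y : psd K -> K x x = 0 -> K x y = 0.
Proof.
move=> [symK K0] Kx; have := K0 [:: (- ((K y y + 1) / (2 * K x y)), x); (1, y)].
rewrite bform_cons// Kx big_seq1/= /bform !big_seq1/= => h.
apply/eqP/negP => /negP Kxy; move: h.
suff -> : 2 * - ((K y y + 1) / (2 * K x y)) * (1 * K x y) = - (K y y + 1) by lra.
by field.
Qed.

Lemma eq_psd K L : (forall x y, K x y = L x y) -> psd K -> psd L.
Proof.
by move=> E; have -> // : K = L by apply/funext => x; apply/funext => y.
Qed.

Lemma bformD K L u v : bform (fun x y => K x y + L x y) u v = bform K u v + bform L u v.
Proof.
rewrite /bform -big_split/=; apply: eq_bigr => t _; rewrite -big_split/=.
by apply: eq_bigr => t' _; rewrite mulrDr.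
Qed.

Lemma bformZ a K u v : bform (fun x y => a * K x y) u v = a * bform K u v.
Proof.
rewrite /bform mulr_sumr; apply: eq_bigr => t _; rewrite mulr_sumr.
by apply: eq_bigr => t' _; rewrite mulrCA.
Qed.

Lemma psdD K L : psd K -> psd L -> psd (fun x y => K x y + L x y).
Proof.
move=> [sK K0] [sL L0]; split=> [x y|u]; first by rewrite sK sL.
by rewrite bformD addr_ge0.
Qed.

Lemma bform_rank1 (f : T -> R) u v : bform (fun x y => f x * f y) u v =
  (\sum_(t <- u) t.1 * f t.2) * (\sum_(t <- v) t.1 * f t.2).
Proof.
rewrite /bform mulr_suml; apply: eq_bigr => t _; rewrite mulr_sumr.
by apply: eq_bigr => t' _; rewrite mulrACA.
Qed.

Lemma psd_rank1 (f : T -> R) : psd (fun x y => f x * f y).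
Proof.
by split=> [x y|u]; [rewrite mulrC|rewrite bform_rank1 -expr2 sqr_ge0].
Qed.

(** Minimization of the form of u + a v over [a]. When [v] has norm 0 the form is affine in [a],
    which forces the mixed term to vanish. *)
Lemma bform_Cauchy_Schwarz K u v : psd K ->
  (bform K u v) ^+ 2 <= bform K u u * bform K v v.
Proof.
move=> [symK K0]; have H a := K0 (u ++ scale_seq a v).
set b := bform K u v; set p := bform K u u; set q := bform K v v.
have {}H a : 0 <= p + 2 * a * b + a ^+ 2 * q by rewrite /p -bform_cat.
have [q0|q0] := eqVneq q 0.
  have [->|b0] := eqVneq b 0; first by rewrite expr0n q0 mulr0.
  have := H (- ((p + 1) / (2 * b))); rewrite q0 mulr0 addr0.
  suff -> : 2 * - ((p + 1) / (2 * b)) * b = - (p + 1) by lra.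
  by field.
have q1 : 0 < q by rewrite lt_neqAle eq_sym q0 K0.
have := H (- b / q); have -> : p + 2 * (- b / q) * b + (- b / q) ^+ 2 * q = p - b ^+ 2 / q.
  by field.
by rewrite subr_ge0 ler_pdivrMr.
Qed.

(* With respect to a point where K is not zero, K is the sum of a rank one kernel
   and of its Schur complement, which vanishes at that point: this reduces the Schur
   product theorem to finitely many rank one kernels. *)
Lemma psd_schur K x0 : psd K -> K x0 x0 != 0 ->
  psd (fun x y => K x y - K x x0 * K x0 y / K x0 x0).
Proof.
move=> [symK K0] k0; split=> [x y|u].
  by rewrite symK (symK y x0) (symK x0 x) [K x0 y * _]mulrC.
pose S := \sum_(t <- u) t.1 * K x0 t.2.
have -> : bform (fun x y => K x y - K x x0 * K x0 y / K x0 x0) u u =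
    bform K u u + - (K x0 x0)^-1 * S ^+ 2.
  rewrite /S expr2 -bform_rank1 -bformZ -bformD; congr bform.
  by apply/funext => x; apply/funext => y; rewrite (symK x x0); field.
have := K0 ((- S / K x0 x0, x0) :: u); rewrite bform_cons// -/S.
by congr (_ <= _); field.
Qed.

(** Induction on the points, for all [K] at once. The Schur complement at the first point has a zero
    row there, so that point drops out of its product with [L]; the rank one remainder times [L] is
    the form of [L] with rescaled weights. *)
Lemma psdM K L : psd K -> psd L -> psd (fun x y => K x y * L x y).
Proof.
move=> pK pL; split=> [x y|u]; first by rewrite pK.1 pL.1.
elim: u K pK => [|[c x0] u IH] K pK; first by rewrite /bform big_nil.
have red K' : psd K' -> (forall y, K' x0 y = 0) ->
    0 <= bform (fun x y => K' x y * L x y) ((c, x0) :: u) ((c, x0) :: u).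
  move=> pK' K'0; rewrite bform_cons; last by move=> x y; rewrite pK'.1 pL.1.
  rewrite K'0 mul0r mulr0 add0r big1 ?mulr0 ?add0r; last by move=> t _; rewrite K'0 mul0r mulr0.
  exact: IH.
have [k0|k0] := eqVneq (K x0 x0) 0.
  by apply: red => // y; exact: psd0.
have kp : 0 < K x0 x0.
  rewrite lt_neqAle eq_sym k0/=; have := pK.2 [:: (1, x0)].
  by rewrite /bform !big_seq1/= !mul1r.
set w := (c, x0) :: u.
have -> : bform (fun x y => K x y * L x y) w w =
    bform (fun x y => (K x y - K x x0 * K x0 y / K x0 x0) * L x y) w w +
    (K x0 x0)^-1 * bform L [seq (t.1 * K x0 t.2, t.2) | t <- w]
      [seq (t.1 * K x0 t.2, t.2) | t <- w].
  have -> : bform L [seq (t.1 * K x0 t.2, t.2) | t <- w]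
      [seq (t.1 * K x0 t.2, t.2) | t <- w] =
      bform (fun x y => K x0 x * K x0 y * L x y) w w.
    rewrite /bform big_map; apply: eq_bigr => t _; rewrite big_map.
    by apply: eq_bigr => t' _ /=; lra.
  rewrite -bformZ -bformD; congr bform; apply/funext => x; apply/funext => y.
  by rewrite (pK.1 x x0); field.
apply: addr_ge0; last by rewrite mulr_ge0 ?invr_ge0 ?(ltW kp)// pL.2.
apply: red; first exact: psd_schur.
by move=> y; field.
Qed.

End one_type.

Lemma psd_comp (T S : Type) (h : S -> T) (K : T -> T -> R) :
  psd K -> psd (fun x y => K (h x) (h y)).
Proof.
move=> [symK K0]; split=> [//|u].
have := K0 [seq (t.1, h t.2) | t <- u]; congr (_ <= _).
rewrite /bform big_map; apply: eq_bigr => t _; rewrite big_map.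
exact: eq_bigr.
Qed.

(** Products preserve the order between positive semidefinite kernels: P P' - Q Q' = (P - Q) P' + Q
    (P' - Q'), where P' is the sum of Q' and P' - Q'. *)
Lemma psd_prod (I T : Type) (r : seq I) (P Q : I -> T -> T -> R) :
  (forall i, psd (Q i)) -> (forall i, psd (fun x y => P i x y - Q i x y)) ->
  psd (fun x y => \prod_(i <- r) Q i x y) /\
  psd (fun x y => \prod_(i <- r) P i x y - \prod_(i <- r) Q i x y).
Proof.
move=> pQ pPQ; elim: r => [|i r [IH1 IH2]].
  split; first by apply: eq_psd (psd_rank1 (fun=> 1)) => x y; rewrite big_nil mulr1.
  by apply: eq_psd (psd_rank1 (fun=> 0)) => x y; rewrite !big_nil subrr mulr0.
split; first by apply: eq_psd (psdM (pQ i) IH1) => x y; rewrite big_cons.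
have IH3 := psdD IH1 IH2.
apply: eq_psd (psdD (psdM (pPQ i) IH3) (psdM (pQ i) IH2)) => x y.
by rewrite !big_cons; lra.
Qed.

(** A one-dimensional bound [c j] says that c j P - Q j is positive semidefinite; [psd_prod]
    multiplies these bounds. They may vary with [j], as the telescoped products require. *)
Lemma bform_prod_le (T S : Type) s (P : T -> T -> R) (Q : 'I_s -> S -> S -> R) (c : 'I_s -> R)
    (h : 'I_s -> S -> T) (u : seq (R * S)) :
  (forall j, psd (Q j)) ->
  (forall j, psd (fun x y => c j * P (h j x) (h j y) - Q j x y)) ->
  bform (fun x y => \prod_j Q j x y) u u <=
  (\prod_j c j) * bform (fun x y => \prod_j P (h j x) (h j y)) u u.
Proof.
move=> pQ pPQ; have [_ [_ /(_ u)]] := psd_prod (index_enum _) pQ pPQ.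
rewrite (_ : (fun x y => _) = (fun x y => (\prod_j c j) * (\prod_j P (h j x) (h j y)) +
  (-1) * \prod_j Q j x y)); last first.
  by apply/funext => x; apply/funext => y; rewrite big_split/= mulN1r.
by rewrite bformD !bformZ mulN1r subr_ge0.
Qed.

End psd_kernels.

Section psd_norm.
Context {R : realType} (T : Type) (K : T -> T -> R).
Hypothesis pK : psd K.
Implicit Types u v : seq (R * T).

Definition bform_sqdist u v := bform K u u - bform K u v *+ 2 + bform K v v.

Lemma bform_sqdistE u v :
  bform_sqdist u v = bform K (u ++ scale_seq (-1) v) (u ++ scale_seq (-1) v).
Proof. by rewrite /bform_sqdist bform_cat; [rewrite mulr2n; lra|exact: pK.1]. Qed.

(** Reverse triangle inequality, from Cauchy-Schwarz; norms along a Cauchy sequence therefore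
    converge. *)
Lemma bform_norm_sub_le u v :
  (Num.sqrt (bform K u u) - Num.sqrt (bform K v v)) ^+ 2 <= bform_sqdist u v.
Proof.
have p0 w : 0 <= bform K w w by exact: pK.2.
have CS : bform K u v <= Num.sqrt (bform K u u) * Num.sqrt (bform K v v).
  rewrite -sqrtrM ?p0//; apply: le_trans (ler_norm _) _.
  by rewrite -sqrtr_sqr; apply: ler_wsqrtr; exact: bform_Cauchy_Schwarz.
rewrite sqrrB !sqr_sqrtr ?p0// /bform_sqdist.
by rewrite !mulr2n; lra.
Qed.

Lemma psd_cauchy_norm_cvg (u : nat -> seq (R * T)) :
  (forall e : R, 0 < e -> exists N, forall k l, (N <= k)%N -> (N <= l)%N ->
    bform_sqdist (u k) (u l) < e) ->
  cvg (Num.sqrt (bform K (u k) (u k)) @[k --> \oo]).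
Proof.
move=> cu; apply/cauchy_cvgP/cauchy_exP => e e0.
have e20 : 0 < e ^+ 2 by rewrite exprn_gt0.
have [N HN] := cu _ e20; exists (Num.sqrt (bform K (u N) (u N))).
exists N => // k /= Nk; rewrite /ball/= -ltr_sqr ?nnegrE ?(ltW e0)// real_normK ?num_real//.
exact: le_lt_trans (bform_norm_sub_le _ _) (HN _ _ (leqnn N) Nk).
Qed.

End psd_norm.

Section tensors.
Context {R : realType} (H : fun_space R) (s : nat).
Local Notation elt := {f : R -> R | fs_mem H f}.
Local Notation dotH := (fun f g : elt => fs_dot H (sval f) (sval g)).
Hypothesis psdH : psd dotH.
Implicit Types (u v : tensor H s).

Definition tensor_kernel (x y : 'I_s -> elt) := \prod_(j < s) fs_dot H (sval (x j)) (sval (y j)).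

Lemma tensor_dotE u v : tensor_dot u v = bform tensor_kernel u v.
Proof. by []. Qed.

Lemma psd_tensor_kernel : psd tensor_kernel.
Proof.
have p j : psd (fun x y : 'I_s -> elt => fs_dot H (sval (x j)) (sval (y j))).
  exact: (psd_comp (fun x : 'I_s -> elt => x j) psdH).
have q j : psd (fun x y : 'I_s -> elt => fs_dot H (sval (x j)) (sval (y j)) -
    fs_dot H (sval (x j)) (sval (y j))).
  by apply: eq_psd (psd_rank1 (fun=> 0)) => x y; rewrite subrr mulr0.
by have [] := psd_prod (index_enum 'I_s) p q.
Qed.

Definition tensor_sub u v : tensor H s := u ++ scale_seq (-1) v.

Lemma tensor_sqdistE u v : tensor_sqdist u v = tensor_dot (tensor_sub u v) (tensor_sub u v).
Proof.
rewrite /tensor_sqdist !tensor_dotE bform_cat; last exact: psd_tensor_kernel.1.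
by rewrite mulr2n; lra.
Qed.

Lemma tensor_dot_ge0 u : 0 <= tensor_dot u u.
Proof. exact: psd_tensor_kernel.2. Qed.

Lemma tensor_cauchy_norm_cvg (u : nat -> tensor H s) : tensor_cauchy u ->
  cvg (Num.sqrt (tensor_dot (u k) (u k)) @[k --> \oo]).
Proof. exact: (psd_cauchy_norm_cvg psd_tensor_kernel). Qed.

Section functional.
Variables (L : 'I_s -> (R -> R) -> R) (B : 'I_s -> R).
Hypothesis LB : forall j (w : seq (R * elt)),
  (\sum_(t <- w) t.1 * L j (sval t.2)) ^+ 2 <=
  B j ^+ 2 * bform dotH w w.

Definition tensor_apply u := \sum_(t <- u) t.1 * \prod_(j < s) L j (sval (t.2 j)).

(** The square of a product functional is the form of a product of rank one kernels, and [LB] says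
    that each of these is dominated by B^2 times the inner product. *)
Lemma tensor_apply_le u : (tensor_apply u) ^+ 2 <= (\prod_j B j) ^+ 2 * tensor_dot u u.
Proof.
rewrite tensor_dotE [leLHS]expr2 -(bform_rank1 (fun x : 'I_s -> elt => \prod_(j < s) L j (sval (x j)))).
rewrite -prodrXl.
rewrite (_ : (fun x y => _) = (fun x y : 'I_s -> elt =>
    \prod_j (L j (sval (x j)) * L j (sval (y j))))); last first.
  by apply/funext => x; apply/funext => y; rewrite big_split.
apply: (bform_prod_le (P := fun f g : elt => fs_dot H (sval f) (sval g))
  (Q := fun j (x y : 'I_s -> elt) => L j (sval (x j)) * L j (sval (y j)))
  (c := fun j => B j ^+ 2) (h := fun j x => x j)) => j; first exact: (psd_rank1 (fun x : 'I_s -> elt => L j (sval (x j)))).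
apply: (psd_comp (fun x : 'I_s -> elt => x j)
  (K := fun f g : elt => B j ^+ 2 * fs_dot H (sval f) (sval g) - L j (sval f) * L j (sval g))).
split=> [f g|w]; first by rewrite psdH.1 [L j _ * _]mulrC.
rewrite (_ : (fun x y => _) = (fun f g : elt => B j ^+ 2 * fs_dot H (sval f) (sval g) +
  (-1) * (L j (sval f) * L j (sval g)))).
  by rewrite bformD !bformZ bform_rank1 -expr2 mulN1r subr_ge0.
by apply/funext => x; apply/funext => y; rewrite mulN1r.
Qed.

End functional.

End tensors.

Section tensor_norm.
Context {R : realType} (H : fun_space R) (s : nat) (F : s.-tuple R -> R).

Let norms := [set N : R | exists2 u, @tensor_represents _ H s u F &
  Num.sqrt (tensor_dot (u k) (u k)) @[k --> \oo] --> N].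

Let norms_lbound : lbound norms 0.
Proof.
move=> N [u _ uN]; rewrite -(cvg_lim _ uN)//; apply: limr_ge.
  by apply/cvg_ex; exists N.
by apply: nearW => k; exact: sqrtr_ge0.
Qed.

Lemma tensor_norm_ge0 : 0 <= tensor_norm H F.
Proof.
rewrite /tensor_norm -/norms; have [->|/set0P ne] := eqVneq norms set0; first by rewrite inf0.
exact: lb_le_inf.
Qed.

Lemma tensor_norm_le u N : @tensor_represents _ H s u F ->
  Num.sqrt (tensor_dot (u k) (u k)) @[k --> \oo] --> N -> tensor_norm H F <= N.
Proof. by move=> uF uN; apply: ge_inf; [exists 0; exact: norms_lbound|exists u]. Qed.

End tensor_norm.

Section tensor_map.
Context {R : realType} (H H' : fun_space R) (s : nat).
Local Notation elt := {f : R -> R | fs_mem H f}.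
Local Notation dotH := (fun f g : elt => fs_dot H (sval f) (sval g)).
Local Notation elt' := {f : R -> R | fs_mem H' f}.
Hypothesis psdH : psd dotH.
Variables (Phi : elt -> elt') (B : R).
Hypothesis psdPhi : psd (fun f g : elt => fs_dot H' (sval (Phi f)) (sval (Phi g))).
Hypothesis PhiB : forall w : seq (R * elt),
  bform (fun f g => fs_dot H' (sval (Phi f)) (sval (Phi g))) w w <=
  B ^+ 2 * bform dotH w w.

Definition tensor_map (u : tensor H s) : tensor H' s :=
  [seq (t.1, fun j => Phi (t.2 j)) | t <- u].

Let pullback (x y : 'I_s -> elt) := \prod_(j < s) fs_dot H' (sval (Phi (x j))) (sval (Phi (y j))).

Let psd_factor j :
  psd (fun x y : 'I_s -> elt => fs_dot H' (sval (Phi (x j))) (sval (Phi (y j)))).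
Proof. exact: (psd_comp (fun x : 'I_s -> elt => x j) psdPhi). Qed.

Let psd_pullback : psd pullback.
Proof.
have q j : psd (fun x y : 'I_s -> elt => fs_dot H' (sval (Phi (x j))) (sval (Phi (y j))) -
    fs_dot H' (sval (Phi (x j))) (sval (Phi (y j)))).
  by apply: eq_psd (psd_rank1 (fun=> 0)) => x y; rewrite subrr mulr0.
by have [] := psd_prod (index_enum 'I_s) psd_factor q.
Qed.

Let tensor_map_dot u v : tensor_dot (tensor_map u) (tensor_map v) = bform pullback u v.
Proof.
rewrite /tensor_dot /bform big_map; apply: eq_bigr => t _; rewrite big_map.
exact: eq_bigr.
Qed.

(** [PhiB], stated on formal combinations, combines linearity and boundedness of [Phi] in one kernel
    inequality. Positivity is asked of the inner product of [H'] pulled back along [Phi]. *)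
Lemma tensor_map_le u : tensor_dot (tensor_map u) (tensor_map u) <=
  (B ^+ s) ^+ 2 * tensor_dot u u.
Proof.
have -> : (B ^+ s) ^+ 2 = \prod_(j < s) B ^+ 2 :> R by rewrite prodr_const card_ord -!exprM mulnC.
rewrite tensor_map_dot tensor_dotE.
apply: (bform_prod_le (P := fun f g : elt => fs_dot H (sval f) (sval g))
  (Q := fun j (x y : 'I_s -> elt) => fs_dot H' (sval (Phi (x j))) (sval (Phi (y j))))
  (c := fun=> B ^+ 2) (h := fun j x => x j) _ psd_factor) => j.
apply: (psd_comp (fun x : 'I_s -> elt => x j)
  (K := fun f g : elt => B ^+ 2 * fs_dot H (sval f) (sval g) -
     fs_dot H' (sval (Phi f)) (sval (Phi g)))).
split=> [f g|w]; first by rewrite psdH.1 psdPhi.1.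
rewrite (_ : (fun x y => _) = (fun f g : elt => B ^+ 2 * fs_dot H (sval f) (sval g) +
  (-1) * fs_dot H' (sval (Phi f)) (sval (Phi g)))).
  by rewrite bformD !bformZ mulN1r subr_ge0.
by apply/funext => x; apply/funext => y; rewrite mulN1r.
Qed.

Lemma tensor_map_sqdist u v : tensor_sqdist (tensor_map u) (tensor_map v) <=
  (B ^+ s) ^+ 2 * tensor_sqdist u v.
Proof.
rewrite (tensor_sqdistE psdH) {1}/tensor_sqdist !tensor_map_dot -/(bform_sqdist pullback u v).
by rewrite (bform_sqdistE psd_pullback) -tensor_map_dot; exact: tensor_map_le.
Qed.

Lemma tensor_map_cauchy (u : nat -> tensor H s) :
  tensor_cauchy u -> tensor_cauchy (tensor_map \o u).
Proof.
move=> cu e e0; have p : 0 < (B ^+ s) ^+ 2 + 1 by rewrite ltr_wpDl ?sqr_ge0.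
have [N HN] := cu (e / ((B ^+ s) ^+ 2 + 1)) (divr_gt0 e0 p).
exists N => k l Nk Nl; apply: le_lt_trans (tensor_map_sqdist _ _) _.
have := HN k l Nk Nl; rewrite ltr_pdivlMr// => h.
have := tensor_dot_ge0 psdH (tensor_sub (u k) (u l)).
rewrite -tensor_sqdistE//; set d := tensor_sqdist _ _ in h *.
by move=> d0; apply: le_lt_trans h; rewrite mulrC ler_wpM2l// lerDl.
Qed.

Lemma tensor_map_norm_le (u : nat -> tensor H s) (N : R) : 0 <= B -> tensor_cauchy u ->
  Num.sqrt (tensor_dot (u k) (u k)) @[k --> \oo] --> N ->
  exists2 N', Num.sqrt (tensor_dot (tensor_map (u k)) (tensor_map (u k))) @[k --> \oo] --> N' &
    N' <= B ^+ s * N.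
Proof.
move=> B0 cu uN; have cv : cvg (Num.sqrt (bform pullback (u k) (u k)) @[k --> \oo]).
  apply: (psd_cauchy_norm_cvg psd_pullback) => e /(tensor_map_cauchy cu)[M HM].
  exists M => k l Mk Ml; have := HM k l Mk Ml.
  by rewrite /tensor_sqdist/= !tensor_map_dot.
have E k : tensor_dot (tensor_map (u k)) (tensor_map (u k)) = bform pullback (u k) (u k).
  exact: tensor_map_dot.
exists (lim (Num.sqrt (bform pullback (u k) (u k)) @[k --> \oo])).
  by under eq_fun do rewrite E.
have BN : B ^+ s * Num.sqrt (tensor_dot (u k) (u k)) @[k --> \oo] --> B ^+ s * N.
  by apply: cvgM => //; exact: cvg_cst.
rewrite -(cvg_lim _ BN)//; apply: ler_lim => //; first by apply/cvg_ex; exists (B ^+ s * N).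
apply: nearW => k; rewrite -E.
have Bs0 : 0 <= B ^+ s by exact: exprn_ge0.
rewrite -(ger0_norm Bs0) -sqrtr_sqr -sqrtrM ?sqr_ge0//; apply: ler_wsqrtr.
exact: tensor_map_le.
Qed.

End tensor_map.

(** * Functionals and operators on H_rho *)

Section jet_functionals.
Context {R : realType}.
Local Notation mu := (@lebesgue_measure R).
Implicit Types (D : nat -> R -> R) (x y : R) (r i k : nat) (g : R -> R).

Definition eval_const (alpha : nat) x : R := 2 ^+ alpha.-1 * expR (`|x| / 2) * growth x.
(** Pointwise bound of f rho for f of norm 1. Its integral bounds the integral functionals, its tail
    the truncation, and its tensor power dominates in the passage to the limit. *)
Definition kappa (alpha : nat) x : R := eval_const alpha x * rho x.

Lemma kappaE alpha x : kappa alpha x = 2 ^+ alpha.-1 * expR (3 / 4 * `|x| - x ^+ 2 / 4).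
Proof.
rewrite /kappa /eval_const -mulrA growth_rho -mulrA /decay -expRD.
by congr (_ * expR _); lra.
Qed.

Lemma kappa_ge0 alpha x : 0 <= kappa alpha x.
Proof. by rewrite kappaE mulr_ge0 ?expR_ge0 ?exprn_ge0. Qed.

Lemma eval_const_ge0 alpha x : 0 <= eval_const alpha x.
Proof.
have := @growth_ge1 R x => g1.
by rewrite /eval_const mulr_ge0 ?mulr_ge0 ?expR_ge0 ?exprn_ge0//; lra.
Qed.

Lemma continuous_kappa alpha : continuous (kappa alpha).
Proof.
rewrite (_ : kappa alpha = fun x => 2 ^+ alpha.-1 * expR (3 / 4 * `|x| - x ^+ 2 / 4)); last first.
  by apply/funext => x; exact: kappaE.
move=> x; apply: cvgM; first exact: cvg_cst.
apply: continuous_comp; last exact: continuous_expR.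
apply: cvgB.
  by apply: cvgM; [exact: cvg_cst|apply: cvg_norm; exact: cvg_id].
by apply: cvgM; [exact: exprn_continuous|exact: cvg_cst].
Qed.

Let gauss_pair m x : R := gauss4 m x + gauss4 (- m) x.

Let Rintegrable_gauss_pair m : Rintegrable mu setT (gauss_pair m).
Proof. by apply: RintegrableD => //; exact: integrable_gauss4. Qed.

Let Rintegral_gauss_pair m : \int[mu]_x gauss_pair m x <= 8.
Proof.
rewrite RintegralD//; [|exact: integrable_gauss4..].
by have := @Rintegral_gauss4 R m; have := @Rintegral_gauss4 R (- m); lra.
Qed.

(** Completing the square: 3 |x| / 4 - x^2 / 4 = 9 / 16 - (|x| - 3 / 2)^2 / 4. *)
Lemma kappa_le alpha x : kappa alpha x <= 2 ^+ alpha.-1 * expR (9 / 16) * gauss_pair (3 / 2) x.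
Proof.
rewrite kappaE -[leRHS]mulrA ler_pM2l ?exprn_gt0// /gauss_pair mulrDr /gauss4 -!expRD.
have [x0|x0] := leP 0 x.
  by apply: ler_wpDr; rewrite ?expR_ge0// ler_expR ger0_norm//; lra.
by apply: ler_wpDl; rewrite ?expR_ge0// ler_expR ltr0_norm//; lra.
Qed.

Lemma Rintegrable_kappa alpha : Rintegrable mu setT (kappa alpha).
Proof.
have gi := @RintegrableZ _ _ _ mu setT (2 ^+ alpha.-1 * expR (9 / 16)) _ measurableT (Rintegrable_gauss_pair (3 / 2)).
apply: le_Rintegrable gi => //; first by apply: continuous_measurable_fun; exact: continuous_kappa.
by move=> x _; rewrite ger0_norm ?kappa_ge0// kappa_le.
Qed.

Lemma Rintegral_kappa alpha : (0 < alpha)%N -> \int[mu]_x kappa alpha x <= 16 * 2 ^+ alpha.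
Proof.
move=> a0; have e : expR (9 / 16 : R) <= 16 / 7.
  apply: le_trans (@expR_le_inv R (9 / 16) 1 _ _) _ => //; first by apply/andP; split; lra.
  by rewrite expr1 divr1 (_ : 1 - 9 / 16 = 7 / 16 :> R) ?invf_div//; lra.
apply: (@le_trans _ _ (\int[mu]_x (2 ^+ alpha.-1 * expR (9 / 16) * gauss_pair (3 / 2) x))).
  apply: le_Rintegral => //; [exact: Rintegrable_kappa|exact: RintegrableZ|].
  by move=> x _; exact: kappa_le.
rewrite RintegralZl//; last exact: Rintegrable_gauss_pair.
have := Rintegral_gauss_pair (3 / 2); set I := \int[_]_(_ in _) _ => I8.
rewrite -[in leRHS](prednK a0) exprS; have p : 0 < (2 : R) ^+ alpha.-1 by rewrite exprn_gt0.
have -> : 16 * (2 * 2 ^+ alpha.-1) = 2 ^+ alpha.-1 * 32 :> R by ring.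
rewrite -mulrA ler_pM2l//; have := expR_ge0 (9 / 16 : R); set f := expR _ in e * => f0.
by apply: (@le_trans _ _ (f * 8)); [rewrite ler_wpM2l|lra].
Qed.

(** Recentring the Gaussian at the cut-off [T] extracts exp(- (T / 2 - 1)^2) and leaves an
    integrable factor; the exponents compare because (T - 2) (|x| - T) >= 0. *)
Lemma kappa_tail_le alpha (T : R) x : 2 <= T -> T <= `|x| ->
  kappa alpha x <= 2 ^+ alpha.-1 * (expR 1 * expR (- (T / 2 - 1) ^+ 2)) * gauss_pair T x.
Proof.
move=> T2 Tx; rewrite kappaE -[leRHS]mulrA ler_pM2l ?exprn_gt0// -expRD /gauss_pair mulrDr /gauss4 -!expRD.
have [x0|x0] := leP 0 x.
  rewrite (ger0_norm x0) in Tx *; apply: ler_wpDr; rewrite ?expR_ge0// ler_expR.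
  have : 0 <= (T - 2) * (x - T) by rewrite mulr_ge0; lra.
  by rewrite !expr2; nra.
rewrite (ltr0_norm x0) in Tx *; apply: ler_wpDl; rewrite ?expR_ge0// ler_expR.
have : 0 <= (T - 2) * (- x - T) by rewrite mulr_ge0; lra.
by rewrite !expr2; nra.
Qed.

Lemma Rintegral_kappa_tail alpha (T : R) : (0 < alpha)%N -> 2 <= T ->
  \int[mu]_(x in ~` `[- T, T]%classic) kappa alpha x <=
  16 * 2 ^+ alpha * expR (- (T / 2 - 1) ^+ 2).
Proof.
move=> a0 T2; have mT : measurable (~` `[- T, T]%classic : set (measurableTypeR R)).
  by apply: measurableC; exact: measurable_itv.
have e : expR (1 : R) <= 4.
  apply: le_trans (@expR_le_inv R 1 2 _ _) _ => //; first by apply/andP; split; lra.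
  by rewrite (_ : 1 - 1 / 2 = 1 / 2 :> R) ?invf_div ?divr1 ?expr2; lra.
set tau := expR (- _ ^+ 2).
pose C : R := 2 ^+ alpha.-1 * (expR 1 * tau).
have Ci : Rintegrable mu setT (fun x => C * gauss_pair T x) by exact: RintegrableZ.
have C0 x : 0 <= C * gauss_pair T x.
  by rewrite /C !mulr_ge0 ?exprn_ge0 ?expR_ge0 ?addr_ge0 ?expR_ge0.
apply: (@le_trans _ _ (\int[mu]_(x in ~` `[- T, T]%classic) (C * gauss_pair T x))).
  apply: le_Rintegral => //.
  - exact: RintegrableS (Rintegrable_kappa alpha).
  - exact: RintegrableS Ci.
  - move=> x /= xT; apply: kappa_tail_le => //.
    by rewrite leNgt ltr_norml; apply/negP => /andP[h1 h2]; apply: xT; rewrite in_itv/= !ltW.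
apply: (@le_trans _ _ (\int[mu]_x (C * gauss_pair T x))).
  by apply: subset_Rintegral.
rewrite RintegralZl//; last exact: Rintegrable_gauss_pair.
have := Rintegral_gauss_pair T; set I := \int[_]_(_ in _) _ => I8.
rewrite -[in leRHS](prednK a0) exprS /C.
have t0 : 0 <= tau by exact: expR_ge0.
have p : 0 < (2 : R) ^+ alpha.-1 by rewrite exprn_gt0.
have -> : 16 * (2 * 2 ^+ alpha.-1) * tau = 2 ^+ alpha.-1 * (32 * tau) by ring.
rewrite -mulrA ler_pM2l// mulrAC ler_wpM2r//.
have := expR_ge0 (1 : R); set f := expR _ in e * => f0.
by apply: (@le_trans _ _ (f * 8)); [rewrite ler_wpM2l|lra].
Qed.

Definition full_int D := \int[mu]_x (D 0%N x * rho x).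

Section bounds.
Variables (alpha : nat) (T : R).
Hypotheses (alpha2 : (2 <= alpha)%N) (T2 : 2 <= T).

Definition cube_int D := \int[mu]_(y in `[0, 1]) scaled T D 0 y.

Let a0 : (0 < alpha)%N. Proof. exact: ltnW. Qed.

Section one.
Variable D : nat -> R -> R.
Hypothesis jD : jet alpha D.
Let N := Num.sqrt (jet_sqnorm alpha D).

Lemma jet_eval x : `|D 0%N x| <= N * eval_const alpha x.
Proof.
have ka : (alpha.-1 < alpha)%N by rewrite prednK.
by have := jet_le alpha2 jD x ka; rewrite subnn /eval_const !mulrA.
Qed.

Lemma jet_kappa x : `|D 0%N x * rho x| <= N * kappa alpha x.
Proof.
have := @rho_gt0 R x; rewrite /kappa; move: (rho x) => w w0.
by rewrite normrM (gtr0_norm w0) mulrA ler_wpM2r ?jet_eval// ltW.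
Qed.

Lemma measurable_jet_rho : measurable_fun setT (fun x => D 0%N x * rho x).
Proof.
have [_ cD _ _ _] := jD; apply: measurable_funM; apply: continuous_measurable_fun.
  exact: cD.
exact: rho_continuous.
Qed.

Lemma jet_rho_int : Rintegrable mu setT (fun x => D 0%N x * rho x).
Proof.
have ki : Rintegrable mu setT (fun x => N * kappa alpha x).
  by apply: RintegrableZ => //; exact: Rintegrable_kappa.
apply: le_Rintegrable ki => //; first exact: measurable_jet_rho.
by move=> x _; exact: jet_kappa.
Qed.

Lemma int_jet_rho_le (A : set (measurableTypeR R)) : measurable A ->
  `|\int[mu]_(x in A) (D 0%N x * rho x)| <= N * \int[mu]_(x in A) kappa alpha x.
Proof.
move=> mA; have ji : Rintegrable mu A (fun x => D 0%N x * rho x) by exact: RintegrableS jet_rho_int.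
have ki : Rintegrable mu A (kappa alpha) by exact: RintegrableS (Rintegrable_kappa alpha).
apply: le_trans (le_normr_Rintegral mA ji) _; rewrite -RintegralZl//.
apply: le_Rintegral => //; [exact: integrable_norm|exact: RintegrableZ|].
by move=> x _; exact: jet_kappa.
Qed.

Lemma scaled0E y : scaled T D 0 y = 2 * T * (D 0%N (2 * T * y - T) * rho (2 * T * y - T)).
Proof.
rewrite /scaled expr1 /leibniz big_ord_recr big_ord0/= add0r leibniz_termE bin0 subn0.
by rewrite herm0E !mul1r.
Qed.

Lemma cube_intE : cube_int D = \int[mu]_(x in `[- T, T]) (D 0%N x * rho x).
Proof.
have T0 : 0 < 2 * T by have := T2; lra.
have mT := @measurable_itv R `[- T, T].
have giT : Rintegrable mu `[- T, T]%classic (fun x => D 0%N x * rho x).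
  exact: RintegrableS jet_rho_int.
have [] := Rintegral_affine (- T) T0 mT measurable_jet_rho giT.
rewrite (affine_preimage_cube T2) => ia ->; rewrite -RintegralZl//.
by apply: eq_Rintegral => y _; rewrite scaled0E.
Qed.

Lemma full_int_le : `|full_int D| <= 16 * 2 ^+ alpha * N.
Proof.
apply: le_trans (int_jet_rho_le measurableT) _; rewrite mulrC ler_wpM2r ?sqrtr_ge0//.
exact: Rintegral_kappa.
Qed.

Lemma cube_int_le : `|cube_int D| <= 16 * 2 ^+ alpha * N.
Proof.
rewrite cube_intE; apply: le_trans (int_jet_rho_le _) _; first exact: measurable_itv.
rewrite mulrC ler_wpM2r ?sqrtr_ge0//; apply: le_trans (Rintegral_kappa a0).
apply: subset_Rintegral => //; first by move=> x _; exact: kappa_ge0.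
exact: Rintegrable_kappa.
Qed.

Lemma tail_int_le : `|full_int D - cube_int D| <= 16 * 2 ^+ alpha * expR (- (T / 2 - 1) ^+ 2) * N.
Proof.
have mT := @measurable_itv R `[- T, T].
have ji := jet_rho_int.
have -> : full_int D = cube_int D + \int[mu]_(x in ~` `[- T, T]%classic) (D 0%N x * rho x).
  rewrite cube_intE /full_int -[X in \int[mu]_(x in X) _](setUv `[- T, T]%classic).
  rewrite Rintegral_setU//; first exact: measurableC.
    by rewrite setUv.
  by apply/disj_setPCl.
rewrite addrAC subrr add0r.
apply: le_trans (int_jet_rho_le _) _; first exact: measurableC.
by rewrite mulrC ler_wpM2r ?sqrtr_ge0// Rintegral_kappa_tail.
Qed.

End one.
End bounds.
End jet_functionals.

Section bform_integral.
Context d (T : measurableType d) {R : realType} (mu : {measure set T -> \bar R}).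
Variables (X : Type) (A : set T) (K : X -> X -> T -> R).
Hypotheses (mA : measurable A) (Ki : forall x y, Rintegrable mu A (K x y)).

Lemma bform_Rintegral (u v : seq (R * X)) :
  bform (fun x y => \int[mu]_(t in A) K x y t) u v =
  \int[mu]_(t in A) bform (fun x y => K x y t) u v.
Proof.
rewrite /bform Rintegral_sum//; last first.
  by move=> p; apply: Rintegrable_sum => // q; exact: RintegrableZ.
apply: eq_bigr => p _; rewrite Rintegral_sum//; last by move=> q; exact: RintegrableZ.
by apply: eq_bigr => q _; rewrite RintegralZl//; exact: Ki.
Qed.

End bform_integral.

Section jet_combinations.
Context {R : realType}.
Local Notation mu := (@lebesgue_measure R).
Variable alpha : nat.
Implicit Types (D E : nat -> R -> R) (x y : R) (r i k : nat).

Lemma jet0 : jet alpha (fun _ _ => 0 : R).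
Proof.
split=> // [r _ x|r _ a b ab|]; first exact: cvg_cst.
  split; first by apply: continuous_Rintegrable => x; exact: cvg_cst.
  by rewrite subrr Rintegral_cst ?mul0r.
have -> : (fun x : R => 0 ^+ 2 * rho x) = fun=> 0.
  by apply/funext => x; rewrite expr0n mul0r.
by apply: Rintegrable_ge0 => //; rewrite /= integral0.
Qed.

Lemma jetZ c D : jet alpha D -> jet alpha (fun r x => c * D r x).
Proof.
move=> [D0 cD pD mD Di]; split.
- by rewrite D0 mulr0.
- by move=> r ra x; apply: cvgM; [exact: cvg_cst|exact: cD].
- by move=> r ra; apply: primitiveZ; exact: pD.
- exact: measurable_funM.
- rewrite (_ : (fun x => _) = (fun x => c ^+ 2 * (D alpha x ^+ 2 * rho x))).
    exact: RintegrableZ.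
  by apply/funext => x; rewrite exprMn; move: (rho x) => w; ring.
Qed.

Lemma measurable_rho : measurable_fun setT (@rho R).
Proof. by apply: continuous_measurable_fun; exact: rho_continuous. Qed.

Lemma jet_mul_int D E : jet alpha D -> jet alpha E ->
  Rintegrable mu setT (fun x => D alpha x * E alpha x * rho x).
Proof.
move=> [_ _ _ mD Di] [_ _ _ mE Ei].
apply: le_Rintegrable (RintegrableD _ Di Ei) => //.
  by apply: measurable_funM; [exact: measurable_funM|exact: measurable_rho].
move=> x _; have := @rho_gt0 R x; move: (rho x) => w w0.
rewrite normrM (gtr0_norm w0) -mulrDl ler_pM2r// ler_norml.
move: (D _ _) (E _ _) => a b; have := sqr_ge0 (a + b); have := sqr_ge0 (a - b).
have := sqr_ge0 a; have := sqr_ge0 b; nra.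
Qed.

Lemma jetD D E : jet alpha D -> jet alpha E -> jet alpha (fun r x => D r x + E r x).
Proof.
move=> jD jE; have DEi := jet_mul_int jD jE.
have [D0 cD pD mD Di] := jD; have [E0 cE pE mE Ei] := jE; split.
- by rewrite D0 E0 addr0.
- by move=> r ra x; apply: cvgD; [exact: cD|exact: cE].
- by move=> r ra; apply: primitiveD; [exact: pD|exact: pE].
- exact: measurable_funD.
- rewrite (_ : (fun x => _) = (fun x => D alpha x ^+ 2 * rho x +
    (E alpha x ^+ 2 * rho x + 2 * (D alpha x * E alpha x * rho x)))).
    by do 2?apply: RintegrableD => //; exact: RintegrableZ.
  by apply/funext => x; move: (rho x) => w; ring.
Qed.

Definition jet_dot D E :=
  \sum_(1 <= r < alpha) D r 0 * E r 0 + \int[mu]_x (D alpha x * E alpha x * rho x).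

Section comb.
Variables (X : Type) (D : X -> nat -> R -> R).
Hypothesis jD : forall z, jet alpha (D z).
Implicit Types w : seq (R * X).

Definition jet_comb w r x := \sum_(t <- w) t.1 * D t.2 r x.

Lemma jet_comb_jet w : jet alpha (jet_comb w).
Proof.
elim: w => [|t w IH].
  suff -> : jet_comb [::] = fun _ _ => 0 by exact: jet0.
  by apply/funext => r; apply/funext => x; rewrite /jet_comb big_nil.
suff -> : jet_comb (t :: w) = fun r x => t.1 * D t.2 r x + jet_comb w r x.
  by apply: jetD IH; exact: jetZ.
by apply/funext => r; apply/funext => x; rewrite /jet_comb big_cons.
Qed.

Lemma bform_sum (I : Type) (s : seq I) (K : I -> X -> X -> R) w w' :
  bform (fun z z' => \sum_(i <- s) K i z z') w w' = \sum_(i <- s) bform (K i) w w'.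
Proof.
rewrite /bform [RHS]exchange_big/=; apply: eq_bigr => t _.
rewrite [RHS]exchange_big/=; apply: eq_bigr => t' _.
by rewrite mulr_sumr.
Qed.

Lemma bform_jet_dot w :
  bform (fun z z' => jet_dot (D z) (D z')) w w = jet_sqnorm alpha (jet_comb w).
Proof.
rewrite bformD; congr (_ + _).
  rewrite bform_sum; apply: eq_bigr => r _.
  by rewrite (bform_rank1 (fun z => D z r 0)) -expr2.
rewrite (bform_Rintegral measurableT (fun z z' => jet_mul_int (jD z) (jD z'))).
apply: eq_Rintegral => x _; move: (rho x) => c.
rewrite expr2 -(bform_rank1 (fun z => D z alpha x)) mulrC -bformZ.
by congr bform; apply/funext => z; apply/funext => z'; rewrite mulrC.
Qed.

Lemma psd_jet_dot : psd (fun z z' => jet_dot (D z) (D z')).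
Proof.
split=> [z z'|w]; last by rewrite bform_jet_dot jet_sqnorm_ge0.
rewrite /jet_dot; congr (_ + _); first by apply: eq_bigr => r _; rewrite mulrC.
by apply: eq_Rintegral => x _; rewrite [D z _ _ * _]mulrC.
Qed.

(** Turns a norm bound into the inequality on formal combinations that [tensor_apply_le] takes: it
    is the norm bound at the jet of the combination. *)
Lemma jet_functional_bound (L : (nat -> R -> R) -> R) (C : R) w :
  L (jet_comb w) = \sum_(t <- w) t.1 * L (D t.2) ->
  (forall E, jet alpha E -> `|L E| <= C * Num.sqrt (jet_sqnorm alpha E)) ->
  (\sum_(t <- w) t.1 * L (D t.2)) ^+ 2 <= C ^+ 2 * bform (fun z z' => jet_dot (D z) (D z')) w w.
Proof.
move=> <- LC; rewrite bform_jet_dot.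
rewrite -[X in C ^+ 2 * X](sqr_sqrtr (jet_sqnorm_ge0 alpha (jet_comb w))) -exprMn.
rewrite -[leLHS]real_normK ?num_real// -[leRHS]real_normK ?num_real// lerXn2r ?nnegrE//.
exact: le_trans (LC _ (jet_comb_jet w)) (ler_norm _).
Qed.

Lemma leibniz_comb w r x : leibniz (jet_comb w) r x = \sum_(t <- w) t.1 * leibniz (D t.2) r x.
Proof.
rewrite /leibniz; under [RHS]eq_bigr do rewrite mulr_sumr.
rewrite exchange_big/=; apply: eq_bigr => i _.
rewrite /leibniz_term /jet_comb; move: (rho x) (herm _) => c h.
rewrite mulr_sumr mulr_suml; apply: eq_bigr => t _.
by move: (D t.2 i x) => ?; ring.
Qed.

Lemma scaled_comb T w r x : scaled T (jet_comb w) r x = \sum_(t <- w) t.1 * scaled T (D t.2) r x.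
Proof.
rewrite /scaled leibniz_comb mulr_sumr; apply: eq_bigr => t _.
by rewrite mulrCA.
Qed.

Section functionals.
Variable T : R.
Hypotheses (alpha2 : (2 <= alpha)%N) (T2 : 2 <= T).

Let m01 : measurable (`[0, 1]%classic : set (measurableTypeR R)). Proof. exact: measurable_itv. Qed.

Lemma full_int_comb w : full_int (jet_comb w) = \sum_(t <- w) t.1 * full_int (D t.2).
Proof.
rewrite /full_int.
under eq_Rintegral => x _.
  rewrite /jet_comb mulr_suml; under eq_bigr do rewrite -(mulrA _ _ (rho x)).
  over.
have i t : Rintegrable mu setT (fun x => D t 0%N x * rho x) by exact: (jet_rho_int alpha2).
rewrite Rintegral_sum//; last by move=> t; exact: RintegrableZ.
by apply: eq_bigr => t _; rewrite RintegralZl//; exact: i.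
Qed.

Lemma scaled_int_comb w r : (r < alpha)%N ->
  \int[mu]_(y in `[0, 1]) scaled T (jet_comb w) r y =
  \sum_(t <- w) t.1 * \int[mu]_(y in `[0, 1]) scaled T (D t.2) r y.
Proof.
move=> ra; under eq_Rintegral => x _ do rewrite scaled_comb.
have i z : Rintegrable mu `[0, 1] (scaled T (D z) r) by exact: (scaled_int_lt T2 alpha2).
rewrite Rintegral_sum//; last by move=> t; exact: RintegrableZ.
by apply: eq_bigr => t _; rewrite RintegralZl//; exact: i.
Qed.

Lemma cube_int_comb w : cube_int T (jet_comb w) = \sum_(t <- w) t.1 * cube_int T (D t.2).
Proof. by apply: scaled_int_comb; exact: ltnW. Qed.

Definition scaled_dot E E' :=
  \sum_(0 <= r < alpha)
    (\int[mu]_(y in `[0, 1]) scaled T E r y) * (\int[mu]_(y in `[0, 1]) scaled T E' r y) +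
  \int[mu]_(y in `[0, 1]) (scaled T E alpha y * scaled T E' alpha y).

Lemma scaled_mul_int E E' : jet alpha E -> jet alpha E' ->
  Rintegrable mu (`[0, 1]%classic : set (measurableTypeR R))
    (fun y => scaled T E alpha y * scaled T E' alpha y).
Proof.
move=> jE jE'; have i := scaled_sqr_int_top T2 alpha2 jE.
have i' := scaled_sqr_int_top T2 alpha2 jE'.
apply: le_Rintegrable (RintegrableD _ i i') => //.
  apply: measurable_funTS; apply: measurable_funM; first exact: (measurable_scaled T jE).
  exact: (measurable_scaled T jE').
move=> x _; rewrite ler_norml; move: (scaled T E _ x) (scaled T E' _ x) => a b.
have := sqr_ge0 (a + b); have := sqr_ge0 (a - b).
have := sqr_ge0 a; have := sqr_ge0 b; nra.
Qed.

Lemma bform_scaled_dot w : bform (fun z z' => scaled_dot (D z) (D z')) w w <=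
  (2 * T) ^+ alpha.*2.+1 * (400 * jet_const alpha ^+ 2) *
  bform (fun z z' => jet_dot (D z) (D z')) w w.
Proof.
rewrite bform_jet_dot; apply: le_trans (scaled_norm_le T2 alpha2 (jet_comb_jet w)).
apply: eqW.
rewrite bformD; congr (_ + _).
  rewrite bform_sum; apply: eq_big_nat => r /andP[_ ra].
  by rewrite (bform_rank1 (fun z => \int[mu]_(y in `[0, 1]) scaled T (D z) r y)) -expr2 scaled_int_comb.
rewrite (bform_Rintegral m01 (fun z z' => scaled_mul_int (jD z) (jD z'))).
apply: eq_Rintegral => x _.
by rewrite (bform_rank1 (fun z => scaled T (D z) alpha x)) -expr2 scaled_comb.
Qed.

Lemma psd_scaled_dot : psd (fun z z' => scaled_dot (D z) (D z')).
Proof.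
split=> [z z'|w].
  rewrite /scaled_dot; congr (_ + _); first by apply: eq_bigr => r _; rewrite mulrC.
  by apply: eq_Rintegral => x _; rewrite mulrC.
rewrite bformD addr_ge0//.
  rewrite bform_sum sumr_ge0// => r _.
  by rewrite (bform_rank1 (fun z => \int[mu]_(y in `[0, 1]) scaled T (D z) r y)) -expr2 sqr_ge0.
rewrite (bform_Rintegral m01 (fun z z' => scaled_mul_int (jD z) (jD z'))).
apply: Rintegral_ge0 => x _.
by rewrite (bform_rank1 (fun z => scaled T (D z) alpha x)) -expr2 sqr_ge0.
Qed.

End functionals.


End comb.
End jet_combinations.

(** * Closure properties of absolute continuity *)

Section abs_cont_closure.
Context {R : realType}.
Implicit Types (f g h : R -> R) (a b x y : R).

(** Sums, products and Lipschitz functions reduce to this bound; the increments of [f], those of [g]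
    and the lengths each get a share e / (3 M). *)
Lemma abs_cont_controlled a b f g h (M : R) : 0 < M -> abs_cont a b f -> abs_cont a b g ->
  (forall x y, a <= x -> x <= y -> y <= b ->
    `|h y - h x| <= M * (`|f y - f x| + `|g y - g x| + (y - x))) ->
  abs_cont a b h.
Proof.
move=> M0 fAC gAC hM e e0; have e3 : 0 < e / (3 * M) by rewrite divr_gt0// mulr_gt0.
have [d1 d10 H1] := fAC _ e3; have [d2 d20 H2] := gAC _ e3.
exists (Num.min (e / (3 * M)) (Num.min d1 d2)); first by rewrite !lt_min e3 d10.
move=> n I Iab tI; rewrite !lt_min => /andP[I3 /andP[I1 I2]].
have := H1 n I Iab tI I1; have := H2 n I Iab tI I2.
set s1 := \sum_i _ => h1; set s2 := \sum_i _ => h2.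
apply: (@le_lt_trans _ _ (M * (s2 + s1 + \sum_i ((I i).2 - (I i).1)))).
  rewrite /s1 /s2 -!big_split/= mulr_sumr; apply: ler_sum => i _.
  by have [p1 [p2 p3]] := Iab i; exact: hM.
have -> : e = M * (e / (3 * M) + e / (3 * M) + e / (3 * M)) by field; rewrite gt_eqF.
by rewrite ltr_pM2l//; lra.
Qed.

Lemma abs_cont_lipschitz a b f (M : R) :
  (forall x y, a <= x -> x <= y -> y <= b -> `|f y - f x| <= M * (y - x)) -> abs_cont a b f.
Proof.
move=> fM; have c0 : abs_cont a b (fun=> 0 : R).
  move=> e e0; exists 1 => // n I _ _ _; rewrite big1// => i _.
  by rewrite subrr normr0.
apply: (abs_cont_controlled (M := `|M| + 1) _ c0 c0) => [|x y ax xy yb].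
  by rewrite ltr_wpDl.
rewrite subrr normr0 !add0r; apply: le_trans (fM _ _ ax xy yb) _.
by rewrite ler_wpM2r ?subr_ge0// (le_trans (ler_norm _))// lerDl.
Qed.

Lemma abs_cont_cst a b (c : R) : abs_cont a b (fun=> c).
Proof.
by apply: (@abs_cont_lipschitz _ _ _ 0) => x y _ _ _; rewrite subrr normr0 mul0r.
Qed.

Lemma abs_contD a b f g : abs_cont a b f -> abs_cont a b g -> abs_cont a b (fun x => f x + g x).
Proof.
move=> fAC gAC; apply: (abs_cont_controlled ltr01 fAC gAC) => x y ax xy yb.
rewrite mul1r opprD addrACA; apply: le_trans (ler_normD _ _) _.
by rewrite lerDl subr_ge0.
Qed.

Lemma abs_cont_sum a b n (F : nat -> R -> R) : (forall i, (i < n)%N -> abs_cont a b (F i)) ->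
  abs_cont a b (fun x => \sum_(i < n) F i x).
Proof.
elim: n => [|n IH] FAC.
  apply: (@abs_cont_lipschitz _ _ _ 0) => x y _ _ _.
  by rewrite !big_ord0 subrr normr0 mul0r.
rewrite (_ : (fun x => _) = (fun x => (\sum_(i < n) F i x) + F n x)).
  by apply: abs_contD; [apply: IH => i ?; apply: FAC; exact: ltnW|exact: FAC].
by apply/funext => x; rewrite big_ord_recr.
Qed.

Lemma continuous_bounded_itv a b f : continuous f ->
  exists2 M, 0 < M & forall x, a <= x <= b -> `|f x| <= M.
Proof.
move=> cf; have [ab|ba] := leP a b; last first.
  exists 1 => // x /andP[ax xb].
  by have := le_lt_trans (le_trans ax xb) ba; rewrite ltxx.
have cn : {within `[a, b], continuous (fun x => `|f x|)}.
  by apply: continuous_subspaceT => x; apply: cvg_norm; exact: cf.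
have [c _ Hc] := EVT_max ab cn; exists (`|f c| + 1); first by rewrite ltr_wpDl.
move=> x axb; apply: le_trans (Hc x _) _; first by rewrite in_itv.
by rewrite lerDl.
Qed.

Lemma abs_contM a b f g : continuous f -> continuous g ->
  abs_cont a b f -> abs_cont a b g -> abs_cont a b (fun x => f x * g x).
Proof.
move=> cf cg fAC gAC.
have [M M0 fM] := continuous_bounded_itv a b cf.
have [M' M'0 gM] := continuous_bounded_itv a b cg.
apply: (abs_cont_controlled (addr_gt0 M0 M'0) fAC gAC) => x y ax xy yb.
have -> : f y * g y - f x * g x = f y * (g y - g x) + (f y - f x) * g x by ring.
have fy := fM y; rewrite (le_trans ax xy) yb/= in fy.
have gx := gM x; rewrite ax (le_trans xy yb)/= in gx.
apply: le_trans (ler_normD _ _) _; rewrite !normrM.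
move: (normr_ge0 (g y - g x)) (normr_ge0 (f y - f x)) (fy isT) (gx isT).
move: (normr_ge0 (f y)) (normr_ge0 (g x)).
set u := `|g y - g x|; set v := `|f y - f x|; set p := `|f y|; set q := `|g x|.
move=> p0 q0 u0 v0 pM qM; have xy0 : 0 <= y - x by rewrite subr_ge0.
have h1 : p * u <= M * u by rewrite ler_wpM2r.
have h2 : v * q <= v * M' by rewrite ler_wpM2l.
have h3 : 0 <= M * v by rewrite mulr_ge0// ltW.
have h4 : 0 <= M' * u by rewrite mulr_ge0// ltW.
have h5 : 0 <= (M + M') * (y - x) by rewrite mulr_ge0// addr_ge0 ?ltW.
by rewrite !mulrDr !mulrDl in h5 *; lra.
Qed.

Lemma abs_cont_affine a b f c d : 0 < c -> abs_cont (c * a + d) (c * b + d) f ->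
  abs_cont a b (fun x => f (c * x + d)).
Proof.
move=> c0 fAC e e0; have [r r0 H] := fAC e e0.
exists (r / c); first by rewrite divr_gt0.
move=> n I Iab tI Ir; pose J i := (c * (I i).1 + d, c * (I i).2 + d).
apply: (H n J).
- move=> i; have [p1 [p2 p3]] := Iab i.
  by rewrite /J/= !lerD2r !ler_pM2l.
- apply/trivIsetP => i j _ _ ij; rewrite predeqE => x; split=> //= -[].
  rewrite /J/= !in_itv/= (_ : x = c * ((x - d) / c) + d); last by field; rewrite gt_eqF.
  rewrite !ltrD2r !ltr_pM2l// => hi hj.
  by move/trivIsetP : tI => /(_ i j Logic.I Logic.I ij); rewrite predeqE => /(_ ((x - d) / c))[+ _];
    rewrite /= !in_itv/=; apply.
- rewrite ltr_pdivlMr// mulrC mulr_sumr in Ir; apply: le_lt_trans Ir.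
  by apply: eqW; apply: eq_bigr => i _; rewrite /J/=; ring.
Qed.

Lemma abs_cont_continuous f : (forall a b, abs_cont a b f) -> continuous f.
Proof.
move=> fAC x; apply/cvgrPdist_lt => e e0.
have [d d0 H] := fAC (x - 1) (x + 1) e e0.
have small u v : x - 1 <= u -> u <= v -> v <= x + 1 -> v - u < d -> `|f v - f u| < e.
  move=> h1 h2 h3 h4; have := H 1%N (fun=> (u, v)); rewrite !big_ord1/=; apply => //.
  by have [_] := disjoint_family1 h2.
near=> y.
have yd : `|x - y| < d by near: y; apply/nbhs_ballP; exists d.
have y1 : `|x - y| < 1 by near: y; apply/nbhs_ballP; exists 1; rewrite //=.
rewrite ltr_norml in yd; rewrite ltr_norml in y1.
have [xy|/ltW yx] := leP x y; last by apply: small => //; lra.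
by rewrite distrC; apply: small => //; lra.
Unshelve. all: by end_near. Qed.

Lemma abs_cont_C1 a b f (f' : R -> R) : (forall x, is_derive x 1 f (f' x)) -> continuous f' ->
  abs_cont a b f.
Proof.
move=> df cf'; have [M M0 fM] := continuous_bounded_itv a b cf'.
apply: (@abs_cont_lipschitz _ _ _ M) => x y ax xy yb.
have cf : {within `[x, y], continuous f}.
  apply: derivable_within_continuous => z _; exact: ex_derive.
have [c cxy ->] := MVT_segment xy (fun z _ => df z) cf.
rewrite normrM (ger0_norm (_ : 0 <= y - x)) ?subr_ge0// ler_wpM2r ?subr_ge0// fM//.
by move: cxy; rewrite in_itv/= => /andP[xc cy]; rewrite (le_trans ax xc) (le_trans cy yb).
Qed.

End abs_cont_closure.

Section H_rho_jet.
Context {R : realType}.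
Local Notation mu := (@lebesgue_measure R).
Variables (alpha : nat) (f : R -> R).
Hypotheses (alpha2 : (2 <= alpha)%N) (fH : H_rho_mem alpha f).

Definition derivs (r : nat) : R -> R := derive1n r f.

Lemma derivs_continuous r : (r < alpha)%N -> continuous (derivs r).
Proof.
by move=> ra; apply: abs_cont_continuous => a b; have [_ _ _ fac _] := fH; exact: fac.
Qed.

Lemma derivs_is_derive r (x : R) : (r.+1 < alpha)%N -> is_derive x 1 (derivs r) (derivs r.+1 x).
Proof.
move=> ra; have [_ _ d _ _] := fH; apply: DeriveDef; first exact: d.
by rewrite -derive1E.
Qed.

Lemma derivs_jet : jet alpha derivs.
Proof.
have [_ f0 df fac f2] := fH; split => //.
- exact: derivs_continuous.
- move=> r ra a b ab; have mf : measurable_fun setT (derive1 (derivs r)).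
    by apply: measurable_derive1; exact: derivs_continuous.
  by have [] := abs_cont_FTC (fun a b => fac r a b ra) mf ab.
- have a0 : alpha.-1.+1 = alpha by rewrite prednK// ltnW.
  rewrite -[in derivs _]a0; apply: measurable_derive1; apply: derivs_continuous.
  by rewrite a0.
Qed.

Lemma leibniz_abs_cont r a b : (r < alpha)%N -> abs_cont a b (leibniz derivs r).
Proof.
move=> ra; have [_ _ _ fac _] := fH; apply: abs_cont_sum => i ir.
have ia : (i < alpha)%N by rewrite (leq_ltn_trans _ ra)// -ltnS.
have cD := derivs_continuous ia.
apply: (@abs_contM _ _ _ (fun x => 'C(r, i)%:R * derivs i x) (fun x => (herm (r - i)).[x] * rho x)).
- by move=> x; apply: cvgM; [exact: cvg_cst|exact: cD].
- exact: herm_rho_continuous.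
- have c1 : abs_cont a b (fun=> 'C(r, i)%:R : R) by exact: abs_cont_cst.
  by apply: (abs_contM _ cD c1) => [x|]; [exact: cvg_cst|exact: fac].
- apply: (@abs_cont_C1 _ _ _ _ (fun x => (herm (r - i).+1).[x] * rho x)).
    by move=> x; exact: is_derive_herm_rho.
  by move=> z; exact: herm_rho_continuous.
Qed.

(** Of the factors in the Leibniz sum only the derivative of order alpha - 1 fails to be derivable
    everywhere; it is absolutely continuous, hence derivable almost everywhere. *)
Lemma leibniz_ae_is_derive :
  {ae mu, forall x, is_derive (x : R) 1 (leibniz derivs alpha.-1) (leibniz derivs alpha x)}.
Proof.
have [_ _ df fac _] := fH; have a0 : alpha.-1.+1 = alpha by rewrite prednK// ltnW.
have aa : (alpha.-1 < alpha)%N by rewrite a0.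
have aeF := @ae_filter R.
apply: filterS (abs_cont_ae_derivable (fun a b => fac _ a b aa)) => x dx.
have -> : leibniz derivs alpha x = leibniz derivs alpha.-1.+1 x by rewrite a0.
apply: is_derive_leibniz => i ia.
have [->|ia'] := eqVneq i alpha.-1.
  by apply: DeriveDef => //; rewrite -derive1E.
by apply: derivs_is_derive; rewrite -[ltnRHS]a0 ltnS ltn_neqAle ia'.
Qed.

End H_rho_jet.

(** * Derivatives within the unit interval *)

Section derive_within.
Context {R : realType}.
Implicit Types (f g : R -> R) (A : set R) (x y : R).

Definition slope g x y : R := (g y - g x) / (y - x).

(** Identifies the image filters themselves, so that the two limits have the same value even where
    they do not exist. *)
Lemma fmap_slope g x : slope g x @ x^' = (fun h => h^-1 *: (g (h + x) - g x)) @ 0^'.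
Proof.
apply/funext => P; apply/propext; split=> /nbhs_ballP[e/= e0 He].
  apply/nbhs_ballP; exists e => // h/= hb h0.
  have := He (h + x); rewrite /slope /= addrK => H.
  rewrite /GRing.scale/= mulrC; apply: H.
    by move: hb; rewrite /ball/= sub0r normrN opprD addrCA subrr addr0 normrN.
  by rewrite -[X in _ != X]add0r (inj_eq (addIr x)).
apply/nbhs_ballP; exists e => // y/= yb yx.
have := He (y - x); rewrite /slope /= subrK => H.
rewrite mulrC; apply: H; last by rewrite subr_eq0.
by move: yb; rewrite /ball/= sub0r opprB.
Qed.

Lemma fmap_within_eq (A : set R) (F : set_system R) (p q : R -> R) :
  (forall y, A y -> p y = q y) -> p @ within A F = q @ within A F.
Proof.
move=> pq; apply/funext => P; rewrite /fmap/= /within/nbhs/=; congr (F _).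
by apply/seteqP; split=> y /= H Ay; [rewrite -pq//; exact: H|rewrite pq//; exact: H].
Qed.

Lemma within_interior A x : nbhs x A -> within A x^' = x^'.
Proof.
move=> xA; apply/seteqP; split=> P; rewrite /dnbhs /within/= => H; last first.
  by apply: filterS H => y H + ?; exact: H.
by apply: filterS2 xA H => y Ay H yx; exact: H.
Qed.

Lemma derive_within_eq A f g x : A x -> (forall y, A y -> f y = g y) ->
  derive_within A f x = derive_within A g x /\
  (derivable_within A f x <-> derivable_within A g x).
Proof.
move=> Ax fg; rewrite /derive_within /derivable_within.
suff -> : slope f x @ within A x^' = slope g x @ within A x^' by [].
by apply: fmap_within_eq => y Ay; rewrite /slope !fg.
Qed.

(* Also where g is not derivable: both sides are the lim of the same filter. *)
Lemma derive_within_interior A g x : nbhs x A -> derive_within A g x = derive1 g x.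
Proof.
move=> xA; rewrite /derive_within.
by rewrite -[_ @ _]/(slope g x @ within A x^') within_interior// fmap_slope.
Qed.

Lemma derive_within_is_derive A g x (d : R) : ProperFilter (within A x^') ->
  is_derive x 1 g d -> derivable_within A g x /\ derive_within A g x = d.
Proof.
move=> pF [dg gd].
have cg : slope g x @ within A x^' --> d.
  apply: (@cvg_trans _ (slope g x @ x^')).
    by apply: cvg_app; exact: cvg_within.
  rewrite fmap_slope -gd -derive1E; move: dg; rewrite /derivable.
  suff -> : (fun h => h^-1 *: ((g \o shift x) (h *: 1) - g x)) =
    (fun h => h^-1 *: (g (h + x) - g x)) by [].
  by apply/funext => h; rewrite /= -[h *: 1]/(h * 1) mulr1.
split; first by apply/cvg_ex; exists d.
exact: cvg_lim cg.
Qed.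

(** Gives uniqueness of the limits, one-sided at the end points; the nearby point is taken on the
    side of the midpoint, so that it stays in the interval. *)
Lemma unit_within_proper x : 0 <= x <= 1 -> ProperFilter (within `[0, 1]%classic x^').
Proof.
move=> /andP[x0 x1]; apply: Build_ProperFilter_ex => P /nbhs_ballP[e/= e0 He].
pose d := Num.min (e / 2) (1 / 2).
have d0 : 0 < d by rewrite lt_min !divr_gt0.
have de : d < e by rewrite gt_min ltr_pdivrMr// ltr_pMr// ltr1n.
have d1 : d <= 1 / 2 by rewrite ge_min lexx orbT.
have [xh|xh] := leP x (1 / 2).
  exists (x + d); apply: He => /=.
  - by rewrite /ball/= opprD addNKr normrN gtr0_norm.
  - by rewrite -subr_eq0 addrAC subrr add0r gt_eqF.
  - by rewrite in_itv/=; apply/andP; split; lra.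
exists (x - d); apply: He => /=.
- by rewrite /ball/= opprB addrCA subrr addr0 gtr0_norm.
- by rewrite -subr_eq0 addrAC subrr add0r oppr_eq0 gt_eqF.
- by rewrite in_itv/=; apply/andP; split; lra.
Qed.

End derive_within.

Section unit_image.
Context {R : realType}.
Local Notation mu := (@lebesgue_measure R).
Variables (T : R) (alpha : nat).
Hypotheses (T2 : 2 <= T) (alpha2 : (2 <= alpha)%N).
Local Notation I01 := (`[0, 1]%classic : set (measurableTypeR R)).

Let T0 : 0 < 2 * T. Proof. by rewrite mulr_gt0// (lt_le_trans _ T2). Qed.

Lemma is_derive_scaled D r (y : R) :
  is_derive (2 * T * y - T) 1 (leibniz D r) (leibniz D r.+1 (2 * T * y - T)) ->
  is_derive y 1 (scaled T D r) (scaled T D r.+1 y).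
Proof.
move=> dl; have da : is_derive y 1 (fun y => 2 * T * y - T) (2 * T).
  by apply: is_derive_eq; rewrite /GRing.scale/=; ring.
have dc := @is_derive1_comp R (leibniz D r) (fun y => 2 * T * y - T) y _ _ dl da.
rewrite /scaled; apply: is_derive_eq.
by rewrite -[_ *: _]/(_ * _) mulrCA -exprSr mulrC.
Qed.

Section one_function.
Variable f : R -> R.
Hypothesis fH : H_rho_mem alpha f.
Let D := derivs f.
Let U := scaled T D.
Definition unit_image : R -> R := scaled T (derivs f) 0.

Lemma is_derive_scaled_derivs r (y : R) : (r.+1 < alpha)%N -> is_derive y 1 (U r) (U r.+1 y).
Proof.
move=> ra; apply: is_derive_scaled; apply: is_derive_leibniz => i ir.
by apply: (derivs_is_derive fH); rewrite (leq_ltn_trans _ ra).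
Qed.

(** The derivative within [0, 1] depends on values in [0, 1] only, so an induction hypothesis
    restricted to that interval suffices. *)
Lemma derive_unitE r (y : R) : (r < alpha)%N -> 0 <= y <= 1 -> derive_unit r unit_image y = U r y.
Proof.
elim: r y => // r IH y ra y01; rewrite /derive_unit iterS -/(derive_unit r _).
have I01y : [set` `[0, 1]] y by rewrite /= in_itv.
have [-> _] := derive_within_eq I01y (fun z Az => IH z (ltnW ra) ltac:(by move: Az; rewrite /= in_itv)).
by have [_ ->] := derive_within_is_derive (unit_within_proper y01) (is_derive_scaled_derivs y ra).
Qed.

Let derive_unit_mem r (ra : (r < alpha)%N) (y : R) :
  [set` `[0, 1]] y -> derive_unit r unit_image y = U r y.
Proof. by rewrite /= in_itv/=; exact: derive_unitE. Qed.

Lemma derivable_unit r (y : R) : (r.+1 < alpha)%N -> 0 <= y <= 1 ->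
  derivable_within `[0, 1] (derive_unit r unit_image) y.
Proof.
move=> ra y01; have I01y : [set` `[0, 1]] y by rewrite /= in_itv.
have [_ E] := derive_within_eq I01y (derive_unit_mem (ltnW ra)).
apply/E.
by have [] := derive_within_is_derive (unit_within_proper y01) (is_derive_scaled_derivs y ra).
Qed.

(** Holds at each interior point, derivable or not, and therefore transfers the measurability of
    [derive1]. *)
Lemma derive_unit_top (y : R) : 0 < y < 1 -> derive_unit alpha unit_image y = derive1 (U alpha.-1) y.
Proof.
move=> /andP[y0 y1]; have a0 : alpha.-1.+1 = alpha by rewrite prednK// ltnW.
have aa : (alpha.-1 < alpha)%N by rewrite a0.
rewrite -[in LHS]a0 /derive_unit iterS -/(derive_unit alpha.-1 _).
have I01y : [set` `[0, 1]] y by rewrite /= in_itv/= !ltW.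
have [-> _] := derive_within_eq I01y (derive_unit_mem aa).
apply: derive_within_interior.
apply: (@filterS _ _ _ `]0, 1[%classic) => [z|]; first by rewrite /= !in_itv/= => /andP[/ltW -> /ltW ->].
by apply: near_in_itvoo; rewrite in_itv/= y0.
Qed.

Lemma measurable_derive_unit_top : measurable_fun I01 (derive_unit alpha unit_image).
Proof.
apply: (@measurable_fun_itv_cc _ _ _ false true).
have cU : continuous (U alpha.-1).
  move=> x; apply: cvgM; first exact: cvg_cst.
  apply: (@continuous_comp _ _ _ (fun y => 2 * T * y - T)).
    by apply: cvgB; [apply: cvgM; [exact: cvg_cst|exact: cvg_id]|exact: cvg_cst].
  apply: leibniz_continuous => i ia; apply: (derivs_continuous fH).
  by rewrite (leq_ltn_trans ia)// prednK// ltnW.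
apply: (@eq_measurable_fun _ _ _ _ _ (derive1 (U alpha.-1))) => [y|].
  by rewrite inE/= in_itv/= => y01; rewrite derive_unit_top.
by apply: measurable_funTS; exact: measurable_derive1.
Qed.

Lemma ae_affine (P : R -> Prop) : {ae mu, forall x, P x} ->
  {ae mu, forall y, P (2 * T * y - T)}.
Proof.
move=> [N [mN N0 PN]]; exists (affine (2 * T) (- T) @^-1` N); split.
- by rewrite -[X in measurable X]setTI; exact: measurable_affine.
- move: N0; rewrite (lebesgue_measure_affine (- T) T0 mN) => /eqP.
  by rewrite mule_eq0 eqe gt_eqF//= => /eqP.
- by move=> y nP; apply: PN => Pa; exact: nP.
Qed.

(** The exceptional set is the preimage of a null set under the affine map, together with the two
    end points. *)
Lemma derive_unit_ae : {ae mu, forall y, I01 y -> derive_unit alpha unit_image y = U alpha y}.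
Proof.
have aeF := @ae_filter R.
have aff := ae_affine (leibniz_ae_is_derive alpha2 fH).
move: (ae_neq (0 : R)) (ae_neq (1 : R)) aff; apply: filterS3 => y y0 y1 dy; rewrite /= in_itv/= => /andP[y0' y1'].
have y01 : 0 < y < 1 by rewrite !lt_neqAle eq_sym y0 y0' y1 y1'.
rewrite derive_unit_top// derive1E.
have a0 : alpha.-1.+1 = alpha by rewrite prednK// ltnW.
rewrite -[in leibniz _ alpha _]a0 in dy.
by have [_ ->] := is_derive_scaled dy; rewrite a0.
Qed.

End one_function.
End unit_image.

Section unit_image_space.
Context {R : realType}.
Local Notation mu := (@lebesgue_measure R).
Variables (T : R) (alpha : nat).
Hypotheses (T2 : 2 <= T) (alpha2 : (2 <= alpha)%N).
Local Notation I01 := (`[0, 1]%classic : set (measurableTypeR R)).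
Local Notation top f := (derive_unit alpha (unit_image T f)).
Implicit Types f g : R -> R.

Let T0 : 0 < 2 * T. Proof. by rewrite mulr_gt0// (lt_le_trans _ T2). Qed.

Let m01 : measurable I01. Proof. exact: measurable_itv. Qed.

Lemma derive_unit_abs_cont f r : H_rho_mem alpha f -> (r < alpha)%N ->
  abs_cont 0 1 (derive_unit r (unit_image T f)).
Proof.
move=> fH ra; have sAC : abs_cont 0 1 (scaled T (derivs f) r).
  have lAC : abs_cont 0 1 (fun y => leibniz (derivs f) r (2 * T * y + - T)).
    by apply: (abs_cont_affine T0); exact: (leibniz_abs_cont fH).
  have c0 : abs_cont 0 1 (fun=> 0 : R) by exact: abs_cont_cst.
  apply: (abs_cont_controlled (M := (2 * T) ^+ r.+1) _ lAC c0); first by rewrite exprn_gt0.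
  move=> x y _ xy _; rewrite subrr normr0 addr0 -mulrBr normrM gtr0_norm ?exprn_gt0//.
  by rewrite ler_pM2l ?exprn_gt0// lerDl subr_ge0.
have e0 x : 0 <= x <= 1 -> derive_unit r (unit_image T f) x = scaled T (derivs f) r x.
  exact: (derive_unitE T fH).
apply: (abs_cont_controlled ltr01 sAC sAC) => x y x0 xy y1.
rewrite mul1r !e0 ?x0 ?y1 ?(le_trans x0)// ?(le_trans xy)//.
by rewrite -addrA lerDl addr_ge0// subr_ge0.
Qed.

Lemma unit_image_top_mul_int f g : H_rho_mem alpha f -> H_rho_mem alpha g ->
  Rintegrable mu I01 (fun y => top f y * top g y) /\
  \int[mu]_(y in `[0, 1]) (top f y * top g y) =
  \int[mu]_(y in `[0, 1]) (scaled T (derivs f) alpha y * scaled T (derivs g) alpha y).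
Proof.
move=> fH gH.
have mm : measurable_fun I01 (fun y => top f y * top g y).
  by apply: measurable_funM; exact: measurable_derive_unit_top.
have i := scaled_mul_int alpha2 T2 (derivs_jet alpha2 fH) (derivs_jet alpha2 gH).
have ms := Rintegrable_measurable i.
have ae : {ae mu, forall y, I01 y ->
    top f y * top g y =
    scaled T (derivs f) alpha y * scaled T (derivs g) alpha y}.
  have aeF := @ae_filter R.
  move: (derive_unit_ae T2 alpha2 fH) (derive_unit_ae T2 alpha2 gH); apply: filterS2.
  by move=> y Hf Hg Iy; rewrite Hf// Hg.
by split; [exact: ae_eq_Rintegrable ae i|exact: ae_eq_Rintegral].
Qed.

Lemma unit_image_mem f : H_rho_mem alpha f -> H_unit_mem alpha (unit_image T f).
Proof.
move=> fH; split.
- move=> r x ra x01; exact: (derivable_unit fH ra x01).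
- by move=> r ra; exact: derive_unit_abs_cont.
- have [i _] := unit_image_top_mul_int fH fH.
  by rewrite (_ : (fun x => _) =
    EFin \o (fun y => top f y * top f y)).
Qed.

Lemma unit_image_dot f g : H_rho_mem alpha f -> H_rho_mem alpha g ->
  H_unit_dot alpha (unit_image T f) (unit_image T g) = scaled_dot alpha T (derivs f) (derivs g).
Proof.
move=> fH gH; have [_ E] := unit_image_top_mul_int fH gH.
rewrite /H_unit_dot E /scaled_dot; congr (_ + _).
have e0 h r : H_rho_mem alpha h -> (r < alpha)%N ->
    \int[mu]_(y in `[0, 1]) derive_unit r (unit_image T h) y =
    \int[mu]_(y in `[0, 1]) scaled T (derivs h) r y.
  move=> hH ra; apply: eq_Rintegral => y; rewrite inE/= in_itv/=.
  exact: (derive_unitE T hH).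
by apply: eq_big_nat => r /andP[_ ra]; rewrite !e0.
Qed.

Local Notation H := (H_rho R alpha).
Local Notation elt := {f : R -> R | fs_mem H f}.
Local Notation dotH := (fun f g : elt => fs_dot H (sval f) (sval g)).
Local Notation H1 := (H_unit R alpha).

Definition to_unit (f : elt) : {f : R -> R | fs_mem H1 f} :=
  exist _ (unit_image T (sval f)) (unit_image_mem (svalP f)).

Definition elt_derivs (f : elt) := derivs (sval f).

Lemma elt_derivs_jet (f : elt) : jet alpha (elt_derivs f).
Proof. exact: derivs_jet (svalP f). Qed.

Lemma H_rho_dotE : dotH =
  (fun f g : elt => jet_dot alpha (elt_derivs f) (elt_derivs g)).
Proof. by []. Qed.

Lemma psd_H_rho : psd dotH.
Proof. rewrite H_rho_dotE; exact: (psd_jet_dot elt_derivs_jet). Qed.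

Lemma to_unit_dotE : (fun f g : elt => fs_dot H1 (sval (to_unit f)) (sval (to_unit g))) =
  (fun f g : elt => scaled_dot alpha T (elt_derivs f) (elt_derivs g)).
Proof.
by apply/funext => f; apply/funext => g; apply: unit_image_dot; [exact: svalP|exact: svalP].
Qed.

Lemma psd_to_unit : psd (fun f g : elt => fs_dot H1 (sval (to_unit f)) (sval (to_unit g))).
Proof. by rewrite to_unit_dotE; exact: (psd_scaled_dot elt_derivs_jet). Qed.

Definition unit_bound : R := Num.sqrt ((2 * T) ^+ alpha.*2.+1 * (400 * jet_const alpha ^+ 2)).

Lemma to_unit_le (w : seq (R * elt)) :
  bform (fun f g : elt => fs_dot H1 (sval (to_unit f)) (sval (to_unit g))) w w <=
  unit_bound ^+ 2 * bform dotH w w.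
Proof.
rewrite to_unit_dotE H_rho_dotE sqr_sqrtr; first exact: (bform_scaled_dot elt_derivs_jet).
by apply: mulr_ge0; [exact: exprn_ge0 (ltW T0)|exact: mulr_ge0 (ler0n _ 400) (sqr_ge0 _)].
Qed.

Definition eval_fun x f : R := f x.
Definition full_fun f : R := \int[mu]_x (f x * rho x).
Definition cube_fun f : R := \int[mu]_(y in `[0, 1]) unit_image T f y.

Local Notation B := (16 * 2 ^+ alpha : R).

Lemma eval_fun_bound x (w : seq (R * elt)) :
  (\sum_(t <- w) t.1 * eval_fun x (sval t.2)) ^+ 2 <=
  eval_const alpha x ^+ 2 * bform dotH w w.
Proof.
apply: (@jet_functional_bound _ alpha _ elt_derivs elt_derivs_jet (fun E => E 0%N x)) => //.
by move=> E jE; rewrite mulrC; exact: (jet_eval alpha2).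
Qed.

Lemma full_fun_bound (w : seq (R * elt)) :
  (\sum_(t <- w) t.1 * full_fun (sval t.2)) ^+ 2 <=
  B ^+ 2 * bform dotH w w.
Proof.
apply: (@jet_functional_bound _ alpha _ elt_derivs elt_derivs_jet full_int).
  exact: (full_int_comb elt_derivs_jet).
by move=> E jE; exact: full_int_le.
Qed.

Lemma cube_fun_bound (w : seq (R * elt)) :
  (\sum_(t <- w) t.1 * cube_fun (sval t.2)) ^+ 2 <=
  B ^+ 2 * bform dotH w w.
Proof.
apply: (@jet_functional_bound _ alpha _ elt_derivs elt_derivs_jet (cube_int T)).
  exact: (cube_int_comb elt_derivs_jet).
by move=> E jE; exact: cube_int_le.
Qed.

Lemma tail_fun_bound (w : seq (R * elt)) :
  (\sum_(t <- w) t.1 * (full_fun (sval t.2) - cube_fun (sval t.2))) ^+ 2 <=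
  (B * expR (- (T / 2 - 1) ^+ 2)) ^+ 2 *
  bform dotH w w.
Proof.
apply: (@jet_functional_bound _ alpha _ elt_derivs elt_derivs_jet
  (fun E => full_int E - cube_int T E)).
  rewrite (full_int_comb elt_derivs_jet)// (cube_int_comb elt_derivs_jet)//.
  by rewrite -sumrB; apply: eq_bigr => t _; rewrite mulrBr.
by move=> E jE; exact: tail_int_le.
Qed.

Lemma unit_imageE f y : unit_image T f y = 2 * T * (f (2 * T * y - T) * rho (2 * T * y - T)).
Proof. exact: scaled0E. Qed.

End unit_image_space.

(** * Integrals of tensors *)

Section product_of_two.
Context d1 d2 (T1 : measurableType d1) (T2 : measurableType d2) {R : realType}.
Variables (m1 : {sigma_finite_measure set T1 -> \bar R})
  (m2 : {sigma_finite_measure set T2 -> \bar R}).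
Variables (a : T1 -> R) (b : T2 -> R).
Hypotheses (ai : Rintegrable m1 setT a) (bi : Rintegrable m2 setT b).

Let measurable_prod2 : measurable_fun setT (fun z : T1 * T2 => a z.1 * b z.2).
Proof.
apply: measurable_funM.
  by apply: measurableT_comp; [exact: Rintegrable_measurable ai|exact: measurable_fst].
by apply: measurableT_comp; [exact: Rintegrable_measurable bi|exact: measurable_snd].
Qed.

Lemma Rintegrable_prod2 : Rintegrable (m1 \x m2)%E setT (fun z => a z.1 * b z.2).
Proof.
apply/integrable12ltyP; first exact/measurable_EFinP.
have bi' : m2.-integrable setT (fun y => `|(b y)%:E|)%E by exact: integrable_abse.
have E x : (\int[m2]_y `|(a x * b y)%:E| = `|a x|%:E * \int[m2]_y `|(b y)%:E|)%E.
  rewrite -integralZl//; apply: eq_integral => y _.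
  by rewrite /= normrM EFinM.
under eq_integral do rewrite /= E.
rewrite -(fineK (integrable_fin_num measurableT bi')).
have ai' : m1.-integrable setT (fun y => `|(a y)%:E|)%E by exact: integrable_abse.
rewrite integralZr//.
by rewrite -(fineK (integrable_fin_num measurableT ai')) -EFinM ltry.
Qed.

Lemma Rintegral_prod2 : \int[(m1 \x m2)%E]_z (a z.1 * b z.2) =
  (\int[m1]_x a x) * (\int[m2]_y b y).
Proof.
rewrite /Rintegral -(integral12_prod_meas1 Rintegrable_prod2).
have -> : (\int[m1]_x fubini_F m2 (EFin \o (fun z : T1 * T2 => (a z.1 * b z.2)%R)) x =
    \int[m1]_x ((a x)%:E * \int[m2]_y (b y)%:E))%E.
  by apply: eq_integral => x _; rewrite /fubini_F -integralZl.
rewrite -(fineK (integrable_fin_num measurableT bi)) integralZr//.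
by rewrite -(fineK (integrable_fin_num measurableT ai)) -EFinM.
Qed.

End product_of_two.

Section tuple_products.
Context {R : realType}.
Local Notation mu := (@lebesgue_measure R).
Local Notation leb n := (lebesgue_tuple R n).

Lemma measurable_tuple_prod n (g : 'I_n -> R -> R) : (forall j, measurable_fun setT (g j)) ->
  measurable_fun setT (fun y : Rtuple R n => \prod_j g j (tnth y j)).
Proof.
move=> mg; apply: measurable_prod => j _.
exact: (@measurableT_comp _ _ _ _ _ _ (g j) _ (fun y : Rtuple R n => tnth y j) (mg j)
  (measurable_tnth j)).
Qed.

(** Follows the recursion of [lebesgue_tuple]: a Dirac mass for n = 0, then the image of a product
    measure under [cons_pair], where Fubini splits off the first factor. *)
Lemma tuple_prod_integral n (g : 'I_n -> R -> R) : (forall j, Rintegrable mu setT (g j)) ->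
  Rintegrable (leb n) setT (fun y => \prod_j g j (tnth y j)) /\
  \int[leb n]_y \prod_j g j (tnth y j) = \prod_j \int[mu]_x g j x.
Proof.
elim: n g => [|n IH] g gi.
  have E : (fun y : Rtuple R 0 => \prod_j g j (tnth y j)) = cst 1.
    by apply/funext => y; rewrite big_ord0.
  rewrite E big_ord0; split.
    apply/integrableP; split; first exact/measurable_EFinP.
    by rewrite integral_dirac//= diracT mul1e normr1 ltry.
  have := @diracT _ (Rtuple R 0) R [tuple] => dT.
  have -> : lebesgue_tuple R 0 = dirac [tuple] :> {measure set (Rtuple R 0) -> \bar R} by [].
  rewrite /Rintegral integral_dirac ?mule1; first by rewrite dT.
    exact: measurableT.
  exact/measurable_EFinP.
have [i1 i2] := IH (fun j => g (lift ord0 j)) (fun j => gi _).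
have mg : measurable_fun setT (fun y : Rtuple R n.+1 => \prod_j g j (tnth y j)).
  by apply: measurable_tuple_prod => j; exact: Rintegrable_measurable (gi j).
have mg' : measurable_fun setT (fun y : Rtuple R n.+1 => (\prod_j g j (tnth y j))%:E).
  exact/measurable_EFinP.
have fE : (fun y : Rtuple R n.+1 => (\prod_j g j (tnth y j))%:E) \o @cons_pair R n =
    (fun z => (g ord0 z.1 * \prod_j g (lift ord0 j) (tnth z.2 j))%:E).
  apply/funext => -[x y]; rewrite /= big_ord_recl; congr (_ * _)%:E.
  by apply: eq_bigr => j _; rewrite tnthS.
have pi := Rintegrable_prod2 (gi ord0) i1.
have pE := Rintegral_prod2 (gi ord0) i1.
have ci : (mu \x leb n)%E.-integrable (@cons_pair R n @^-1` setT)
    ((fun y : Rtuple R n.+1 => (\prod_j g j (tnth y j))%:E) \o @cons_pair R n).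
  by rewrite preimage_setT fE.
pose P := pushforward (mu \x leb n)%E (@cons_pair R n).
split.
  have /integrableP[_ lt] := integrable_pushforward (@measurable_cons_pair R n) mg' ci measurableT.
  apply/integrableP; split; first exact/measurable_EFinP.
  by apply: le_lt_trans lt; apply: eqW.
have := integral_pushforward (@measurable_cons_pair R n) mg' ci measurableT.
rewrite preimage_setT fE => E.
rewrite big_ord_recl -i2 -pE /Rintegral -E; congr fine.
Qed.

Definition tuple_box n (A : set R) : set (Rtuple R n) := [set y | forall j, A (tnth y j)].
Arguments tuple_box : clear implicits.

Lemma measurable_tuple_box n (A : set (measurableTypeR R)) : measurable A ->
  measurable (tuple_box n A).
Proof.
move=> mA; rewrite (_ : tuple_box n A = \bigcap_(j in [set: 'I_n]) ((fun y : Rtuple R n => tnth y j) @^-1` A)).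
  apply: fin_bigcap_measurable; first exact: finite_finset.
  by move=> j _; rewrite -[X in measurable X]setTI; exact: measurable_tnth.
by apply/seteqP; split=> y /= H j => [_|]; exact: H.
Qed.

(** Outside the box one of the restricted factors vanishes, so the product of the restrictions is
    the restriction of the product. *)
Lemma tuple_box_integral n (A : set (measurableTypeR R)) (g : 'I_n -> R -> R) :
  measurable A -> (forall j, Rintegrable mu A (g j)) ->
  Rintegrable (leb n) (tuple_box n A) (fun y => \prod_j g j (tnth y j)) /\
  \int[leb n]_(y in tuple_box n A) \prod_j g j (tnth y j) =
    \prod_j \int[mu]_(x in A) g j x.
Proof.
move=> mA gi; have mB : measurable (tuple_box n A) := measurable_tuple_box mA.
have gi' j : Rintegrable mu setT (g j \_ A).
  by rewrite /Rintegrable -restrict_EFin; apply/(integrable_mkcond _ mA).1; exact: gi.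
have [i E] := tuple_prod_integral gi'.
have rE : (fun y : Rtuple R n => \prod_j g j (tnth y j)) \_ (tuple_box n A) =
    (fun y => \prod_j (g j \_ A) (tnth y j)).
  apply/funext => y; rewrite /patch; case: ifPn => [|]; rewrite ?inE ?notin_setE/= => By.
    by apply: eq_bigr => j _; rewrite mem_set//; exact: By.
  have [j nj] : exists j, ~ A (tnth y j) by apply/existsNP.
  by rewrite (bigD1 j)//= memNset// mul0r.
split; first by apply/(integrable_mkcond _ mB).2; rewrite restrict_EFin rE.
by rewrite Rintegral_mkcond rE E; apply: eq_bigr => j _; rewrite [RHS]Rintegral_mkcond.
Qed.

End tuple_products.
Arguments tuple_box {R} n A.

Section tensor_integrals.
Context {R : realType}.
Local Notation mu := (@lebesgue_measure R).
Local Notation leb n := (lebesgue_tuple R n).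
Variables (X : Type) (n : nat) (g : X -> R -> R) (A : set (measurableTypeR R)).
Hypotheses (mA : measurable A) (gi : forall x, Rintegrable mu A (g x)).
Implicit Types u : seq (R * ('I_n -> X)).

Definition sum_prod u (y : Rtuple R n) := \sum_(t <- u) t.1 * \prod_j g (t.2 j) (tnth y j).

Lemma sum_prod_integral u :
  Rintegrable (leb n) (tuple_box n A) (sum_prod u) /\
  \int[leb n]_(y in tuple_box n A) sum_prod u y =
    \sum_(t <- u) t.1 * \prod_j \int[mu]_(x in A) g (t.2 j) x.
Proof.
have mB : measurable (tuple_box n A) := measurable_tuple_box mA.
have pi (t : R * ('I_n -> X)) := tuple_box_integral mA (fun j => gi (t.2 j)).
have ci t : Rintegrable (leb n) (tuple_box n A)
    (fun y => t.1 * \prod_j g (t.2 j) (tnth y j)).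
  by apply: RintegrableZ => //; exact: (pi t).1.
split; first exact: Rintegrable_sum.
rewrite Rintegral_sum//; apply: eq_bigr => t _.
by rewrite RintegralZl//; [rewrite (pi t).2|exact: (pi t).1].
Qed.

(** Dominated convergence on the box, [F] being measurable there as a pointwise limit. *)
Lemma sum_prod_dominated_cvg (u : nat -> seq (R * ('I_n -> X))) (F : Rtuple R n -> R)
    (h : R -> R) (C : R) : Rintegrable mu A h ->
  (forall k y, tuple_box n A y -> `|sum_prod (u k) y| <= C * \prod_j h (tnth y j)) ->
  (forall y, tuple_box n A y -> sum_prod (u k) y @[k --> \oo] --> F y) ->
  \sum_(t <- u k) t.1 * \prod_j \int[mu]_(x in A) g (t.2 j) x @[k --> \oo] -->
  \int[leb n]_(y in tuple_box n A) F y.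
Proof.
move=> hi uh uF; have mB : measurable (tuple_box n A) := measurable_tuple_box mA.
have [Hi _] := @tuple_box_integral _ n A (fun=> h) mA (fun=> hi).
have hC : Rintegrable (leb n) (tuple_box n A) (fun y => C * \prod_j h (tnth y j)).
  exact: RintegrableZ.
have mu_ k : measurable_fun (tuple_box n A) (EFin \o sum_prod (u k)).
  by apply/measurable_EFinP; apply: Rintegrable_measurable; exact: (sum_prod_integral (u k)).1.
have uF' y : tuple_box n A y -> (EFin \o sum_prod (u k)) y @[k --> \oo] --> (EFin \o F) y.
  by move=> By; apply: cvg_EFin; [exact: nearW|exact: uF].
have mF : measurable_fun (tuple_box n A) (EFin \o F).
  exact: (emeasurable_fun_cvg (fun k => EFin \o sum_prod (u k))).
have dom y : forall k, tuple_box n A y ->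
    (`|(sum_prod (u k) y)%:E| <= (C * \prod_j h (tnth y j))%:E)%E.
  by move=> k By; rewrite lee_fin; exact: uh.
have [Fi _ lim] := @dominated_convergence _ _ _ (leb n) _ mB
  (fun k => EFin \o sum_prod (u k)) _ _ mu_ mF (aeW _ uF') hC
  (aeW _ dom).
have E k : \sum_(t <- u k) t.1 * \prod_j \int[mu]_(x in A) g (t.2 j) x =
    \int[leb n]_(y in tuple_box n A) sum_prod (u k) y.
  by rewrite (sum_prod_integral (u k)).2.
under eq_fun do rewrite E.
apply: fine_cvg; rewrite -[X in _ --> X]/(_) fineK//.
exact: integrable_fin_num.
Qed.

End tensor_integrals.

(** * Error in terms of the norms of the functionals *)

Section telescoping_product.
Context {R : realType} (s : nat) (a b : 'I_s -> R).

Definition mixed_factor (i : nat) (j : 'I_s) : R :=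
  if (j < i)%N then b j else if j == i :> nat then a j - b j else a j.

Lemma telescoping_product : \prod_j a j - \prod_j b j = \sum_(i < s) \prod_j mixed_factor i j.
Proof.
pose P i := \prod_(j < s) (if (j < i)%N then b j else a j).
have -> : \prod_j a j = P 0%N by [].
have -> : \prod_j b j = P s by apply: eq_bigr => j _; rewrite ltn_ord.
rewrite -[LHS]opprB -(telescope_sumr P (leq0n s)) -sumrN big_mkord; apply: eq_bigr => i _.
rewrite opprB /P (bigD1 i)//= [X in _ - X](bigD1 i)//= [RHS](bigD1 i)//=.
rewrite ltnn ltnSn /mixed_factor ltnn eqxx.
have E : \prod_(j < s | j != i) (if (j < i.+1)%N then b j else a j) =
    \prod_(j < s | j != i) (if (j < i)%N then b j else a j).
  by apply: eq_bigr => j ji; rewrite ltnS leq_eqVlt (negPf (ji : j != i :> nat)).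
rewrite E -mulrBl; congr (_ * _); apply: eq_bigr => j ji.
by rewrite (negPf (ji : j != i :> nat)).
Qed.

End telescoping_product.

Section error.
Context {R : realType}.
Local Notation mu := (@lebesgue_measure R).
Variables (s alpha : nat) (T : R).
Hypotheses (alpha2 : (2 <= alpha)%N) (T2 : 2 <= T).
Local Notation H := (H_rho R alpha).
Local Notation elt := {f : R -> R | fs_mem H f}.
Local Notation dotH := (fun f g : elt => fs_dot H (sval f) (sval g)).
Local Notation H1 := (H_unit R alpha).
Local Notation B := (16 * 2 ^+ alpha : R).
Local Notation tau := (expR (- (T / 2 - 1) ^+ 2)).
Local Notation I01 := (`[0, 1]%classic : set (measurableTypeR R)).

Let a0 : (0 < alpha)%N. Proof. exact: ltnW. Qed.
Let pH := @psd_H_rho R alpha alpha2.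
Let B0 : 0 <= B. Proof. by rewrite mulr_ge0 ?exprn_ge0. Qed.

Local Notation nrm u := (Num.sqrt (tensor_dot u u)).

Lemma tensor_apply_bound (L : 'I_s -> (R -> R) -> R) (C : 'I_s -> R) (u : tensor H s) :
  (forall j, 0 <= C j) ->
  (forall j (w : seq (R * elt)), (\sum_(t <- w) t.1 * L j (sval t.2)) ^+ 2 <=
    C j ^+ 2 * bform dotH w w) ->
  `|tensor_apply L u| <= (\prod_j C j) * nrm u.
Proof.
move=> C0 LC; have := tensor_apply_le pH LC u.
have u0 := tensor_dot_ge0 pH u.
rewrite -[tensor_dot u u in leRHS](sqr_sqrtr u0) -exprMn => h.
rewrite -ler_sqr ?nnegrE ?mulr_ge0 ?sqrtr_ge0//; last by rewrite prodr_ge0.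
by rewrite real_normK ?num_real.
Qed.

Lemma tensor_eval_bound (u : tensor H s) (y : s.-tuple R) :
  `|tensor_eval u y| <= (\prod_j eval_const alpha (tnth y j)) * nrm u.
Proof.
apply: (@tensor_apply_bound (fun j => eval_fun (tnth y j))) => j.
  exact: eval_const_ge0.
exact: eval_fun_bound.
Qed.

Definition full_apply (u : tensor H s) := tensor_apply (fun=> @full_fun R) u.
Definition cube_apply (u : tensor H s) := tensor_apply (fun=> cube_fun T) u.

Lemma full_cube_apply_le (u : tensor H s) :
  `|full_apply u - cube_apply u| <= s%:R * (B ^+ s * tau) * nrm u.
Proof.
pose L (i : nat) (j : 'I_s) (f : R -> R) := mixed_factor (fun=> full_fun f) (fun=> cube_fun T f) i j.
have -> : full_apply u - cube_apply u = \sum_(i < s) tensor_apply (L i) u.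
  rewrite /full_apply /cube_apply /tensor_apply -sumrB exchange_big/=; apply: eq_bigr => t _.
  by rewrite -mulrBr telescoping_product mulr_sumr.
apply: le_trans (ler_norm_sum _ _ _) _.
have -> : s%:R * (B ^+ s * tau) * nrm u = \sum_(i < s) (B ^+ s * tau) * nrm u.
  by rewrite sumr_const card_ord -mulrA mulr_natl.
apply: ler_sum => i _.
(* In the telescoped term of index [i] the difference of the functionals stands at [i] and brings
   the small factor; every other coordinate has norm at most [B]. *)
pose C (j : 'I_s) := if j == i then B * tau else B.
have C0 j : 0 <= C j by rewrite /C; case: ifP => _; rewrite ?mulr_ge0// expR_ge0.
have -> : B ^+ s * tau = \prod_j C j.
  rewrite (bigD1 i)//= {1}/C eqxx mulrAC; congr (_ * _).
  rewrite (eq_bigr (fun=> B)) => [|j /negPf ji]; last by rewrite /C ji.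
  have := prodr_const 'I_s B; rewrite card_ord => <-.
  by rewrite (bigD1 i)//=.
apply: tensor_apply_bound => // j w; rewrite /L /mixed_factor /C.
have [->|ji] := eqVneq j i; first by rewrite ltnn !eqxx; exact: tail_fun_bound.
rewrite (negPf (ji : j != i :> nat)); case: (j < i)%N; first exact: cube_fun_bound.
exact: full_fun_bound.
Qed.

Section limit.
Variables (u : nat -> tensor H s) (F : s.-tuple R -> R) (N : R).
Hypotheses (uF : tensor_represents u F) (uN : nrm (u k) @[k --> \oo] --> N).

Lemma norms_bounded : exists C, forall k, nrm (u k) <= C.
Proof.
have cv : cvgn (fun k => nrm (u k)) by apply/cvg_ex; exists N.
have [C [_ HC]] := cvg_seq_bounded cv; exists (C + 1) => k.
by apply: le_trans (ler_norm _) _; apply: HC => //; rewrite ltrDl.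
Qed.

Lemma tuple_boxT : tuple_box s (@setT R) = setT.
Proof. by apply/seteqP; split. Qed.

Lemma full_apply_cvg :
  full_apply (u k) @[k --> \oo] --> \int[lebesgue_tuple R s]_y (F y * rho_prod y).
Proof.
have [C HC] := norms_bounded.
pose g (f : elt) x := sval f x * rho x.
have gi (f : elt) : Rintegrable mu setT (g f).
  exact: (jet_rho_int alpha2 (elt_derivs_jet alpha2 f)).
have gE (v : tensor H s) y : sum_prod g v y = tensor_eval v y * rho_prod y.
  rewrite /sum_prod /tensor_eval mulr_suml; apply: eq_bigr => t _.
  by rewrite -mulrA -big_split.
have ki : Rintegrable mu setT (kappa alpha) by exact: Rintegrable_kappa.
have := @sum_prod_dominated_cvg _ elt s g setT measurableT gi u (fun y => F y * rho_prod y)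
  (kappa alpha) C ki; rewrite tuple_boxT; apply.
- move=> k y _; rewrite gE normrM.
  have r0 : 0 <= rho_prod y by apply: prodr_ge0 => j _; exact: rho_ge0.
  rewrite (ger0_norm r0).
  have -> : \prod_j kappa alpha (tnth y j) = (\prod_j eval_const alpha (tnth y j)) * rho_prod y.
    by rewrite -big_split.
  rewrite mulrA ler_wpM2r//; apply: le_trans (tensor_eval_bound _ _) _.
  rewrite mulrC ler_wpM2r//; apply: prodr_ge0 => j _; exact: eval_const_ge0.
- move=> y _; under eq_fun do rewrite gE.
  by apply: cvgM; [exact: uF.2|exact: cvg_cst].
Qed.

(** The integrand carried to the unit cube with density and Jacobian: the limit of the images of the
    tensors, whose mean over the point set is [quadrature]. *)
Definition cube_pullback (y : s.-tuple R) : R :=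
  (2 * T) ^+ s * (F (box_map T y) * rho_prod (box_map T y)).

Lemma sum_prod_unit_image (v : tensor H s) (y : s.-tuple R) :
  sum_prod (fun f : elt => unit_image T (sval f)) v y =
  (2 * T) ^+ s * (tensor_eval v (box_map T y) * rho_prod (box_map T y)).
Proof.
rewrite /sum_prod /tensor_eval mulr_suml mulr_sumr; apply: eq_bigr => t _.
rewrite -mulrA -big_split/= mulrCA; congr (_ * _).
have -> : (2 * T) ^+ s = \prod_(j < s) (2 * T) by rewrite prodr_const card_ord.
by rewrite -big_split/=; apply: eq_bigr => j _; rewrite unit_imageE tnth_mktuple.
Qed.

Lemma cube_pullback_cvg y :
  sum_prod (fun f : elt => unit_image T (sval f)) (u k) y @[k --> \oo] --> cube_pullback y.
Proof.
under eq_fun do rewrite sum_prod_unit_image.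
apply: cvgM; first exact: cvg_cst.
by apply: cvgM; [exact: uF.2|exact: cvg_cst].
Qed.

Lemma unit_cubeE : @unit_cube R s = tuple_box s I01.
Proof.
by apply/seteqP; split=> y /= Hy j; have := Hy j; rewrite /= in_itv.
Qed.

Lemma cube_apply_cvg :
  cube_apply (u k) @[k --> \oo] --> \int[lebesgue_tuple R s]_(y in @unit_cube R s) cube_pullback y.
Proof.
have [C HC] := norms_bounded.
have m01 : measurable I01 by exact: measurable_itv.
have T0 : 0 <= 2 * T by have := T2; lra.
pose h y := 2 * T * kappa alpha (2 * T * y - T).
have hi : Rintegrable mu I01 h.
  apply: continuous_Rintegrable => x; apply: cvgM; first exact: cvg_cst.
  apply: (@continuous_comp _ _ _ (fun y => 2 * T * y - T)); last exact: continuous_kappa.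
  by apply: cvgB; [apply: cvgM; [exact: cvg_cst|exact: cvg_id]|exact: cvg_cst].
have gi (f : elt) : Rintegrable mu I01 (unit_image T (sval f)).
  exact: (scaled_int_lt T2 alpha2 (elt_derivs_jet alpha2 f) a0).
have := @sum_prod_dominated_cvg _ elt s _ I01 m01 gi u cube_pullback h C hi.
rewrite unit_cubeE; apply; last by move=> y _; exact: cube_pullback_cvg.
move=> k y _; rewrite sum_prod_unit_image.
have r0 : 0 <= rho_prod (box_map T y) by apply: prodr_ge0 => j _; exact: rho_ge0.
rewrite 2!normrM (ger0_norm r0) ger0_norm ?exprn_ge0//.
have -> : \prod_j h (tnth y j) = (2 * T) ^+ s *
    ((\prod_j eval_const alpha (tnth (box_map T y) j)) * rho_prod (box_map T y)).
  have -> : (2 * T) ^+ s = \prod_(j < s) (2 * T) by rewrite prodr_const card_ord.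
  by rewrite -!big_split/=; apply: eq_bigr => j _; rewrite tnth_mktuple.
rewrite [leRHS]mulrCA ler_wpM2l ?exprn_ge0// [leRHS]mulrA ler_wpM2r//.
apply: le_trans (tensor_eval_bound _ _) _.
by rewrite mulrC ler_wpM2r//; apply: prodr_ge0 => j _; exact: eval_const_ge0.
Qed.

Lemma full_cube_le :
  `|\int[lebesgue_tuple R s]_y (F y * rho_prod y) -
    \int[lebesgue_tuple R s]_(y in @unit_cube R s) cube_pullback y| <= s%:R * (B ^+ s * tau) * N.
Proof.
have l1 : `|full_apply (u k) - cube_apply (u k)| @[k --> \oo] -->
    `|\int[lebesgue_tuple R s]_y (F y * rho_prod y) -
      \int[lebesgue_tuple R s]_(y in @unit_cube R s) cube_pullback y|.
  by apply: cvg_norm; apply: cvgB; [exact: full_apply_cvg|exact: cube_apply_cvg].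
have l2 : s%:R * (B ^+ s * tau) * nrm (u k) @[k --> \oo] --> s%:R * (B ^+ s * tau) * N.
  by apply: cvgM => //; exact: cvg_cst.
rewrite -(cvg_lim _ l1)// -(cvg_lim _ l2)//; apply: ler_lim.
- by apply/cvg_ex; eexists; exact: l1.
- by apply/cvg_ex; eexists; exact: l2.
- by apply: nearW => k; exact: full_cube_apply_le.
Qed.

Let tm := tensor_map (@to_unit R T alpha T2 alpha2) : tensor H s -> tensor H1 s.

Lemma cube_pullback_represents : tensor_represents (tm \o u) cube_pullback.
Proof.
split; first exact: (tensor_map_cauchy pH (psd_to_unit T2 alpha2) (to_unit_le T2 alpha2) uF.1).
move=> y _; have := @cube_pullback_cvg y.
have -> // : (fun k => sum_prod (fun f : elt => unit_image T (sval f)) (u k) y) =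
  (fun k => tensor_eval ((tm \o u) k) y).
by apply/funext => k; rewrite /sum_prod /tensor_eval /= /tm /tensor_map big_map.
Qed.

Lemma cube_pullback_norm_le : tensor_norm H1 cube_pullback <= unit_bound T alpha ^+ s * N.
Proof.
have ub0 : 0 <= unit_bound T alpha by exact: sqrtr_ge0.
have [N' uN' N'N] := tensor_map_norm_le pH (psd_to_unit T2 alpha2) (to_unit_le T2 alpha2)
  ub0 uF.1 uN.
by apply: le_trans N'N; exact: tensor_norm_le cube_pullback_represents uN'.
Qed.

End limit.

Lemma error_le (n : nat) (y : nat -> s.-tuple R) (lambda : R) (F : s.-tuple R -> R) :
  unit_cube_error_bound alpha n y -> 1 <= lambda < alpha%:R -> tensor_mem H F ->
  0 < Ctilde alpha lambda s -> (0 < s)%N ->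
  `| \int[lebesgue_tuple R s]_x (F x * rho_prod x) - quadrature T n y F | <=
  (s%:R * (B ^+ s * tau) + Ctilde alpha lambda s * n%:R `^ (- lambda) * unit_bound T alpha ^+ s) *
  tensor_norm H F.
Proof.
move=> hb hl [u0 uF0] Ct0 s0; set K := (X in _ <= X * tensor_norm H F).
have K0 : 0 < K.
  rewrite /K ltr_pwDl//; last by rewrite mulr_ge0 ?exprn_ge0 ?sqrtr_ge0// mulr_ge0 ?powR_ge0// ltW.
  have Bp : 0 < B by rewrite mulr_gt0// exprn_gt0.
  by rewrite mulr_gt0 ?ltr0n// mulr_gt0 ?expR_gt0// exprn_gt0.
(* Since [K] is positive, the error divided by [K] need only be a lower bound of the set of limit
   norms, which is not empty because norms of Cauchy sequences converge. *)
rewrite -ler_pdivrMl//; apply: lb_le_inf.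
  have /cvg_ex[N hN] := tensor_cauchy_norm_cvg pH uF0.1.
  by exists N; exists u0.
move=> N [u uF uN]; rewrite ler_pdivrMl//.
have h1 := full_cube_le uF uN.
have fm : tensor_mem H1 (cube_pullback F) by eexists; exact: cube_pullback_represents uF.
have h2 := hb lambda hl (cube_pullback F) fm.
have h3 := cube_pullback_norm_le uF uN.
have qE : n%:R^-1 * \sum_(i < n) cube_pullback F (y i) = quadrature T n y F.
  by rewrite /quadrature /cube_pullback -mulr_sumr mulrA [_^-1 * _]mulrC.
rewrite qE in h2.
set I1 := \int[_]_y (_ * _) in h1 *; set I2 := \int[_]_(_ in _) _ in h1 h2.
rewrite (_ : I1 - _ = (I1 - I2) + (I2 - quadrature T n y F)); last by rewrite addrA subrK.
apply: le_trans (ler_normD _ _) _; rewrite /K mulrDl lerD//.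
apply: le_trans h2 _; rewrite -[leRHS]mulrA ler_wpM2l//.
by rewrite mulr_ge0 ?powR_ge0// ltW.
Qed.

End error.

(** * Constants *)

Section gamma_integer.
Context {R : realType}.
Local Notation mu := (@lebesgue_measure R).
Implicit Types (k : nat) (t : R).

(** The primitive of t^k exp(- t) that vanishes at infinity, by iterated integration by parts. *)
Fixpoint gamma_primitive k t : R :=
  if k is k'.+1 then k%:R * gamma_primitive k' t - t ^+ k * expR (- t) else - expR (- t).

Lemma is_derive_gamma_primitive k t :
  is_derive t 1 (gamma_primitive k) (t ^+ k * expR (- t)).
Proof.
elim: k => [|k IH].
  by apply: is_derive_eq; rewrite /GRing.scale/= expr0; ring.
have dE : is_derive t 1 (fun t => expR (- t)) (- expR (- t)).
  by apply: is_derive_eq; rewrite /GRing.scale/=; ring.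
have dc : is_derive t 1 (fun t => k.+1%:R * gamma_primitive k t) (k.+1%:R * (t ^+ k * expR (- t))).
  exact: (@is_deriveZ _ _ _ (gamma_primitive k) _ _ _ _ IH).
have dX : is_derive t 1 (fun t => t ^+ k.+1 * expR (- t)) (k.+1%:R * (t ^+ k * expR (- t)) - t ^+ k.+1 * expR (- t)).
  have dP : is_derive t 1 (fun t => t ^+ k.+1) (k.+1%:R * t ^+ k).
    have := @is_derive_horner R 'X^(k.+1) t; rewrite derivXn hornerMn hornerXn mulr_natl.
    by under eq_fun do rewrite hornerXn.
  have -> : k.+1%:R * (t ^+ k * expR (- t)) - t ^+ k.+1 * expR (- t) =
      t ^+ k.+1 *: (- expR (- t)) + expR (- t) *: (k.+1%:R * t ^+ k).
    by rewrite -[_ *: _]/(_ * _) -[X in _ = _ + X]/(_ * _); ring.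
  have h := is_deriveM dP dE; exact h.
have -> : t ^+ k.+1 * expR (- t) = k.+1%:R * (t ^+ k * expR (- t)) -
    (k.+1%:R * (t ^+ k * expR (- t)) - t ^+ k.+1 * expR (- t)) by rewrite opprB addrC subrK.
exact: is_deriveB.
Qed.

Lemma gamma_primitive0 k : gamma_primitive k 0 = - k`!%:R.
Proof.
elim: k => [|k /= ->]; first by rewrite /= oppr0 expR0.
by rewrite expr0n mul0r subr0 factS natrM mulrN.
Qed.

Lemma exprn_expRN_cvg0 k : t ^+ k * expR (- t) @[t --> +oo] --> (0 : R).
Proof.
apply: (@squeeze_cvgr _ _ _ _ (cst 0) (fun t => k.+1`!%:R * t^-1)); last 2 first.
- exact: cvg_cst.
- rewrite -[X in _ --> X](mulr0 (k.+1`!%:R)); apply: cvgM; first exact: cvg_cst.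
  apply/(gtr0_cvgV0 (f := id)); first exact: nbhs_pinfty_gt.
  exact: cvg_id.
near=> t; have t0 : 0 < t by near: t; exact: nbhs_pinfty_gt.
apply/andP; split; first by rewrite /cst mulr_ge0 ?expR_ge0// exprn_ge0// ltW.
rewrite expRN ler_pdivrMr ?expR_gt0// mulrAC ler_pdivlMr// -exprSr.
have := @expR_ge_sum R t k.+2 (ltW t0); rewrite big_ord_recr/=.
have : 0 <= \sum_(i < k.+1) t ^+ i / i`!%:R.
  by apply: sumr_ge0 => i _; rewrite divr_ge0// exprn_ge0// ltW.
set S := \sum_(i < _) _ => S0 SE.
have : t ^+ k.+1 / k.+1`!%:R <= expR t by lra.
by rewrite ler_pdivrMr ?ltr0n ?fact_gt0// mulrC.
Unshelve. all: by end_near. Qed.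

Lemma gamma_primitive_cvg0 k : gamma_primitive k t @[t --> +oo] --> (0 : R).
Proof.
elim: k => [|k IH] /=.
  rewrite -[X in _ --> X]oppr0; apply: cvgN.
  have := @exprn_expRN_cvg0 0; apply: cvg_trans; apply: near_eq_cvg.
  by apply: nearW => t; rewrite expr0 mul1r.
rewrite -[X in _ --> X]subr0 -[X in X - _](mulr0 (k.+1%:R)).
by apply: cvgB; [apply: cvgM; [exact: cvg_cst|exact: IH]|exact: exprn_expRN_cvg0].
Qed.

Lemma Gamma_nat k : Gamma (k.+1%:R : R) = k`!%:R.
Proof.
rewrite /Gamma; pose f t : R := t ^+ k * expR (- t).
have cF : continuous (gamma_primitive k).
  move=> t; apply/differentiable_continuous/derivable1_diffP.
  by have [] := is_derive_gamma_primitive k t.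
have cf : continuous f.
  move=> t; apply: cvgM; first exact: exprn_continuous.
  by apply: continuous_comp; [exact: cvgN|exact: continuous_expR].
have E : \int[mu]_(t in `[0, +oo[) f t = k`!%:R.
  rewrite (@Rintegral_ge0_continuous_FTC2y _ f (gamma_primitive k) 0 0).
  - by rewrite gamma_primitive0 opprK add0r.
  - by move=> t t0; rewrite mulr_ge0 ?exprn_ge0 ?expR_ge0.
  - exact: continuous_subspaceT.
  - exact: gamma_primitive_cvg0.
  - by move=> t _; have [] := is_derive_gamma_primitive k t.
  - by apply: cvg_at_right_filter; exact: cF.
  - by move=> t _; rewrite derive1E; have [] := is_derive_gamma_primitive k t.
rewrite -E /Rintegral; congr fine; rewrite -[RHS]integral_itv_obnd_cbnd; last first.
  by apply/measurable_EFinP; apply: measurable_funTS; exact: continuous_measurable_fun.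
apply: eq_integral => t; rewrite inE/= in_itv/= andbT => t0; congr EFin.
by rewrite /f -natr1 addrK powR_mulrn// ltW.
Qed.

End gamma_integer.

Section bessel.
Context {R : realType}.

Lemma bessel_I0_ge1 : 1 <= bessel_I0 (1 / 2 : R).
Proof.
rewrite /bessel_I0; set c := fun k : nat => _.
have c0 k : 0 <= c k by exact: sqr_ge0.
have cv : cvgn (series c).
  apply: (@series_le_cvg _ _ (geometric 1 (1 / 2))) => //.
  - by move=> k; rewrite /geometric/= mul1r exprn_ge0.
  - move=> k; rewrite /geometric/= mul1r /c exprMn.
    have f1 : (k`!%:R^-1) ^+ 2 <= 1 :> R.
      rewrite expr_le1 ?invr_ge0// invf_le1 ?ltr0n ?fact_gt0//.
      by rewrite ler1n fact_gt0.
    apply: (@le_trans _ _ (((1 / 2 / 2) ^+ k) ^+ 2)).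
      by rewrite ler_piMr ?sqr_ge0.
    rewrite -exprM mulnC exprM; apply: lerXn2r; rewrite ?nnegrE; lra.
  - by apply: is_cvg_geometric_series; rewrite ger0_norm; lra.
have nd : nondecreasing_seq (series c) by apply: nondecreasing_series.
apply: le_trans (nondecreasing_cvgn_le nd cv 1%N).
by rewrite /series/= big_nat1 /c expr0 fact0 divr1 expr1n.
Qed.

End bessel.

Section constants.
Context {R : realType}.

Lemma C1_ge0 alpha : 0 <= C1 alpha :> R.
Proof. by rewrite /C1 mulr_ge0 ?sqrtr_ge0// mulr_ge0 ?exprn_ge0. Qed.

(** Here 1 / sqrt(2 pi) is bounded below by 1 / 3 and the Bessel function by its first term 1;
    [Gamma] at an integer is a factorial. *)
Lemma C1_sqr_ge alpha : (2 <= alpha)%N ->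
  (alpha`!%:R ^+ 2 * (2 ^+ (6 * alpha))) *
  (alpha%:R * (1 + alpha%:R / 2) / 3 * (2 * alpha - 1)`!%:R) <= C1 alpha ^+ 2 :> R.
Proof.
move=> a2; rewrite /C1 -[in Gamma _](prednK (_ : 0 < 2 * alpha)%N); last by lia.
rewrite Gamma_nat !exprMn -subn1.
have -> : (2 ^+ (3 * alpha)) ^+ 2 = 2 ^+ (6 * alpha) :> R by rewrite -exprM; congr (_ ^+ _); lia.
have /andP[s2 s3] := @sqrt2pi_bounds R.
have I1 := @bessel_I0_ge1 R.
set q := 1 / Num.sqrt _; have q3 : 1 / 3 <= q.
  by rewrite /q ler_pdivlMr ?ler_pdivrMl; lra.
set f : R := (2 * alpha - 1)`!%:R; have f0 : 0 <= f by [].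
set b : R := alpha%:R * (1 + alpha%:R / 2); have b0 : 0 <= b.
  by rewrite mulr_ge0// addr_ge0// divr_ge0.
rewrite sqr_sqrtr; last first.
  by rewrite !mulr_ge0//; lra.
rewrite ler_wpM2l//.
have b1 : b / 3 * f <= b * q * f.
  by rewrite ler_wpM2r// ler_wpM2l//; lra.
apply: (le_trans b1); rewrite ler_peMr// mulr_ge0// mulr_ge0//; lra.
Qed.

(** The factor 9 / 4 is the square of 3 / 2. After cancellation, 400 * 8 / 9 is compared for alpha
    >= 3 with a quantity that contains (2 alpha - 1)! >= 120; alpha = 2 is numerical. *)
Lemma unit_const_le alpha : (2 <= alpha)%N ->
  2 ^+ alpha.*2.+1 * (400 * jet_const alpha ^+ 2) <= 9 / 4 * C1 alpha ^+ 2 :> R.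
Proof.
move=> a2; apply: (@le_trans _ _ (9 / 4 * ((alpha`!%:R ^+ 2 * (2 ^+ (6 * alpha))) *
  (alpha%:R * (1 + alpha%:R / 2) / 3 * (2 * alpha - 1)`!%:R)))); last first.
  by rewrite ler_pM2l//; exact: C1_sqr_ge.
rewrite /jet_const; have [->|a2'] := eqVneq alpha 2%N.
  rewrite -[(2 * 2 - 1)`!]/6%N -[2`!]/2%N -[2.*2.+1]/5%N -[(6 * 2)%N]/12%N.
  by rewrite -!natrX; lra.
have a3 : (3 <= alpha)%N by rewrite ltn_neqAle eq_sym a2'.
have b3 : (3 : R) <= alpha%:R by rewrite ler_nat.
have f5 : (120 : R) <= (2 * alpha - 1)`!%:R.
  by rewrite (ler_nat R 120) -[120%N]/(5`!) leq_fact//; lia.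
have -> : 2 ^+ alpha.*2.+1 * (400 * (alpha`!%:R * 2 ^+ (2 * alpha - 1) * (4 / 3)) ^+ 2) =
    (alpha`!%:R ^+ 2 * 2 ^+ (6 * alpha)) * (400 * (8 / 9)) :> R.
  have -> : (6 * alpha = alpha.*2 + (2 * alpha - 1) * 2 + 2)%N by lia.
  by rewrite exprS !exprD exprM; field.
rewrite [leRHS]mulrCA; apply: ler_wpM2l; first by rewrite mulr_ge0 ?sqr_ge0 ?exprn_ge0.
set f : R := (_)`!%:R in f5 *; set a : R := alpha%:R in b3 *.
have h : 15 / 2 <= a * (1 + a / 2) by nra.
set c := a * _ in h *; have : 15 / 2 * 120 <= c * f by apply: ler_pM => //; lra.
by lra.
Qed.

(** In this form 16 * 2^alpha is at most one eighth of 2 C1, the share reserved for the truncation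
    error. *)
Lemma cube_const_le alpha : (2 <= alpha)%N -> 64 * 2 ^+ alpha <= C1 alpha :> R.
Proof.
move=> a2; rewrite -ler_sqr ?nnegrE ?C1_ge0 ?mulr_ge0 ?exprn_ge0//.
apply: le_trans (C1_sqr_ge a2); rewrite exprMn.
have f2 : (2 : R) ^+ 2 <= alpha`!%:R ^+ 2.
  by apply: lerXn2r; rewrite ?nnegrE// (ler_nat R 2) -[2%N]/(2`!) leq_fact.
have b2 : (2 : R) <= alpha%:R by rewrite ler_nat.
have f6 : (6 : R) <= (2 * alpha - 1)`!%:R.
  by rewrite (ler_nat R 6) -[6%N]/(3`!) leq_fact//; lia.
have c8 : 8 <= alpha%:R * (1 + alpha%:R / 2) / 3 * (2 * alpha - 1)`!%:R :> R.
  apply: (@le_trans _ _ (4 / 3 * 6)); first by lra.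
  by apply: ler_pM => //; nra.
have p : 64 ^+ 2 * (2 ^+ alpha) ^+ 2 <= 2 ^+ 2 * 2 ^+ (6 * alpha) * 8 :> R.
  have -> : (64 : R) ^+ 2 = 2 ^+ 12 by rewrite -!natrX.
  have -> : (8 : R) = 2 ^+ 3 by rewrite -natrX.
  rewrite -exprM -!exprD; apply: ler_weXn2l; first by rewrite ler1n.
  by lia.
apply: (le_trans p); apply: ler_pM => //; rewrite ?exprn_ge0//.
by rewrite ler_wpM2r// exprn_ge0.
Qed.

Lemma bernoulli_le (x : R) n : 0 <= x -> n%:R * x <= (1 + x) ^+ n - 1.
Proof.
move=> x0; elim: n => [|n IH]; first by rewrite mul0r expr0 subrr.
rewrite exprS -natr1; have e1 : 1 <= (1 + x) ^+ n by rewrite exprn_ege1// lerDl.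
set e := (1 + x) ^+ n in IH e1 *; nra.
Qed.

(** The truncation error carries no factor [Ctilde]; this bound lets it be absorbed. With P =
    2^(alpha / lambda), Bernoulli gives a base of at least alpha / P, hence a power of at least
    alpha 2^-alpha, and the other factors are at least 4 * 2^(alpha - 1). *)
Lemma Ctilde_ge1 alpha (lambda : R) s : (2 <= alpha)%N -> 1 <= lambda < alpha%:R -> (0 < s)%N ->
  1 <= Ctilde alpha lambda s.
Proof.
move=> a2 /andP[l1 la] s0; rewrite /Ctilde.
have l0 : 0 < lambda by exact: lt_le_trans l1.
have b2 : (2 : R) <= alpha%:R by rewrite ler_nat.
set P : R := 2 `^ (alpha%:R / lambda).
have P2 : 2 < P.
  rewrite -[ltLHS](powRr1 (ler0n _ 2)) /P /powR gt_eqF// ltr_expR ltr_pM2r ?ln_gt0 ?ltr1n//.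
  by rewrite ltr_pdivlMr// mul1r.
have x0 : P^-1 <= 1 / (P - 2).
  by rewrite div1r lef_pV2 ?posrE; lra.
have x1 : 0 <= 1 / (P - 2) by rewrite divr_ge0; lra.
have low : alpha%:R / P <= (1 + 1 / (P - 2)) ^+ (alpha * s) - 1.
  apply: le_trans (bernoulli_le (alpha * s) x1).
  apply: ler_pM => //; first by rewrite invr_ge0; lra.
  by rewrite ler_nat leq_pmulr.
have low' : alpha%:R * 2 `^ (- alpha%:R) <= ((1 + 1 / (P - 2)) ^+ (alpha * s) - 1) `^ lambda.
  have aP0 : 0 <= alpha%:R / P by rewrite divr_ge0//; lra.
  apply: le_trans (ge0_ler_powR (ltW l0) _ _ low); rewrite ?nnegrE//; last exact: le_trans low.
  rewrite powRM// ?invr_ge0; [|lra..].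
  have -> : P^-1 `^ lambda = 2 `^ (- alpha%:R).
    by rewrite /P -powRN -powRrM mulNr divfK// gt_eqF.
  rewrite ler_wpM2r ?powR_ge0// -[leLHS](powRr1 (ler0n _ alpha)).
  by apply: ler_powR => //; lra.
have e4 : 4 <= 4 `^ lambda :> R.
  by rewrite -[leLHS](powRr1 (ler0n _ 4)); apply: ler_powR => //; lra.
have e2 : 2 `^ (alpha%:R - 1) <= 2 `^ ((alpha * (alpha - 1) * s)%:R / 2) :> R.
  apply: ler_powR; first by lra.
  rewrite ler_pdivlMr// -(natrB _ (ltnW a2)) -natrM ler_nat.
  have : (2 * (alpha - 1) <= alpha * (alpha - 1))%N by rewrite leq_mul2r a2 orbT.
  by move=> h; rewrite mulnC (leq_trans h)// leq_pmulr.
have p1 : 1 <= 4 * 2 `^ (alpha%:R - 1) * (alpha%:R * 2 `^ (- alpha%:R)) :> R.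
  have pp : 2 `^ (alpha%:R - 1) * 2 `^ (- alpha%:R) = 1 / 2 :> R.
    rewrite -powRD; last by rewrite pnatr_eq0 implybT.
    by rewrite addrAC subrr sub0r powRN powRr1// div1r.
  have -> : 4 * 2 `^ (alpha%:R - 1) * (alpha%:R * 2 `^ (- alpha%:R)) =
    4 * alpha%:R * (2 `^ (alpha%:R - 1) * 2 `^ (- alpha%:R)) :> R by ring.
  by rewrite pp; lra.
apply: (le_trans p1); apply: ler_pM => //.
by apply: ler_pM => //; rewrite powR_ge0.
Qed.

End constants.

Section final_arithmetic.
Context {R : realType}.
Implicit Types (T lambda : R) (alpha s : nat).

Lemma unit_bound_le alpha T : (2 <= alpha)%N -> 2 <= T ->
  unit_bound T alpha <= 3 / 4 * (2 * C1 alpha * T `^ (alpha%:R + 1 / 2)).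
Proof.
move=> a2 T2; have T0 : 0 <= T by lra.
set Y := T `^ _; have Y0 : 0 <= Y by exact: powR_ge0.
have C0 := @C1_ge0 R alpha.
have Y2 : Y ^+ 2 = T ^+ alpha.*2.+1.
  rewrite -!powR_mulrn ?powR_ge0// /Y -powRrM; congr (_ `^ _).
  have -> : alpha.*2.+1%:R = 2 * alpha%:R + 1 :> R by rewrite -natr1 -mul2n natrM.
  by lra.
have XE : 3 / 4 * (2 * C1 alpha * Y) = Num.sqrt ((3 / 4 * (2 * C1 alpha * Y)) ^+ 2).
  by rewrite sqrtr_sqr ger0_norm// !mulr_ge0.
rewrite XE /unit_bound; apply: ler_wsqrtr.
have -> : (3 / 4 * (2 * C1 alpha * Y)) ^+ 2 = Y ^+ 2 * (9 / 4 * C1 alpha ^+ 2) by field.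
rewrite Y2 exprMn -(mulrA (2 ^+ _)) mulrCA ler_wpM2l ?exprn_ge0//.
exact: unit_const_le.
Qed.

Lemma cube_bound_le alpha T : (2 <= alpha)%N -> 2 <= T ->
  16 * 2 ^+ alpha <= 1 / 8 * (2 * C1 alpha * T `^ (alpha%:R + 1 / 2)).
Proof.
move=> a2 T2; have := @cube_const_le R alpha a2.
have Y1 : 1 <= T `^ (alpha%:R + 1 / 2).
  rewrite -[leLHS](powRr0 T); apply: ler_powR; first by lra.
  by rewrite addr_ge0.
have C0 := @C1_ge0 R alpha; set Y := _ `^ _ in Y1 *; set p : R := 2 ^+ alpha.
move=> pC; have : C1 alpha * 1 <= C1 alpha * Y by rewrite ler_wpM2l.
by lra.
Qed.

(** As s / 8^s <= 1 / 8 and (3 / 4)^s <= 3 / 4, the two terms add up to at most (1 / 8 + 3 / 4) Ct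
    X^s. *)
Lemma combine_bounds (B U X Ct : R) s : (0 < s)%N -> 0 <= B -> 0 <= U -> 1 <= Ct ->
  B <= 1 / 8 * X -> U <= 3 / 4 * X -> s%:R * B ^+ s + Ct * U ^+ s <= Ct * X ^+ s.
Proof.
move=> s0 B0 U0 Ct1 BX UX; have X0 : 0 <= X by lra.
have hB : s%:R * B ^+ s <= 1 / 8 * X ^+ s.
  have h8 : s%:R * (1 / 8) ^+ s <= 1 / 8 :> R.
    have : forall k, k.+1%:R * (1 / 8) ^+ k.+1 <= 1 / 8 :> R.
      elim=> [|k IH]; first by rewrite expr1; lra.
      have e0 : (0 : R) <= (1 / 8) ^+ k.+1 by rewrite exprn_ge0.
      rewrite exprS -[k.+2%:R]natr1 mulrCA; have k1 : (1 : R) <= k.+1%:R by rewrite ler1n.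
      set e := _ ^+ k.+1 in IH e0 *; have : 1 * e <= k.+1%:R * e by rewrite ler_wpM2r.
      by lra.
    by move=> /(_ s.-1); rewrite prednK.
  apply: (@le_trans _ _ (s%:R * (1 / 8 * X) ^+ s)).
    by rewrite ler_wpM2l//; apply: lerXn2r; rewrite ?nnegrE//; lra.
  by rewrite exprMn mulrA ler_wpM2r// exprn_ge0.
have hU : U ^+ s <= 3 / 4 * X ^+ s.
  apply: (@le_trans _ _ ((3 / 4 * X) ^+ s)).
    by apply: lerXn2r; rewrite ?nnegrE//; lra.
  rewrite exprMn ler_wpM2r ?exprn_ge0//.
  by rewrite -[leRHS]expr1; apply: ler_wiXn2l => //; lra.
have p0 : 0 <= X ^+ s by rewrite exprn_ge0.
set p := X ^+ s in hB hU p0 *.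
have h2 : Ct * U ^+ s <= Ct * (3 / 4 * p) by rewrite ler_wpM2l//; lra.
have h3 : 1 * p <= Ct * p by rewrite ler_wpM2r.
by lra.
Qed.

(** Origin of the base in [Cconst]: since L >= ln 2, the constant 2 is at most 2 sqrt(L) / sqrt(ln
    2). *)
Lemma truncation_le (L lambda : R) : ln 2 <= L -> 0 <= lambda ->
  2 + 2 * Num.sqrt (lambda * L) <= (2 / Num.sqrt (ln 2) + 2 * Num.sqrt lambda) * Num.sqrt L.
Proof.
move=> L2 l0; have l2 : 0 < ln 2 :> R by rewrite ln_gt0// ltr1n.
rewrite sqrtrM//; set a := Num.sqrt lambda; set b := Num.sqrt L.
have q0 : 0 < Num.sqrt (ln 2 : R) by rewrite sqrtr_gt0.
have : Num.sqrt (ln 2) <= b by exact: ler_wsqrtr.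
set c := Num.sqrt (ln 2) in q0 * => cb.
have -> : (2 / c + 2 * a) * b = 2 * (b / c) + 2 * (a * b) by ring.
have : 1 <= b / c by rewrite ler_pdivlMr// mul1r.
by lra.
Qed.

End final_arithmetic.

Unset Implicit Arguments.

Theorem theorem2 (R : realType) (s alpha m : nat) (p : {poly 'F_2})
    (q : (alpha * s).-tuple {poly 'F_2}) (lambda : R) (F : s.-tuple R -> R)
    (hs : (1 <= s)%N) (halpha : (2 <= alpha)%N) (hm : (1 <= m)%N)
    (hp : irreducible_poly p) (hpm : size p = m.+1)
    (hq : forall j, (size (tnth q j) <= m)%N)
    (hbound : unit_cube_error_bound alpha (2 ^ m)
                (interlaced_point (R := R) m p q))
    (hlambda : 1 <= lambda < alpha%:R)
    (hF : tensor_mem (H_rho R alpha) F) :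
  let n := (2 ^ m)%N in
  let T := 2 + 2 * Num.sqrt (lambda * ln n%:R) in
  `| \int[lebesgue_tuple R s]_y (F y * rho_prod y)
     - quadrature T n (interlaced_point m p q) F | <=
  Cconst alpha lambda s *
  (ln n%:R `^ ((alpha%:R / 2 + 1 / 4) * s%:R) / n%:R `^ lambda) *
  tensor_norm (H_rho R alpha) F.
Proof.
cbv zeta; set n := (2 ^ m)%N; set T := 2 + 2 * Num.sqrt (lambda * ln n%:R).
have /andP[l1 la] := hlambda; have l0 : 0 <= lambda by lra.
have n0 : (0 : R) < n%:R by rewrite ltr0n expn_gt0.
have l2 : 0 < ln 2 :> R by rewrite ln_gt0// ltr1n.
have L2 : ln 2 <= ln n%:R :> R.
  rewrite ler_ln ?posrE// ler_nat -[leqLHS]expn1 /n.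
  by rewrite leq_exp2l.
set L := ln n%:R in L2.
have L0 : 0 < L by exact: lt_le_trans L2.
have T2 : 2 <= T by rewrite /T lerDl mulr_ge0// sqrtr_ge0.
have Ct1 := Ctilde_ge1 halpha hlambda hs.
have Ct0 : 0 < Ctilde alpha lambda s by exact: lt_le_trans Ct1.
apply: le_trans (error_le halpha T2 hbound hlambda hF Ct0 hs) _.
apply: ler_wpM2r; first exact: tensor_norm_ge0.
have tauE : expR (- (T / 2 - 1) ^+ 2) = n%:R `^ (- lambda).
  have -> : T / 2 - 1 = Num.sqrt (lambda * L) by rewrite /T; lra.
  by rewrite sqr_sqrtr ?mulr_ge0// ?(ltW L0)// /powR gt_eqF// mulNr.
rewrite tauE powRN.
set w := (n%:R `^ lambda)^-1; have w0 : 0 <= w by rewrite invr_ge0 powR_ge0.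
have B0 : 0 <= 16 * 2 ^+ alpha :> R by rewrite mulr_ge0 ?exprn_ge0.
have U0 : 0 <= unit_bound T alpha by exact: sqrtr_ge0.
have := combine_bounds hs B0 U0 Ct1 (cube_bound_le halpha T2) (unit_bound_le halpha T2).
set Bs := (16 * 2 ^+ alpha) ^+ s; set Us := unit_bound T alpha ^+ s.
have -> : s%:R * (Bs * w) + Ctilde alpha lambda s * w * Us =
  (s%:R * Bs + Ctilde alpha lambda s * Us) * w by ring.
rewrite (mulrA (Cconst _ _ _)) => h; apply: ler_wpM2r => //; apply: (le_trans h).
set W : R := 2 / Num.sqrt (ln 2) + 2 * Num.sqrt lambda.
have W0 : 0 <= W by rewrite addr_ge0// ?divr_ge0 ?mulr_ge0 ?sqrtr_ge0.
set P := alpha%:R + 1 / 2 : R.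
have P0 : 0 <= P * s%:R by rewrite mulr_ge0// addr_ge0.
(* From T <= W sqrt(L): half of alpha + 1 / 2 is alpha / 2 + 1 / 4, the exponent of the
   logarithm. *)
have TW : (T `^ P) ^+ s <= W `^ (P * s%:R) * L `^ ((alpha%:R / 2 + 1 / 4) * s%:R).
  rewrite -powR_mulrn ?powR_ge0// -powRrM.
  have -> : L `^ ((alpha%:R / 2 + 1 / 4) * s%:R) = Num.sqrt L `^ (P * s%:R).
    rewrite -powR12_sqrt ?(ltW L0)// -powRrM; congr (_ `^ _).
    by rewrite /P mulrA; congr (_ * _); lra.
  rewrite -powRM ?sqrtr_ge0//; apply: ge0_ler_powR => //; rewrite ?nnegrE.
  - by lra.
  - by rewrite mulr_ge0 ?sqrtr_ge0.
  - exact: truncation_le.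
have C40 : 0 <= C4 alpha lambda s.
  by rewrite /C4; apply: mulr_ge0; [apply: mulr_ge0; [exact: exprn_ge0|exact: ltW]|exact: exprn_ge0 (C1_ge0 _)].
have -> : Ctilde alpha lambda s * (2 * C1 alpha * T `^ P) ^+ s =
    C4 alpha lambda s * (T `^ P) ^+ s by rewrite /C4 !exprMn; ring.
apply: (le_trans (ler_wpM2l C40 TW)); rewrite mulrA; apply: ler_wpM2r; first exact: powR_ge0.
by rewrite /Cconst le_max lexx orbT.
Qed.
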